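(* Let $\Omega\subset\mathbb{R}^2$ be a bounded open polygon. Suppose $u_0\in C_b^4(\Omega)$ is the solution of the local problem $-\Delta u_0=f_0$ on $\Omega$, $u_0=g_0$ on $\partial\Omega$; the family of kernels $\{\gamma_\delta\}$ satisfies the kernel conditions (K1)--(K3) given in the context and $$G(\gamma_\delta):=\sup_{\mathbf{x}\in\widehat\Omega_\delta}\int_{B_\delta(\mathbf{x})\cap\widehat\Omega_\delta}\gamma_\delta(\mathbf{x},\mathbf{y})\,d\mathbf{y}\lesssim\delta^{-2};$$ $\widetilde u_0$ is a $C^4$ extension of $u_0$; and, for $\mu=0$ or $\mu=1$, $$\|f_\delta-f_0\|_{C(\Omega)}=O(\delta^2),\qquad\|g_\delta-\widetilde u_0\|_{C(\Omega_\delta^c)}=O(\delta^{2+\mu}).$$ Let $\{B_{\delta,n_\delta^{\mathbf{x}}}\}$ be a weakly quasi-uniform family of inscribed polygons with $n_\delta\to\infty$ as $\delta\to0$ and $n_\delta\sim\delta/h$, and assume $$|\sigma_{n_\delta}^{i,1}(\mathbf{x})|\to0,\quad i=1,2,\quad\text{as }\delta\to0,\qquad\text{where }\ \sigma_{n_\delta}^{i,1}(\mathbf{x})=\int_{\widehat\Omega_\delta}(y_i-x_i)\gamma_{\delta,n_\delta}(\mathbf{x},\mathbf{y})\,d\mathbf{y}.$$ Let $u_{\delta,n_\delta}$ be the solution of $-\mathcal{L}_{\delta,n_\delta}u_{\delta,n_\delta}=f_\delta$ on $\Omega$, $u_{\delta,n_\delta}=g_\delta$ on $\Omega_\delta^c$,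 and let $u_{\delta,n_\delta}^h$ be its linear conforming DG (CDG) approximation (defined in the context). Then $$\|u_{\delta,n_\delta}-u_{\delta,n_\delta}^h\|_{\delta,n_\delta}\lesssim\delta^{(3+\mu)/2}+\delta^{-1}h^2+\delta^{-\lambda-1}h^\lambda,$$ $$\|u_{\delta,n_\delta}-u_{\delta,n_\delta}^h\|_{L^2(\Omega)}\lesssim\delta^{(3+\mu)/2}+\delta^{-1}h^2+\delta^{-\lambda-1}h^\lambda,$$ where $\lambda=2$ if $\Phi'(1)\ne0$, and $\lambda=4$ if $\Phi'(1)=0$ and $\Phi''(1)\neq0$.
   Context: Notation. $\Omega_\delta^c=\{\mathbf{y}\in\mathbb{R}^2\setminus\Omega:\mathrm{dist}(\mathbf{y},\partial\Omega)<\delta\}$, $\widehat\Omega_\delta=\Omega\cup\Omega_\delta^c$, $B_\delta(\mathbf{x})$ is the Euclidean disc, $\|\cdot\|_{C(D)}$ is the supremum norm on $D$, and $C_b^n(D)$ is the space of functions with continuous bounded derivatives of orders $0,\dots,n$ on $D$. $O(\cdot)$, $\lesssim$ and $\sim$ (two-sided bound) hold for small $\delta,h$ with constants independent of $\delta$ and $h$. A $C^n$ extension of $u$ is a function $\widetilde u\in C^n_b(\widehat\Omega_\delta)$ with $\widetilde u|_\Omega=u$ (a single function, not varying with $\delta$). Kernel conditions. $\gamma_\delta\ge0$ is symmetric and (K1) $\gamma_\delta(\mathbf{x},\mathbf{y})=0$ for $\mathbf{y}\notin B_\delta(\mathbf{x})$; (K2) $\gamma_\delta(\mathbf{x},\mathbf{y})=\widetilde\gamma_\delta(|\mathbf{y}-\mathbf{x}|)$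 with $\widetilde\gamma_\delta(s)>0$ for $0<s<\delta$, $\widetilde\gamma_\delta\in L^1(0,\delta)$, and $2\pi\int_0^\delta s^3\widetilde\gamma_\delta(s)\,ds=2$; (K3) (rescaled form) $\widetilde\gamma_\delta(s)=\delta^{-4}\gamma(s/\delta)$ for a nonnegative function $\gamma$ on $(0,1)$. Define $\Phi(t)=\pi\int_0^t\rho^3\gamma(\rho)\,d\rho$, so $\Phi(1)=1$ and $\Phi'(t)=\pi t^3\gamma(t)$ for $t\in(0,1]$; $\Phi$ is understood to be regular enough near $t=1$ for $\Phi'(1),\Phi''(1)$ to be used in a Taylor expansion. Polygons. For each $\mathbf{x}\in\widehat\Omega_\delta$, $B_{\delta,n_\delta^{\mathbf{x}}}$ is a polygon inscribed in the circle bounding $B_\delta(\mathbf{x})$, with $n_\delta^{\mathbf{x}}$ sides; $n_\delta=\sup_{\mathbf{x}}n_\delta^{\mathbf{x}}$. $H_{n_\delta^{\mathbf{x}}}$ is the length of its longest side and $r_{\delta,\mathbf{x}}$ is the radius of the largest circle centered at $\mathbf{x}$ contained in it. The family is weakly quasi-uniform if there are constants $C_1,C_2>0$ such that for all $\delta>0$, $\sup_{\mathbf{x}}\frac{H_{n_\delta^{\mathbf{x}}}}{2\sin(\pi/n_\delta^{\mathbf{x}})}\le C_1\delta$ and $\inf_{\mathbf{x}}r_{\delta,\mathbf{x}}\ge C_2\delta$, with sup/inf over $\mathbf{x}\in\widehat\Omega_\delta$. Kernel, operator and norm: with $B'_{\delta,n_\delta^{\mathbf{x}}}=\{\mathbf{y}\in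 B_\delta(\mathbf{x}):\mathbf{x}\in B_{\delta,n_\delta^{\mathbf{y}}}\}$ and $\chi$ denoting indicator functions, $$\gamma_{\delta,n_\delta}(\mathbf{x},\mathbf{y})=\tfrac12\gamma_\delta(\mathbf{x},\mathbf{y})\big(\chi_{B_{\delta,n_\delta^{\mathbf{x}}}}(\mathbf{y})+\chi_{B'_{\delta,n_\delta^{\mathbf{x}}}}(\mathbf{y})\big);$$ $\mathcal{L}_{\delta,n_\delta}u(\mathbf{x})=2\int_{\mathbb{R}^2}(u(\mathbf{y})-u(\mathbf{x}))\gamma_{\delta,n_\delta}(\mathbf{x},\mathbf{y})\,d\mathbf{y}$ for $\mathbf{x}\in\Omega$; and $\|u\|_{\delta,n_\delta}=\big(\int_{\widehat\Omega_\delta}\int_{\widehat\Omega_\delta}(u(\mathbf{y})-u(\mathbf{x}))^2\gamma_{\delta,n_\delta}(\mathbf{x},\mathbf{y})\,d\mathbf{y}\,d\mathbf{x}\big)^{1/2}$. CDG approximation. $\mathcal{T}_\delta^h$ is a triangulation of $\widehat\Omega_\delta$ that simultaneously triangulates $\Omega$, quasi-uniform with mesh size $h<\delta$. $V_\delta^{0,h}$ is the space of functions that are continuous piecewise linear on the triangulation of $\overline\Omega$ and zero on the rest (possibly jumping across $\partial\Omega$). $V_\delta^{c,h}$ is the space of functions that are continuous piecewise linear on the triangulation of $\overline{\Omega_\delta^c}$ and zero on $\Omega$. $g_\delta^h\in V_\delta^{c,h}$ is an approximation of $g_\delta$ with $\|g_\delta-g_\delta^h\|_{C(\Omega_\delta^c)}\lesssim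 h^2$. Find $u_{\delta,n_\delta}^{0,h}\in V_\delta^{0,h}$ such that for all $w_h\in V_\delta^{0,h}$, $$-2\int_\Omega w_h(\mathbf{x})\int_\Omega\big(u_{\delta,n_\delta}^{0,h}(\mathbf{y})-u_{\delta,n_\delta}^{0,h}(\mathbf{x})\big)\gamma_{\delta,n_\delta}(\mathbf{x},\mathbf{y})\,d\mathbf{y}\,d\mathbf{x}=\int_\Omega f_\delta w_h\,d\mathbf{x}+2\int_\Omega w_h(\mathbf{x})\int_{\Omega_\delta^c}\big(g_\delta^h(\mathbf{y})-u_{\delta,n_\delta}^{0,h}(\mathbf{x})\big)\gamma_{\delta,n_\delta}(\mathbf{x},\mathbf{y})\,d\mathbf{y}\,d\mathbf{x},$$ and set $u_{\delta,n_\delta}^h=u_{\delta,n_\delta}^{0,h}+g_\delta^h$.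
   Formalization: The condition n_δ ~ δ/h is required uniformly in x (every n_δ^x is bounded below by a multiple of δ/h), not only for the supremum n_δ; with the supremum alone the estimate fails, e.g. for thin stripes alternating many-sided polygons with triangles. *)

(* Defs.v *)
From HB Require Import structures.
From mathcomp Require Import all_boot all_order all_algebra.
From mathcomp Require Import all_classical all_reals all_analysis.

Set Implicit Arguments.
Unset Strict Implicit.
Unset Printing Implicit Defensive.
Import Order.TTheory GRing.Theory Num.Theory.
Import numFieldNormedType.Exports.
Local Open Scope classical_set_scope.
Local Open Scope ring_scope.

Notation plane R := (measurableTypeR R * measurableTypeR R)%type.

Section Geometry.
Context {R : realType}.
Local Notation P := (R * R)%type.
Implicit Types (x y : P) (A : set P) (r d : R).

(* The norm of the product type R * R is the maximum norm, so the Euclidean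
   distance is spelled out. *)
Definition ed x y : R := Num.sqrt ((y.1 - x.1) ^+ 2 + (y.2 - x.2) ^+ 2).

Definition disc x r : set P := [set y | ed x y < r].

Definition dist y A : R := inf [set ed y z | z in A].

Definition frontier A : set P := closure A `\` interior A.

Definition conv_hull A : set P :=
  [set p | exists (k : nat) (v : 'I_k -> P) (w : 'I_k -> R),
     [/\ forall i, A (v i), forall i, 0 <= w i, \sum_i w i = 1
       & p = (\sum_i w i * (v i).1, \sum_i w i * (v i).2)]].

Definition segment x y : set P := conv_hull [set x; y].

(* A bounded open set whose boundary is a simple closed polygonal chain; by the
   Jordan curve theorem it is the region enclosed by the chain. *)
Definition open_polygon (Om : set P) : Prop :=
  [/\ open Om, Om !=set0, bounded_set Om
    & exists (m : nat) (v : 'I_m -> P),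
      [/\ (3 <= m)%N, injective v,
          frontier Om = \bigcup_i segment (v i) (v (ordS i))
        & forall i j, i != j ->
            segment (v i) (v (ordS i)) `&` segment (v j) (v (ordS j))
            `<=` [set v i; v (ordS i)] `&` [set v j; v (ordS j)]]].

Definition Oc (Om : set P) d : set P :=
  [set y | ~ Om y /\ dist y (frontier Om) < d].

Definition Oh (Om : set P) d : set P := Om `|` Oc Om d.

End Geometry.

Section Smoothness.
Context {R : realType}.
Local Notation P := (R * R)%type.
Implicit Types (D : set P) (f u : P -> R).

Definition e1 : P := (1, 0).
Definition e2 : P := (0, 1).

(* To be used on open sets D, where the partial derivatives of a total function
   f at points of D only depend on the restriction of f to D. *)
Fixpoint Cb (n : nat) D f : Prop :=
  [/\ {within D, continuous f}, exists M : R, forall x, D x -> `|f x| <= M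
    & match n with
      | 0 => True
      | k.+1 =>
          [/\ forall x, D x -> derivable f x e1 /\ derivable f x e2,
              Cb k D ('D_e1 f) & Cb k D ('D_e2 f)]
      end].

Definition laplacian u : P -> R := fun x => 'D_e1 ('D_e1 u) x + 'D_e2 ('D_e2 u) x.

Definition supnorm D f : \bar R := ereal_sup [set (`|f x|)%:E | x in D].

Definition local_solution (Om : set P) (f0 g0 u0 : P -> R) : Prop :=
  (forall x, Om x -> - laplacian u0 x = f0 x) /\
  (forall z, frontier Om z -> u0 x @[x --> within Om (nbhs z)] --> g0 z).

End Smoothness.

Section Measure.
Context {R : realType}.

Definition leb2 : {measure set (plane R) -> \bar R} :=
  (@lebesgue_measure R \x @lebesgue_measure R)%E.

Definition L2norm (D : set (plane R)) (u : plane R -> R) : \bar R :=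
  ('N[leb2]_(2%:E)[EFin \o (u \_ D)])%E.

End Measure.

Section Kernel.
Context {R : realType}.
Local Notation P := (R * R)%type.
Implicit Types (d : R) (gam : P -> P -> R) (gt g : R -> R).

(* The conditions at one value d of the horizon; gt is the radial profile and g
   the rescaled profile, of which only the values on ]0, 1[ matter. *)
Record kernel_conditions d gam gt g : Prop := {
  kernel_ge0 : forall x y, 0 <= gam x y;
  kernel_sym : forall x y, gam x y = gam y x;
  kernel_K1 : forall x y, ~ disc x d y -> gam x y = 0;
  kernel_K2_radial : forall x y, disc x d y -> gam x y = gt (ed x y);
  kernel_K2_gt0 : forall s : R, 0 < s < d -> 0 < gt s;
  kernel_K2_L1 : (@lebesgue_measure R).-integrable `]0, d[ (EFin \o gt);
  kernel_K2_moment :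
    2 * pi * (\int[@lebesgue_measure R]_(s in `]0, d[) (s ^+ 3 * gt s)) = 2;
  kernel_K3 : forall s : R, 0 < s < d -> gt s = d ^- 4 * g (s / d)
}.

Definition Gker (Om : set P) d gam : \bar R :=
  ereal_sup [set (\int[leb2]_(y in disc x d `&` Oh Om d) (gam x y)%:E)%E
            | x in Oh Om d].

Definition Phi g (t : R) : R :=
  pi * (\int[@lebesgue_measure R]_(r in `]0, t[) (r ^+ 3 * g r)).

(* F is differentiable near 1 on the left, and F'(1) = a and F''(1) = b as left
   derivatives.  Only the left side is relevant, kernels being truncated
   at 1. *)
Definition left_derivatives_at1 (F : R -> R) (a b : R) : Prop :=
  [/\ \forall t \near 1^'-, derivable F t 1,
      (F t - F 1) / (t - 1) @[t --> 1^'-] --> a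
    & (derive1 F t - a) / (t - 1) @[t --> 1^'-] --> b].

End Kernel.

Section Polygons.
Context {R : realType}.
Local Notation P := (R * R)%type.
Implicit Types (d : R) (x : P).

(* A polygon inscribed in a circle is given by the arguments of its vertices,
   listed counterclockwise over one full turn. *)
Record polygon := Polygon { sides : nat; angle : nat -> R }.

Definition polygon_ok (Q : polygon) : Prop :=
  [/\ (3 <= sides Q)%N,
      forall k, (k < sides Q)%N -> angle Q k < angle Q k.+1
    & angle Q (sides Q) = angle Q 0 + 2 * pi].

Definition vertex d x (Q : polygon) (k : nat) : P :=
  (x.1 + d * cos (angle Q k), x.2 + d * sin (angle Q k)).

Definition poly_set d x (Q : polygon) : set P :=
  conv_hull [set vertex d x Q k | k in [set k | (k < sides Q)%N]].

Definition longest_side d x (Q : polygon) : R :=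
  \big[Num.max/0]_(k < sides Q) ed (vertex d x Q k) (vertex d x Q k.+1).

Definition inradius d x (Q : polygon) : R :=
  sup [set r | 0 <= r /\ disc x r `<=` poly_set d x Q].

Implicit Types (Om : set P) (Q : R -> P -> polygon).

(* Joint measurability of the family is what gives a meaning to the integrals
   of the truncated kernel in both variables. *)
Definition polygon_family Om Q : Prop :=
  forall d : R, 0 < d ->
    (forall x, Oh Om d x -> polygon_ok (Q d x)) /\
    measurable ([set z | Oh Om d z.1 /\ poly_set d z.1 (Q d z.1) z.2]
                : set (plane R * plane R)).

Definition weakly_quasi_uniform Om Q : Prop :=
  exists C1 C2 : R, [/\ 0 < C1, 0 < C2 & forall d : R, 0 < d ->
    (ereal_sup [set (longest_side d x (Q d x) /
                      (2 * sin (pi / (sides (Q d x))%:R)))%:E | x in Oh Om d]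
       <= (C1 * d)%:E)%E /\
    ((C2 * d)%:E <= ereal_inf [set (inradius d x (Q d x))%:E | x in Oh Om d])%E].

Definition max_sides Om Q d : \bar R :=
  ereal_sup [set ((sides (Q d x))%:R)%:E | x in Oh Om d].

Definition min_sides Om Q d : \bar R :=
  ereal_inf [set ((sides (Q d x))%:R)%:E | x in Oh Om d].

End Polygons.

Section Nonlocal.
Context {R : realType}.
Local Notation P := (R * R)%type.
Variables (Om : set P) (d : R) (gam : P -> P -> R) (Q : P -> @polygon R).
Implicit Types (x y : P) (u f g : P -> R).

Definition gamma_n x y : R :=
  2^-1 * gam x y *
  (\1_(poly_set d x (Q x)) y +
   \1_([set z | disc x d z /\ poly_set d z (Q z) x]) y).

Definition Lop u x : R := 2 * (\int[leb2]_y ((u y - u x) * gamma_n x y)).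

Definition energy_norm u : \bar R :=
  ((\int[leb2]_(x in Oh Om d) \int[leb2]_(y in Oh Om d)
     ((u y - u x) ^+ 2 * gamma_n x y)%:E) `^ (2^-1))%E.

(* The first moment along a coordinate c, which is either fst or snd. *)
Definition moment1 (c : P -> R) x : R :=
  \int[leb2]_(y in Oh Om d) ((c y - c x) * gamma_n x y).

Definition nonlocal_solution f g u : Prop :=
  [/\ measurable_fun (Oh Om d : set (plane R)) (u : plane R -> R),
      (L2norm (Oh Om d) u < +oo)%E,
      {ae @leb2 R, forall x, Om x -> - Lop u x = f x}
    & forall y, Oc Om d y -> u y = g y].

End Nonlocal.

Section FiniteElements.
Context {R : realType}.
Local Notation P := (R * R)%type.
Variables (Om : set P) (d : R).

Definition verts (t : P * P * P) : set P := [set t.1.1; t.1.2; t.2].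
Definition tri (t : P * P * P) : set P := conv_hull (verts t).

Definition inner (T : set (P * P * P)) : set (P * P * P) :=
  [set t | T t /\ tri t `<=` closure Om].

(* The outer boundary of Oh Om d contains circular arcs around the convex
   corners of Om, so no set of straight triangles has Oh Om d as its union up to
   boundaries.  Cells touching that outer boundary are therefore triangles
   truncated by it: the triangles cover Oh Om d and each of them meets it. On
   Om the triangulation is exact.  *)
Record triangulation (T : set (P * P * P)) : Prop := {
  tg_finite : finite_set T;
  tg_conforming : forall t t', T t -> T t' ->
    tri t `&` tri t' = conv_hull (verts t `&` verts t');
  tg_cover : Oh Om d `<=` \bigcup_(t in T) tri t;
  tg_meet : forall t, T t -> tri t `&` Oh Om d !=set0;
  tg_inner : closure Om = \bigcup_(t in inner T) tri t
}.

Definition mesh_size (T : set (P * P * P)) : R :=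
  sup [set r | exists t, T t /\ exists a b, [/\ verts t a, verts t b & r = ed a b]].

Definition quasi_uniform (kappa : R) (T : set (P * P * P)) : Prop :=
  forall t, T t -> exists z, disc z (kappa * mesh_size T) `<=` tri t.

Definition affine_on (D : set P) (w : P -> R) : Prop :=
  exists a b c : R, forall x, D x -> w x = a + b * x.1 + c * x.2.

Definition V0 (T : set (P * P * P)) (w : P -> R) : Prop :=
  [/\ {within closure Om, continuous w},
      forall t, inner T t -> affine_on (tri t) w
    & forall x, ~ closure Om x -> w x = 0].

Definition Vc (T : set (P * P * P)) (w : P -> R) : Prop :=
  [/\ {within closure (Oc Om d), continuous w},
      forall t, (T `\` inner T) t -> affine_on (tri t `&` closure (Oc Om d)) w
    & forall x, Om x -> w x = 0].

Definition cdg_solution (gam : P -> P -> R) (Q : P -> @polygon R)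
    (T : set (P * P * P)) (f gh u0h : P -> R) : Prop :=
  V0 T u0h /\
  forall w, V0 T w ->
    - 2 * (\int[leb2]_(x in Om)
        (w x * (\int[leb2]_(y in Om) ((u0h y - u0h x) * gamma_n d gam Q x y))))
    = (\int[leb2]_(x in Om) (f x * w x)) +
      2 * (\int[leb2]_(x in Om)
        (w x * (\int[leb2]_(y in Oc Om d) ((gh y - u0h x) * gamma_n d gam Q x y)))).

End FiniteElements.

(* Main.v *)
Require Import Defs.
From HB Require Import structures.
From mathcomp Require Import all_boot all_order all_algebra.
From mathcomp Require Import all_classical all_reals all_analysis.
From mathcomp Require Import measurable_realfun.
From mathcomp Require Import ring lra.

(* Write e for the error.  The Galerkin solution is the best approximation in the
   energy norm, so that norm of e is at most that of u - w, where w is the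
   interpolant of the local solution ut0 on Om and the discrete data outside.
   Then u - w is the sum of u - ut0 on Om, of the interpolation error (O(h^2))
   and of the boundary error (O(h^2)); since the kernel has mass O(delta^-2), the
   last two have energy O(delta^-2 h^4).

   The first term is controlled by stability: the nonlocal operator applied to
   u - ut0 is the consistency error, and the Poincare inequality and Young's
   inequality bound its energy by the square of the consistency error plus the
   energy of u - ut0 on the strip Oc, which has measure O(delta) and hence
   contributes O(delta^-2 delta^(4 + 2 mu) delta).

   For the consistency error, the polygons contain the discs of radius
   delta (1 - s^2) with s = O(h / delta), so the operator differs from the one with
   a radial kernel only in a thin annulus, where the Lipschitz bound on ut0 costs
   delta^-1 (1 - Phi (1 - s^2)) = O(delta^-1 s^lambda); on the disc the odd moments
   vanish and the Taylor expansion of order four leaves O(delta^2). *)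

Set Implicit Arguments.
Unset Strict Implicit.
Unset Printing Implicit Defensive.
Import Order.TTheory GRing.Theory Num.Theory.
Import numFieldNormedType.Exports.
Local Open Scope classical_set_scope.
Local Open Scope ring_scope.

(** * Integration on the plane *)

(** The Poincare constant must not depend on the horizon. The truncated kernel is therefore
    minorized by the radial kernel on the disc of radius [r0 * d], whose second moment along an axis
    is [Phi g r0] for every [d], by (K3). The inequality itself is a statement on translations: a
    function supported in a strip vanishes after enough translations by the same vector, hence is
    controlled by its increments, and integrating over the vector brings in the kernel. The radius
    [delta (1 - s^2)] is an apothem: a side seen under the angle [2 e] is at distance [delta cos e]
    from the center, and [cos e >= 1 - sin^2 e] with [sin e = O(1 / n) = O(h / delta)]. That
    [h / delta] tends to 0 follows from the divergence of the number of sides and its upper bound.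
    The frontier needs care, because the interior and the exterior discrete functions may both be
    nonzero there while the Galerkin argument sees one value; the two versions of the error differ
    on a null set. *)

Section lebesgue_affine.
Context {R : realType}.
Local Notation mu := (@lebesgue_measure R).
Local Notation RR := (measurableTypeR R).

(** By uniqueness of the Lebesgue measure: [a] times the image of [mu] under [x |-> a * x + b]
    agrees with [mu] on half-open intervals. *)
Lemma lebesgue_measure_affine (a b : R) (A : set RR) : 0 < a -> measurable A ->
  mu [set x | A (a * x + b)] = (a^-1%:E * mu A)%E.
Proof.
move=> a0 mA.
have mphi : measurable_fun setT (fun x : RR => (a * x + b : RR)).
  by apply: measurable_funD => //; apply: measurable_funM.
pose a' : {nonneg R} := NngNum (ltW a0).
pose m : {measure set RR -> \bar R} :=
  mscale a' (pushforward mu (fun x : RR => (a * x + b : RR))).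
have H B : measurable B -> mu B = m mphi B.
  apply: lebesgue_measure_unique => _ [[x y]] _ <- /=.
  rewrite /m/= /mscale /pushforward/=.
  rewrite [X in (_ * mu X)%E](_ : _ = `](x - b) / a, (y - b) / a]%classic); last first.
    apply/seteqP; split => z /=; rewrite !in_itv/= => /andP[xz zy]; apply/andP; split.
    - by rewrite ltr_pdivrMr// mulrC; lra.
    - by rewrite ler_pdivlMr// mulrC; lra.
    - by rewrite ltr_pdivrMr// mulrC in xz; lra.
    - by rewrite ler_pdivlMr// mulrC in zy; lra.
  rewrite !lebesgue_measure_itv/= !lte_fin ltr_pM2r ?invr_gt0//.
  rewrite [in RHS]ltrD2r; case: ifPn => _; last by rewrite mule0.
  by rewrite -EFinB -EFinM; congr EFin; rewrite mulrBl; field; rewrite gt_eqF.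
rewrite (H _ mA) /m/= /mscale/= /pushforward muleA -EFinM mulVf ?gt_eqF// mul1e.
by [].
Qed.

Lemma ge0_integral_affine (a b : R) (F : RR -> \bar R) : 0 < a ->
  measurable_fun setT F -> (forall x, (0 <= F x)%E) ->
  (\int[mu]_x F (a * x + b)%R = a^-1%:E * \int[mu]_x F x)%E.
Proof.
move=> a0 mF F0.
have mphi : measurable_fun setT (fun x : RR => (a * x + b : RR)).
  by apply: measurable_funD => //; apply: measurable_funM.
have ai0 : 0 <= a^-1 by rewrite invr_ge0 ltW.
have := @ge0_integral_pushforward _ _ _ _ R _ mphi mu setT F measurableT mF
  (fun x _ => F0 x).
rewrite preimage_setT => <-.
pose a' : {nonneg R} := NngNum ai0.
rewrite -[RHS](@ge0_integral_mscale _ _ _ mu setT measurableT a' F)//.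
apply: eq_measure_integral => A mA _ /=.
by rewrite /mscale/= -(lebesgue_measure_affine b)//.
Qed.

Lemma ge0_integral_oppr (F : RR -> \bar R) :
  measurable_fun setT F -> (forall x, (0 <= F x)%E) ->
  (\int[mu]_x F (- x)%R = \int[mu]_x F x)%E.
Proof.
move=> mF F0.
have mphi : measurable_fun setT (fun x : RR => (- x : RR)) by exact: oppr_measurable.
have := @ge0_integral_pushforward _ _ _ _ R _ mphi mu setT F measurableT mF
  (fun x _ => F0 x).
rewrite preimage_setT => <-.
apply: eq_measure_integral => A mA _ /=.
by rewrite lebesgue_measureN.
Qed.

End lebesgue_affine.

Section leb2_transform.
Context {R : realType}.
Local Notation mu := (@lebesgue_measure R).
Local Notation RR := (measurableTypeR R).
Local Notation PP := (plane R).
Implicit Types F : PP -> \bar R.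

Lemma leb2X (A B : set RR) : measurable A -> measurable B ->
  (@leb2 R (A `*` B) = mu A * mu B)%E.
Proof. by move=> mA mB; rewrite /leb2/= product_measure1E. Qed.

(** Copy of [leb2] that carries a sigma-finite structure, as required by the Dirichlet form and by
    the exchange of integrals; the two are equal by unfolding. *)
Definition leb2s : set PP -> \bar R := leb2.

HB.instance Definition _ := Measure.on leb2s.

Let leb2s_sigma_finite : sigma_finite setT leb2s.
Proof.
exists (fun n : nat => `]- n%:R, n%:R[%classic `*` `]- n%:R, n%:R[%classic).
  apply/esym/seteqP; split => // -[x y] _ /=.
  have [n xyn] : exists n : nat, Num.max `|x| `|y| < n%:R.
    exists (Num.truncn (Num.max `|x| `|y|)).+1.
    by rewrite truncnS_gt.
  exists n => //=; rewrite !in_itv/= -!ltr_norml.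
  by move: xyn; rewrite gt_max => /andP[].
move=> n; split; first exact: measurableX.
rewrite /leb2s leb2X// !lebesgue_measure_itv/=.
by case: ifPn => _; rewrite ?mul0e// -EFinB -EFinM ltry.
Qed.

HB.instance Definition _ :=
  Measure_isSigmaFinite.Build _ _ _ leb2s leb2s_sigma_finite.

Lemma leb2_tonelli1 F : measurable_fun setT F -> (forall x, (0 <= F x)%E) ->
  (\int[leb2]_z F z = \int[mu]_x \int[mu]_y F (x, y))%E.
Proof. by move=> mF F0; rewrite /leb2/= fubini_tonelli1. Qed.

Lemma leb2_tonelli2 F : measurable_fun setT F -> (forall x, (0 <= F x)%E) ->
  (\int[leb2]_z F z = \int[mu]_y \int[mu]_x F (x, y))%E.
Proof. by move=> mF F0; rewrite /leb2/= fubini_tonelli2. Qed.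

Lemma measurable_pair_affine (a b c d : R) :
  measurable_fun setT (fun z : PP => (a * z.1 + b, c * z.2 + d) : PP).
Proof.
apply/measurable_fun_pairP; split => /=.
  by apply: measurable_funD => //; apply: measurable_funM.
by apply: measurable_funD => //; apply: measurable_funM.
Qed.

Lemma ge0_leb2_affine (a b c d : R) F : 0 < a -> 0 < c ->
  measurable_fun setT F -> (forall x, (0 <= F x)%E) ->
  (\int[leb2]_z F ((a * z.1 + b)%R, (c * z.2 + d)%R) =
   (a * c)^-1%:E * \int[leb2]_z F z)%E.
Proof.
move=> a0 c0 mF F0.
have mF' : measurable_fun setT (fun z : PP => F (a * z.1 + b, c * z.2 + d)).
  exact: (measurableT_comp mF (measurable_pair_affine a b c d)).
rewrite !leb2_tonelli1//=.
under eq_integral => x _.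
  rewrite (@ge0_integral_affine R c d (fun y => F (a * x + b, y)))//; last first.
    exact: measurableT_comp.
  over.
rewrite (@ge0_integral_affine R a b (fun x => (c^-1%:E * \int[mu]_y F (x, y))%E))//.
- rewrite ge0_integralZl//; last first.
  + by rewrite lee_fin invr_ge0 ltW.
  + by move=> x _; apply: integral_ge0.
  + exact: (@measurable_fun_fubini_tonelli_F _ _ RR RR R mu F).
  by rewrite muleA -EFinM invfM.
- apply: measurable_funeM.
  exact: (@measurable_fun_fubini_tonelli_F _ _ RR RR R mu F).
- move=> x; apply: mule_ge0; first by rewrite lee_fin invr_ge0 ltW.
  exact: integral_ge0.
Qed.

Lemma ge0_leb2_shift (p : R * R) F :
  measurable_fun setT F -> (forall x, (0 <= F x)%E) ->
  (\int[leb2]_z F (z + p)%R = \int[leb2]_z F z)%E.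
Proof.
move=> mF F0.
have := @ge0_leb2_affine 1 p.1 1 p.2 F ltr01 ltr01 mF F0.
rewrite mulr1 invr1 mul1e => <-.
by apply: eq_integral => z _; rewrite !mul1r.
Qed.

Lemma ge0_leb2_opp1 F : measurable_fun setT F -> (forall x, (0 <= F x)%E) ->
  (\int[leb2]_z F (- z.1, z.2)%R = \int[leb2]_z F z)%E.
Proof.
move=> mF F0.
have mF' : measurable_fun setT (fun z : PP => F (- z.1, z.2)).
  apply: (measurableT_comp mF).
  exact: (measurable_fun_pair (measurable_funN measurable_fst) measurable_snd).
rewrite (leb2_tonelli2 mF' (fun z => F0 _)) (leb2_tonelli2 mF F0); apply: eq_integral => y _.
by rewrite (@ge0_integral_oppr R (fun x => F (x, y)))//; exact: measurableT_comp.
Qed.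

Lemma ge0_leb2_opp2 F : measurable_fun setT F -> (forall x, (0 <= F x)%E) ->
  (\int[leb2]_z F (z.1, - z.2)%R = \int[leb2]_z F z)%E.
Proof.
move=> mF F0.
have mF' : measurable_fun setT (fun z : PP => F (z.1, - z.2)).
  apply: (measurableT_comp mF).
  exact: (measurable_fun_pair measurable_fst (measurable_funN measurable_snd)).
rewrite (leb2_tonelli1 mF' (fun z => F0 _)) (leb2_tonelli1 mF F0); apply: eq_integral => x _.
by rewrite (@ge0_integral_oppr R (fun y => F (x, y)))//; exact: measurableT_comp.
Qed.

Lemma ge0_leb2_swap F : measurable_fun setT F -> (forall x, (0 <= F x)%E) ->
  (\int[leb2]_z F (z.2, z.1) = \int[leb2]_z F z)%E.
Proof.
move=> mF F0.
have mF' : measurable_fun setT (fun z : PP => F (z.2, z.1)).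
  apply: (measurableT_comp mF).
  exact: (measurable_fun_pair measurable_snd measurable_fst).
by rewrite (leb2_tonelli1 mF' (fun z => F0 _)) (leb2_tonelli2 mF F0).
Qed.

End leb2_transform.

(** * Polar coordinates for radial functions *)

Section polar.
Context {R : realType}.
Local Notation mu := (@lebesgue_measure R).
Local Notation RR := (measurableTypeR R).
Local Notation PP := (plane R).

Definition enorm (z : R * R) : R := Num.sqrt (z.1 ^+ 2 + z.2 ^+ 2).
(** Auxiliary norm: its balls are squares, for which the counterpart of the polar formula is
    elementary. *)
Definition mnorm (z : R * R) : R := Num.max `|z.1| `|z.2|.

Lemma edE (x y : R * R) : ed x y = enorm (y - x).
Proof. by []. Qed.

Lemma enorm_ge0 z : 0 <= enorm z. Proof. exact: sqrtr_ge0. Qed.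

Lemma sqr_enorm z : enorm z ^+ 2 = z.1 ^+ 2 + z.2 ^+ 2.
Proof. by rewrite sqr_sqrtr// addr_ge0 ?sqr_ge0. Qed.

Lemma enormZ (a : R) z : 0 <= a -> enorm (a * z.1, a * z.2) = a * enorm z.
Proof.
by move=> a0; rewrite /enorm/= !exprMn -mulrDr sqrtrM ?sqr_ge0// sqrtr_sqr ger0_norm.
Qed.

Lemma norm1_le_enorm z : `|z.1| <= enorm z.
Proof. by rewrite -sqrtr_sqr /enorm ler_wsqrtr// lerDl sqr_ge0. Qed.

Lemma norm2_le_enorm z : `|z.2| <= enorm z.
Proof. by rewrite -sqrtr_sqr /enorm ler_wsqrtr// lerDr sqr_ge0. Qed.

Lemma measurable_enorm : measurable_fun setT (enorm : PP -> RR).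
Proof.
apply: (measurableT_comp (continuous_measurable_fun (@sqrt_continuous R))).
apply: measurable_funD; apply: measurable_funX.
  exact: measurable_fst.
exact: measurable_snd.
Qed.

Lemma measurable_mnorm : measurable_fun setT (mnorm : PP -> RR).
Proof.
apply: measurable_maxr; apply: measurableT_comp => //.
Qed.

Lemma leb2_mnorm_lt (r : R) : 0 < r ->
  @leb2 R [set z | mnorm z < r] = (4 * r ^+ 2)%:E.
Proof.
move=> r0.
rewrite (_ : [set z | _] = `]- r, r[%classic `*` `]- r, r[%classic); last first.
  apply/seteqP; split => -[x y]/=; rewrite /mnorm/= gt_max !in_itv/= !ltr_norml.
    by move=> /andP[-> ->].
  by case=> -> ->.
rewrite leb2X// !lebesgue_measure_itv/= lte_fin ifT; last lra.
by rewrite -EFinB -EFinM; congr EFin; ring.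
Qed.

Lemma leb2_enorm_lt (r : R) : 0 < r ->
  @leb2 R [set z | enorm z < r] = ((r ^+ 2)%:E * @leb2 R [set z | (enorm z < 1)%R])%E.
Proof.
move=> r0.
have mE (s : R) : measurable ([set z | enorm z < s] : set PP).
  rewrite -[X in measurable X]setTI.
  have := measurable_enorm measurableT (measurable_itv `]-oo, s[).
  by congr measurable; apply/seteqP; split => z; rewrite /= in_itv.
have mI : measurable_fun setT (EFin \o (\1_[set z | enorm z < r] : PP -> R)).
  by apply/measurable_EFinP; exact: measurable_indic.
have I0 (z : PP) : (0 <= (EFin \o (\1_[set z | (enorm z < r)%R] : PP -> R)) z)%E.
  by rewrite lee_fin.
have := @ge0_leb2_affine R r 0 r 0 _ r0 r0 mI I0.
rewrite /comp [X in (_ * X)%E](integral_indic leb2 measurableT (mE r)) setIT.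
rewrite (_ : (\int[leb2]__ _ = @leb2 R [set z | (enorm z < 1)%R])%E); last first.
  transitivity (@leb2 R ([set z | (enorm z < 1)%R] `&` setT)); last by rewrite setIT.
  rewrite -(integral_indic leb2 measurableT (mE 1)).
  apply: eq_integral => z _; congr EFin.
  rewrite !indicE; congr ((nat_of_bool _)%:R); rewrite !addr0.
  by apply/idP/idP; rewrite !inE/= enormZ ?(ltW r0)// gtr_pMr.
by move=> ->; rewrite muleA -EFinM -expr2 mulfV ?mul1e// sqrf_eq0 gt_eqF.
Qed.

(** Area of the unit disc, carried along as an unknown constant until a Gaussian integral identifies
    it. *)
Let A1 : R := fine (@leb2 R [set z | enorm z < 1]).

Let A1E : @leb2 R [set z | enorm z < 1] = A1%:E.
Proof.
rewrite /A1 fineK// ge0_fin_numE//.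
have mE : measurable ([set z | enorm z < 1] : set PP).
  rewrite -[X in measurable X]setTI.
  have := measurable_enorm measurableT (measurable_itv `]-oo, 1[).
  by congr measurable; apply/seteqP; split => z; rewrite /= in_itv.
have mE' : measurable ([set z | mnorm z < 1] : set PP).
  rewrite -[X in measurable X]setTI.
  have := measurable_mnorm measurableT (measurable_itv `]-oo, 1[).
  by congr measurable; apply/seteqP; split => z; rewrite /= in_itv.
apply: (@le_lt_trans _ _ (@leb2 R [set z | mnorm z < 1])).
  apply: le_measure; rewrite ?inE// => z /= z1.
  by rewrite /mnorm gt_max !(le_lt_trans _ z1)// ?norm1_le_enorm ?norm2_le_enorm.
by rewrite leb2_mnorm_lt// ltry.
Qed.

Let A1_ge0 : 0 <= A1 / 4.
Proof. by rewrite divr_ge0// /A1 fine_ge0. Qed.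

(** The images of [leb2] under the two norms agree up to the factor [A1 / 4]: by homogeneity the
    ball of radius [r] has area [A1 * r ^+ 2] for one norm and [4 * r ^+ 2] for the other, and the
    half-lines []-oo, r[] generate the Borel sets and are stable under intersection. *)
Let ge0_integral_enorm_mnorm (F : RR -> \bar R) :
  measurable_fun setT F -> (forall x, (0 <= F x)%E) ->
  (\int[leb2]_z F (enorm z) = (A1 / 4)%:E * \int[leb2]_z F (mnorm z))%E.
Proof.
move=> mF F0.
have := @ge0_integral_pushforward _ _ _ _ R _ measurable_enorm leb2 setT F
  measurableT mF (fun x _ => F0 x).
rewrite preimage_setT => <-.
have := @ge0_integral_pushforward _ _ _ _ R _ measurable_mnorm leb2 setT F
  measurableT mF (fun x _ => F0 x).
rewrite preimage_setT => <-.
pose a' : {nonneg R} := NngNum A1_ge0.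
pose m1 : {measure set RR -> \bar R} := pushforward leb2 (enorm : PP -> RR).
pose m2 : {measure set RR -> \bar R} := pushforward leb2 (mnorm : PP -> RR).
pose m3 : {measure set RR -> \bar R} := mscale a' (m2 measurable_mnorm).
transitivity (\int[m3]_x F x)%E; last by rewrite ge0_integral_mscale.
transitivity (\int[m1 measurable_enorm]_x F x)%E => //.
apply: eq_measure_integral => A mA _.
apply: (@measure_unique _ R RR (@RGenInftyO.G R) (fun n : nat => `]-oo, n%:R[%classic)) => //.
- exact: RGenInftyO.measurableE.
- move=> _ _ [a ->] [b ->]; exists (Num.min a b).
  apply/seteqP; split => z /=; rewrite !in_itv/= lt_min; first by case=> -> ->.
  by move=> /andP[].
- by move=> n; exists n%:R.
- apply/seteqP; split => // x _; exists (Num.truncn x).+1 => //=.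
  by rewrite in_itv/= truncnS_gt.
- move=> _ [r ->]; rewrite /m3/= /mscale/= /pushforward.
  have E1 : enorm @^-1` `]-oo, r[ = [set z | enorm z < r].
    by apply/seteqP; split => z; rewrite /= in_itv.
  have E2 : mnorm @^-1` `]-oo, r[ = [set z | mnorm z < r].
    by apply/seteqP; split => z; rewrite /= in_itv.
  rewrite [X in leb2 X]E1 [X in (_ * leb2 X)%E]E2.
  have [r0|r0] := leP r 0.
    rewrite (_ : [set z | enorm z < r] = set0); last first.
      apply/seteqP; split => z //= zr.
      by have := lt_le_trans zr r0; rewrite ltNge enorm_ge0.
    rewrite (_ : [set z | mnorm z < r] = set0) ?measure0 ?mule0//.
    apply/seteqP; split => z //= zr; have := lt_le_trans zr r0.
    by rewrite /mnorm gt_max ltNge normr_ge0.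
  rewrite (leb2_enorm_lt r0) (leb2_mnorm_lt r0) A1E -!EFinM; congr EFin; by field.
- move=> n /=; rewrite /pushforward.
  have E1 : enorm @^-1` `]-oo, n%:R[ = [set z | enorm z < n%:R].
    by apply/seteqP; split => z; rewrite /= in_itv.
  rewrite [X in leb2 X]E1.
  case: n {E1} => [|n].
    rewrite (_ : [set z | _] = set0) ?measure0//.
    by apply/seteqP; split => z //=; rewrite ltNge enorm_ge0.
  by rewrite leb2_enorm_lt// A1E -EFinM ltry.
Qed.


(** The plane is cut along its diagonals. Where [|y| < |x|] the integrand is constant in [y] on an
    interval of length [2 * |x|]; the rest is the mirror image under the swap, with the non-strict
    inequality so that each point is counted once. Two parts, two signs of [x] and the factor 2 of
    the length give 8. *)
Let ge0_integral_mnorm (F : RR -> \bar R) :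
  measurable_fun setT F -> (forall x, (0 <= F x)%E) ->
  (\int[leb2]_z F (mnorm z) = 8%:E * \int[mu]_(s in `]0%R, +oo[) (s%:E * F s))%E.
Proof.
move=> mF F0.
have mf1 : measurable_fun setT (fst : PP -> RR) by exact: measurable_fst.
have mf2 : measurable_fun setT (snd : PP -> RR) by exact: measurable_snd.
have mn1 : measurable_fun setT (fun z : PP => `|z.1| : RR).
  exact: measurableT_comp.
have mn2 : measurable_fun setT (fun z : PP => `|z.2| : RR).
  exact: measurableT_comp.
pose G1 (z : PP) : \bar R := if `|z.2| < `|z.1| then F `|z.1| else 0%E.
pose G2 (z : PP) : \bar R := if `|z.2| <= `|z.1| then F `|z.1| else 0%E.
have mG1 : measurable_fun setT G1.
  apply: measurable_fun_ifT => //; first exact: measurable_fun_ltr.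
  exact: measurableT_comp.
have mG2 : measurable_fun setT G2.
  apply: measurable_fun_ifT => //; first exact: measurable_fun_ler.
  exact: measurableT_comp.
have G10 z : (0 <= G1 z)%E by rewrite /G1; case: ifP.
have G20 z : (0 <= G2 z)%E by rewrite /G2; case: ifP.
pose H := (fun s : RR => s%:E * F s)%E \_ `]0%R, +oo[.
have mH : measurable_fun setT H.
  apply/(measurable_restrictT _ _).1 => //; apply: measurable_funTS.
  by apply: emeasurable_funM => //.
have H0 s : (0 <= H s)%E.
  rewrite /H patchE; case: ifPn => //; rewrite inE/= in_itv/= andbT => s0.
  by rewrite mule_ge0// lee_fin ltW.
have HE s : ((`|s|%R)%:E * F (`|s|%R) = H s + H (- s)%R)%E.
  rewrite /H !patchE !mem_setE !in_itv/= !andbT oppr_gt0.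
  have [s0|s0|->] := ltgtP s 0.
  - by rewrite add0e ltr0_norm.
  - by rewrite adde0 gtr0_norm.
  - by rewrite normr0 mul0e add0e.
have key (G : PP -> \bar R) : measurable_fun setT G -> (forall z, 0 <= G z)%E ->
    (forall x, \int[mu]_y G (x, y) = 2%:E * ((`|x|%R)%:E * F (`|x|%R)))%E ->
    (\int[leb2]_z G z = 4%:E * \int[mu]_(s in `]0%R, +oo[) (s%:E * F s))%E.
  move=> mG G0 GE; rewrite (leb2_tonelli1 mG)//.
  under eq_integral do rewrite GE HE.
  have mHN : measurable_fun setT (fun x : RR => H (- x)).
    by apply: measurableT_comp => //; exact: oppr_measurable.
  rewrite ge0_integralZl//; last 2 first.
  - exact: emeasurable_funD.
  - by move=> x _; rewrite adde_ge0.
  rewrite ge0_integralD// ge0_integral_oppr// -integral_mkcond.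
  have I0 : (0 <= \int[mu]_(s in `]0%R, +oo[) (s%:E * F s))%E.
    apply: integral_ge0 => x; rewrite /= in_itv/= andbT => x0.
    by rewrite mule_ge0// lee_fin ltW.
  rewrite ge0_muleDr// -ge0_muleDl ?lee_fin//.
  by rewrite -EFinD; congr (_%:E * _)%E; lra.
have -> : (\int[leb2]_z F (mnorm z) = \int[leb2]_z (G1 z + G2 (z.2, z.1)))%E.
  apply: eq_integral => -[x y] _; rewrite /G1 /G2 /mnorm/=.
  case: ltP => [yx|xy]; first by rewrite adde0.
  by rewrite add0e.
rewrite ge0_integralD//; last first.
  apply: (measurableT_comp mG2).
  exact: (measurable_fun_pair measurable_snd measurable_fst).
rewrite (ge0_leb2_swap mG2)// !key//.
- rewrite -ge0_muleDl ?lee_fin//.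
  by rewrite -EFinD; congr (_%:E * _)%E; lra.
- move=> x; rewrite /G1.
  transitivity (\int[mu]_y ((cst (F (`|x|%R)) : RR -> _) \_ `](- `|x|)%R, (`|x|)%R[) y)%E.
    apply: eq_integral => y _; rewrite patchE mem_setE in_itv/= -ltr_norml.
    by case: ifP.
  rewrite -integral_mkcond integral_cst//= lebesgue_measure_itv/= lte_fin.
  case: ifPn => [x0|].
    by rewrite -EFinB muleC muleA -EFinM; congr (_%:E * _)%E; lra.
  rewrite -leNgt => x0; have := normr_ge0 (x : R) => x1.
  by rewrite (_ : `|x| = 0) ?mule0 ?mul0e ?mule0//; lra.
- move=> x; rewrite /G2.
  transitivity (\int[mu]_y ((cst (F (`|x|%R)) : RR -> _) \_ `[(- `|x|)%R, (`|x|)%R]) y)%E.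
    apply: eq_integral => y _; rewrite patchE mem_setE in_itv/= -ler_norml.
    by case: ifP.
  rewrite -integral_mkcond integral_cst//= lebesgue_measure_itv/= lte_fin.
  case: ifPn => [x0|].
    by rewrite -EFinB muleC muleA -EFinM; congr (_%:E * _)%E; lra.
  rewrite -leNgt => x0; have := normr_ge0 (x : R) => x1.
  by rewrite (_ : `|x| = 0) ?mule0 ?mul0e ?mule0//; lra.
Qed.

(** The comparison of the two norms is evaluated on the Gaussian: one side factors into two
    one-dimensional integrals with product pi, the other is [A1 / 4 * 8 * (1 / 2)]. *)
Let A1_pi : A1 = pi.
Proof.
have mG : measurable_fun setT (fun x : RR => (gauss_fun x)%:E).
  by apply/measurable_EFinP; exact: measurable_gauss_fun.
have G0 x : (0 <= (gauss_fun (x : R))%:E)%E by rewrite lee_fin gauss_fun_ge0.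
have := ge0_integral_enorm_mnorm mG G0.
rewrite (ge0_integral_mnorm mG G0).
have -> : (\int[@leb2 R]_z (gauss_fun (enorm z))%:E = pi%:E)%E.
  under eq_integral => z _.
    rewrite /gauss_fun sqr_enorm opprD expRD; over.
  have mG2 : measurable_fun setT
      (fun z : PP => (expR (- z.1 ^+ 2) * expR (- z.2 ^+ 2))%:E).
    apply/measurable_EFinP; apply: measurable_funM.
      exact: (measurableT_comp measurable_gauss_fun).
    exact: (measurableT_comp measurable_gauss_fun).
  rewrite (leb2_tonelli1 mG2)/=; last first.
    by move=> z; rewrite lee_fin mulr_ge0 ?expR_ge0.
  under eq_integral => x _.
    under eq_integral do rewrite EFinM.
    rewrite ge0_integralZl// ?lee_fin ?expR_ge0//.
    rewrite (integralT_gauss); over.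
  rewrite /= ge0_integralZr// ?lee_fin ?sqrtr_ge0// integralT_gauss -EFinM.
  by rewrite -expr2 sqr_sqrtr// pi_ge0.
have -> : (\int[mu]_(s in `]0%R, +oo[) (s%:E * (gauss_fun s)%:E) = (1/2)%:E)%E.
  rewrite integral_itv_obnd_cbnd; last first.
    apply: measurable_funTS; apply: emeasurable_funM => //.
  under eq_integral do rewrite -EFinM.
  pose f (s : R) := s * gauss_fun s.
  pose F (s : R) := - (1/2) * gauss_fun s.
  have dF (x : R) : is_derive x 1 F (f x).
    rewrite /F /f /gauss_fun.
    apply: is_derive_eq.
    by rewrite /GRing.scale/= mulr1; field.
  rewrite (@ge0_continuous_FTC2y _ f F 0 0).
  - rewrite /F /gauss_fun expr0n/= oppr0 expR0 -EFinB; congr EFin; lra.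
  - by move=> x x0; rewrite mulr_ge0// gauss_fun_ge0.
  - apply: continuous_subspaceT => x; apply: cvgM; first exact: cvg_id.
    exact: continuous_gauss_fun.
  - rewrite -(mulr0 (- (1/2))); apply: cvgMr; exact: cvg_gauss_fun.
  - by move=> x _; have := dF x.
  - apply: cvg_at_right_filter; apply: cvgMr; exact: continuous_gauss_fun.
  - by move=> x _; rewrite derive1E; apply: derive_val.
by rewrite -!EFinM => -[]; lra.
Qed.

Lemma ge0_integral_polar (F : RR -> \bar R) :
  measurable_fun setT F -> (forall x, (0 <= F x)%E) ->
  (\int[leb2]_z F (enorm z) =
   (2 * pi)%:E * \int[mu]_(s in `]0%R, +oo[) (s%:E * F s))%E.
Proof.
move=> mF F0; rewrite ge0_integral_enorm_mnorm// ge0_integral_mnorm// A1_pi.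
by rewrite muleA -EFinM; congr (_%:E * _)%E; field.
Qed.

End polar.

(** * The Dirichlet form of a symmetric kernel *)

Section dirichlet_form.
Context d (T : measurableType d) (R : realType).
Variable m : {sigma_finite_measure set T -> \bar R}.
Local Notation mm := (m \x m)%E.

Lemma integrableZlR d' (T' : measurableType d')
    (n : {measure set T' -> \bar R}) (c : R) (f : T' -> R) :
  n.-integrable setT (EFin \o f) ->
  n.-integrable setT (fun x => (c * f x)%:E).
Proof. by move=> fi; exact: (integrableZl measurableT c fi). Qed.

Lemma integrableDR d' (T' : measurableType d')
    (n : {measure set T' -> \bar R}) (f g : T' -> R) :
  n.-integrable setT (EFin \o f) -> n.-integrable setT (EFin \o g) ->
  n.-integrable setT (fun x => (f x + g x)%:E).
Proof. by move=> fi gi; exact: (integrableD measurableT fi gi). Qed.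

Lemma measurable_Rintegral_section (g : T * T -> R) : measurable_fun setT g ->
  measurable_fun setT (fun x => \int[m]_y g (x, y)).
Proof.
move=> mg; apply: measurableT_comp => //.
have mgE : measurable_fun setT (EFin \o g) by exact/measurable_EFinP.
rewrite (_ : (fun _ => _) = (fun x => (\int[m]_y (EFin \o g)^\+ (x, y))%E)
   \- (fun x => (\int[m]_y (EFin \o g)^\- (x, y))%E))%E.
  apply: emeasurable_funB; apply: measurable_fun_fubini_tonelli_F => //.
  + exact: measurable_funepos.
  + exact: measurable_funeneg.
by apply/funext => x; rewrite integralE; congr (_ - _)%E;
  apply: eq_integral => y _; rewrite ?funeposE ?funenegE.
Qed.

Let iterated_ae_eq (b : T -> R) (g : T * T -> R) :
  {ae m, forall x, b x != 0 -> m.-integrable setT (fun y => (g (x, y))%:E)} ->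
  {ae m, forall x, setT x -> (b x * \int[m]_y g (x, y))%:E =
                   fubini_F m (fun z => (b z.1 * g z)%:E) x}.
Proof.
apply: filterS => x ig _; rewrite /fubini_F/=.
have [->|bx] := eqVneq (b x) 0.
  rewrite mul0r; under eq_integral do rewrite mul0r.
  by rewrite integral0.
under eq_integral do rewrite EFinM.
rewrite integralZl ?ig//= EFinM /Rintegral fineK//.
exact: integrable_fin_num (ig bx).
Qed.

Lemma iterated_integrable (b : T -> R) (g : T * T -> R) :
  measurable_fun setT b -> measurable_fun setT g ->
  mm.-integrable setT (fun z => (b z.1 * g z)%:E) ->
  {ae m, forall x, b x != 0 -> m.-integrable setT (fun y => (g (x, y))%:E)} ->
  m.-integrable setT (fun x => (b x * \int[m]_y g (x, y))%:E).
Proof.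
move=> mb mg ibg ig; have iF := integrable_fubini_F ibg.
have mbg : measurable_fun setT (fun x => (b x * \int[m]_y g (x, y))%:E).
  apply/measurable_EFinP; apply: measurable_funM => //.
  exact: measurable_Rintegral_section.
apply/integrableP; split => //.
case/integrableP: iF => mF; congr (_ < _)%E.
apply: ae_eq_integral => //; try exact: measurableT_comp.
by apply: filterS (iterated_ae_eq ig) => x /[apply] ->.
Qed.

(** Fubini with the factor [b] outside the inner integral, the shape in which the weak formulation
    comes. The sections of [g] are integrable only for almost every [x], and this is asked only
    where [b x != 0], since both integrands vanish elsewhere. *)
Lemma Rintegral_iterated (b : T -> R) (g : T * T -> R) :
  measurable_fun setT b -> measurable_fun setT g ->
  mm.-integrable setT (fun z => (b z.1 * g z)%:E) ->
  {ae m, forall x, b x != 0 -> m.-integrable setT (fun y => (g (x, y))%:E)} ->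
  \int[m]_x (b x * \int[m]_y g (x, y)) = \int[mm]_z (b z.1 * g z).
Proof.
move=> mb mg ibg ig; rewrite {1 3}/Rintegral; congr fine.
rewrite -integral12_prod_meas1//; apply: ae_eq_integral (iterated_ae_eq ig) => //.
- apply/measurable_EFinP; apply: measurable_funM => //.
  exact: measurable_Rintegral_section.
- exact: (measurable_int _ (integrable_fubini_F ibg)).
Qed.

Definition sqintegrable (v : T -> R) :=
  measurable_fun setT v /\ (\int[m]_x ((v x) ^+ 2)%:E < +oo)%E.

Lemma sqintegrableD a b : sqintegrable a -> sqintegrable b ->
  sqintegrable (a \+ b).
Proof.
move=> [ma ia] [mb ib]; split; first exact: measurable_funD.
apply: (@le_lt_trans _ _ (\int[m]_x (2%:E * ((a x) ^+ 2)%:E + 2%:E * ((b x) ^+ 2)%:E))%E).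
  apply: ge0_le_integral => //.
  - by move=> x _; rewrite lee_fin sqr_ge0.
  - by apply/measurable_EFinP; apply: measurable_funX; exact: measurable_funD.
  - apply: emeasurable_funD; apply: measurable_funeM; apply/measurable_EFinP;
      exact: measurable_funX.
  - move=> x _; rewrite -!EFinM -EFinD lee_fin.
    by rewrite -subr_ge0 (_ : _ - _ = (a x - b x) ^+ 2) ?sqr_ge0//=; ring.
have ma2 : measurable_fun setT (fun x => ((a x) ^+ 2)%:E).
  by apply/measurable_EFinP; exact: measurable_funX.
have mb2 : measurable_fun setT (fun x => ((b x) ^+ 2)%:E).
  by apply/measurable_EFinP; exact: measurable_funX.
rewrite ge0_integralD//; last 4 first.
- by move=> x _; rewrite mule_ge0// lee_fin sqr_ge0.
- exact: measurable_funeM.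
- by move=> x _; rewrite mule_ge0// lee_fin sqr_ge0.
- exact: measurable_funeM.
rewrite !ge0_integralZl//; try by move=> x _; rewrite lee_fin sqr_ge0.
by rewrite lte_add_pinfty// lte_mul_pinfty.
Qed.

Lemma sqintegrableN a : sqintegrable a -> sqintegrable (\- a).
Proof.
move=> [ma ia]; split; first exact: measurable_funN.
by under eq_integral do rewrite /= sqrrN.
Qed.

Lemma sqintegrableB a b : sqintegrable a -> sqintegrable b ->
  sqintegrable (a \- b).
Proof. by move=> ia ib; exact: sqintegrableD ia (sqintegrableN ib). Qed.

Variables (k : T -> T -> R) (G : R).
Hypothesis mk : measurable_fun setT (fun z => k z.1 z.2).
Hypothesis k0 : forall x y, 0 <= k x y.
Hypothesis ksym : forall x y, k x y = k y x.
Hypothesis kG : forall x, (\int[m]_y (k x y)%:E <= G%:E)%E.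
Implicit Types a b c v : T -> R.

Hypothesis G0 : 0 <= G.

Let mkE : measurable_fun setT (fun z => (k z.1 z.2)%:E).
Proof. exact/measurable_EFinP. Qed.

Let msq v : measurable_fun setT v -> measurable_fun setT (fun x => ((v x) ^+ 2)%:E).
Proof. by move=> mv; apply/measurable_EFinP; exact: measurable_funX. Qed.

Let msq0 v x : (0 <= ((v x) ^+ 2)%:E)%E.
Proof. by rewrite lee_fin sqr_ge0. Qed.

Let mk1 v : measurable_fun setT v ->
  measurable_fun setT (fun z : T * T => ((v z.1) ^+ 2 * k z.1 z.2)%:E).
Proof.
move=> mv; apply/measurable_EFinP; apply: measurable_funM => //.
by apply: measurable_funX; exact: measurableT_comp.
Qed.

Let mk2 v : measurable_fun setT v ->
  measurable_fun setT (fun z : T * T => ((v z.2) ^+ 2 * k z.1 z.2)%:E).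
Proof.
move=> mv; apply/measurable_EFinP; apply: measurable_funM => //.
by apply: measurable_funX; exact: measurableT_comp.
Qed.

Let mkx x : measurable_fun setT (fun y => (k x y)%:E).
Proof. exact: (measurableT_comp mkE (pair1_measurable x)). Qed.

Lemma kernel_int_sq1 v : measurable_fun setT v ->
  (\int[mm]_z ((v z.1) ^+ 2 * k z.1 z.2)%:E <= G%:E * \int[m]_x ((v x) ^+ 2)%:E)%E.
Proof.
move=> mv; rewrite fubini_tonelli1//=; [|exact: mk1|]; last first.
  by move=> z; rewrite lee_fin mulr_ge0// sqr_ge0.
rewrite -ge0_integralZl//; [|exact: msq].
apply: ge0_le_integral => //.
- by move=> x _; apply: integral_ge0 => y _; rewrite lee_fin mulr_ge0// sqr_ge0.
- apply: (measurable_fun_fubini_tonelli_F (fun z : T * T => ((v z.1) ^+ 2 * k z.1 z.2)%:E)).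
    exact: mk1.
  by move=> z; rewrite lee_fin mulr_ge0// sqr_ge0.
- by apply: measurable_funeM; exact: msq.
- move=> x _; rewrite /fubini_F/=; under eq_integral do rewrite EFinM.
  rewrite ge0_integralZl//; last by move=> y _; rewrite lee_fin.
  by rewrite muleC lee_wpmul2r.
Qed.

Lemma kernel_int_sq2 v : measurable_fun setT v ->
  (\int[mm]_z ((v z.2) ^+ 2 * k z.1 z.2)%:E <= G%:E * \int[m]_x ((v x) ^+ 2)%:E)%E.
Proof.
move=> mv; apply: le_trans (kernel_int_sq1 mv).
rewrite fubini_tonelli2//=; [|exact: mk2|]; last first.
  by move=> z; rewrite lee_fin mulr_ge0// sqr_ge0.
rewrite fubini_tonelli1//=; [|exact: mk1|]; last first.
  by move=> z; rewrite lee_fin mulr_ge0// sqr_ge0.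
by rewrite /fubini_F /fubini_G/=; under eq_integral do under eq_integral do rewrite ksym.
Qed.

(** Schur's test: the kernel has mass at most [G] in each variable, so the square of a
    square-integrable function of either variable, times [k], is integrable. The double integrals
    below are dominated in this way, products of differences being bounded by sums of squares. *)
Lemma kernel_integrable a b (f : T * T -> R) :
  sqintegrable a -> sqintegrable b -> measurable_fun setT f ->
  (forall z, `|f z| <= (a z.1 ^+ 2 + a z.2 ^+ 2 + (b z.1 ^+ 2 + b z.2 ^+ 2)) * k z.1 z.2) ->
  mm.-integrable setT (EFin \o f).
Proof.
move=> [ma ia] [mb ib] mf fle; apply/integrableP; split; first exact/measurable_EFinP.
have fin v : measurable_fun setT v -> (\int[m]_x ((v x) ^+ 2)%:E < +oo)%E ->
    (\int[mm]_z ((v z.1) ^+ 2 * k z.1 z.2)%:E +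
     \int[mm]_z ((v z.2) ^+ 2 * k z.1 z.2)%:E < +oo)%E.
  move=> mv iv; apply: lte_add_pinfty.
    by apply: le_lt_trans (kernel_int_sq1 mv) _; rewrite lte_mul_pinfty.
  by apply: le_lt_trans (kernel_int_sq2 mv) _; rewrite lte_mul_pinfty.
have ge1 v z : (0 <= ((v (z : T * T).1) ^+ 2 * k z.1 z.2)%:E)%E.
  by rewrite lee_fin mulr_ge0// sqr_ge0.
have ge2 v z : (0 <= ((v (z : T * T).2) ^+ 2 * k z.1 z.2)%:E)%E.
  by rewrite lee_fin mulr_ge0// sqr_ge0.
apply: le_lt_trans (lte_add_pinfty (fin a ma ia) (fin b mb ib)).
have D v : measurable_fun setT v ->
   (\int[mm]_z ((v z.1) ^+ 2 * k z.1 z.2)%:E +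
     \int[mm]_z ((v z.2) ^+ 2 * k z.1 z.2)%:E =
   \int[mm]_z (((v z.1) ^+ 2 * k z.1 z.2)%:E + ((v z.2) ^+ 2 * k z.1 z.2)%:E))%E.
  by move=> mv; rewrite ge0_integralD//; [exact: mk1|exact: mk2].
rewrite !D// -ge0_integralD//; last 4 first.
- by move=> z _; rewrite adde_ge0.
- by apply: emeasurable_funD; [exact: mk1|exact: mk2].
- by move=> z _; rewrite adde_ge0.
- by apply: emeasurable_funD; [exact: mk1|exact: mk2].
apply: ge0_le_integral => //.
- by apply: measurableT_comp => //; exact/measurable_EFinP.
- by apply: emeasurable_funD; apply: emeasurable_funD;
    [exact: mk1|exact: mk2|exact: mk1|exact: mk2].
- by move=> z _; rewrite -!EFinD lee_fin (le_trans (fle z))// !mulrDl.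
Qed.

Definition dform a b : R :=
  \int[mm]_z ((a z.2 - a z.1) * (b z.2 - b z.1) * k z.1 z.2).

Let mdiff a : measurable_fun setT a ->
  measurable_fun setT (fun z : T * T => a z.2 - a z.1).
Proof. by move=> ma; apply: measurable_funB; exact: measurableT_comp. Qed.

Lemma dform_integrable a b : sqintegrable a -> sqintegrable b ->
  mm.-integrable setT
    (fun z => ((a z.2 - a z.1) * (b z.2 - b z.1) * k z.1 z.2)%:E).
Proof.
move=> ia ib; apply: (kernel_integrable ia ib).
  apply: measurable_funM => //; apply: measurable_funM; apply: mdiff.
    by case: ia.
  by case: ib.
move=> z; rewrite normrM (ger0_norm (k0 _ _)) ler_wpM2r//.
rewrite ler_norml; apply/andP; split; rewrite -subr_ge0.
  rewrite (_ : _ - _ = 2^-1 * ((a z.2 + b z.2 - a z.1 - b z.1) ^+ 2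
    + (a z.1 + a z.2) ^+ 2 + (b z.1 + b z.2) ^+ 2)); last by field.
  by rewrite mulr_ge0// !addr_ge0// sqr_ge0.
rewrite (_ : _ - _ = 2^-1 * ((a z.2 - b z.2 - a z.1 + b z.1) ^+ 2
    + (a z.1 + a z.2) ^+ 2 + (b z.1 + b z.2) ^+ 2)); last by field.
by rewrite mulr_ge0// !addr_ge0// sqr_ge0.
Qed.

Lemma dformC a b : dform a b = dform b a.
Proof. by apply: eq_Rintegral => z _; congr (_ * _); rewrite mulrC. Qed.

Lemma dformDl a b c : sqintegrable a -> sqintegrable b -> sqintegrable c ->
  dform (a \+ b) c = dform a c + dform b c.
Proof.
move=> ia ib ic; rewrite /dform -RintegralD//.
- by apply: eq_Rintegral => z _ /=; ring.
- exact: dform_integrable.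
- exact: dform_integrable.
Qed.

Lemma dformBl a b c : sqintegrable a -> sqintegrable b -> sqintegrable c ->
  dform (a \- b) c = dform a c - dform b c.
Proof.
move=> ia ib ic; rewrite /dform -RintegralB//.
- by apply: eq_Rintegral => z _ /=; ring.
- exact: dform_integrable.
- exact: dform_integrable.
Qed.

Lemma dformBr a b c : sqintegrable a -> sqintegrable b -> sqintegrable c ->
  dform a (b \- c) = dform a b - dform a c.
Proof. by move=> *; rewrite dformC dformBl// !(dformC a). Qed.

Lemma dform_ge0 a : 0 <= dform a a.
Proof. by apply: Rintegral_ge0 => z _; rewrite mulr_ge0// -expr2 sqr_ge0. Qed.

Lemma dform_energy a : sqintegrable a ->
  (dform a a)%:E =
  (\int[m]_x \int[m]_y ((a y - a x) ^+ 2 * k x y)%:E)%E.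
Proof.
move=> ia; rewrite /dform /Rintegral fineK; last first.
  exact: integrable_fin_num (dform_integrable ia ia).
have [ma _] := ia.
rewrite fubini_tonelli1/=.
- by rewrite /fubini_F/=; under eq_integral do under eq_integral do rewrite -expr2.
- apply/measurable_EFinP; apply: measurable_funM => //.
  by apply: measurable_funM; exact: mdiff.
- by move=> z; rewrite lee_fin mulr_ge0// -expr2 sqr_ge0.
Qed.

(** From [(s - t) ^+ 2 <= 2 * s ^+ 2 + 2 * t ^+ 2]; each of the two squares contributes [2 * G]. *)
Lemma dform_le a : sqintegrable a ->
  ((dform a a)%:E <= (4 * G)%:E * \int[m]_x ((a x) ^+ 2)%:E)%E.
Proof.
move=> ia; have [ma _] := ia.
rewrite /dform /Rintegral fineK; last first.
  exact: integrable_fin_num (dform_integrable ia ia).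
have -> : ((4 * G)%:E * \int[m]_x ((a x) ^+ 2)%:E =
    2%:E * (G%:E * \int[m]_x ((a x) ^+ 2)%:E + G%:E * \int[m]_x ((a x) ^+ 2)%:E))%E.
  rewrite -ge0_muleDl ?lee_fin// -EFinD muleA -EFinM; congr (_%:E * _)%E; ring.
apply: (@le_trans _ _ (2%:E * (\int[mm]_z ((a z.1) ^+ 2 * k z.1 z.2)%:E +
     \int[mm]_z ((a z.2) ^+ 2 * k z.1 z.2)%:E))%E); last first.
  apply: lee_wpmul2l; first by rewrite lee_fin.
  by apply: leeD; [exact: kernel_int_sq1|exact: kernel_int_sq2].
have ge1 z : (0 <= ((a (z : T * T).1) ^+ 2 * k z.1 z.2)%:E)%E.
  by rewrite lee_fin mulr_ge0// sqr_ge0.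
have ge2 z : (0 <= ((a (z : T * T).2) ^+ 2 * k z.1 z.2)%:E)%E.
  by rewrite lee_fin mulr_ge0// sqr_ge0.
rewrite -ge0_integralD//; [|exact: mk1|exact: mk2].
rewrite -ge0_integralZl//; last 2 first.
- by apply: emeasurable_funD; [exact: mk1|exact: mk2].
- by move=> z _; rewrite adde_ge0.
apply: ge0_le_integral => //.
- by move=> z _; rewrite lee_fin mulr_ge0// -expr2 sqr_ge0.
- apply/measurable_EFinP; apply: measurable_funM => //.
  by apply: measurable_funM; exact: mdiff.
- apply: measurable_funeM.
  by apply: emeasurable_funD; [exact: mk1|exact: mk2].
- move=> z _; rewrite -EFinD -EFinM lee_fin -mulrDl mulrA ler_wpM2r//.
  rewrite -subr_ge0 (_ : _ - _ = (a z.1 + a z.2) ^+ 2) ?sqr_ge0//; ring.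
Qed.

Lemma dform_young (s : R) a b : 0 < s -> sqintegrable a -> sqintegrable b ->
  2 * dform a b <= s * dform a a + s^-1 * dform b b.
Proof.
move=> s0 ia ib; rewrite /dform -!RintegralZl//; try exact: dform_integrable.
have Z1 := @integrableZlR _ _ mm s _ (dform_integrable ia ia).
have Z2 := @integrableZlR _ _ mm s^-1 _ (dform_integrable ib ib).
rewrite -RintegralD//.
apply: le_Rintegral => //.
- by apply: integrableZlR; exact: dform_integrable.
- exact: integrableDR.
move=> z _; rewrite !mulrA -mulrDl ler_wpM2r//.
set u := a z.2 - a z.1; set w := b z.2 - b z.1.
rewrite -subr_ge0 (_ : _ - _ = s^-1 * (s * u - w) ^+ 2); last first.
  by field; rewrite gt_eqF.
by rewrite mulr_ge0 ?invr_ge0 ?(ltW s0)// sqr_ge0.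
Qed.

(** Finite energy makes the squared increment integrable against [k x] for almost every [x]; the
    increment itself follows from [|t| <= t ^+ 2 + 1] and the finite mass of [k x]. *)
Lemma dform_section_integrable a : sqintegrable a ->
  {ae m, forall x, m.-integrable setT (fun y => ((a y - a x) * k x y)%:E)}.
Proof.
move=> ia; have [ma _] := ia.
have mF : measurable_fun setT
    (fun z : T * T => ((a z.2 - a z.1) * (a z.2 - a z.1) * k z.1 z.2)%:E).
  apply/measurable_EFinP; apply: measurable_funM => //.
  by apply: measurable_funM; exact: mdiff.
have iF := integrable_fubini_F (dform_integrable ia ia).
apply: filterS (integrable_ae measurableT iF) => x /(_ I).
rewrite /fubini_F/= => fin.
have mkxR : measurable_fun setT (k x).
  by apply/measurable_EFinP; exact: mkx.
apply/integrableP; split.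
  apply/measurable_EFinP; apply: measurable_funM => //.
  by apply: measurable_funB.
apply: (@le_lt_trans _ _ (\int[m]_y
    (((a y - a x) * (a y - a x) * k x y)%:E + (k x y)%:E))%E).
  apply: ge0_le_integral => //.
  - apply: measurableT_comp => //; apply/measurable_EFinP; apply: measurable_funM => //.
    by apply: measurable_funB.
  - apply: emeasurable_funD => //; apply/measurable_EFinP; apply: measurable_funM => //.
    by apply: measurable_funM; apply: measurable_funB.
  - move=> y _; rewrite -EFinD /= lee_fin normrM (ger0_norm (k0 _ _)).
    rewrite (_ : _ + k x y = ((a y - a x) ^+ 2 + 1) * k x y); last by ring.
    rewrite ler_wpM2r// -real_normK ?num_real//.
    have := sqr_ge0 (`|a y - a x| - 1); have := normr_ge0 (a y - a x).
    by set w := `|_|; lra.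
have q0 y : (0 <= ((a y - a x) * (a y - a x) * k x y)%:E)%E.
  by rewrite lee_fin mulr_ge0// -expr2 sqr_ge0.
have kx0 y : (0 <= (k x y)%:E)%E by rewrite lee_fin.
rewrite ge0_integralD//; last first.
  apply/measurable_EFinP; apply: measurable_funM => //.
  by apply: measurable_funM; apply: measurable_funB.
rewrite lte_add_pinfty// ?(le_lt_trans (kG x)) ?ltry//.
by rewrite -ge0_fin_numE//; apply: integral_ge0 => y _;
  rewrite lee_fin mulr_ge0// -expr2 sqr_ge0.
Qed.

Let mul_sub_le (u v w : R) : `|u * (v - w)| <= v ^+ 2 + w ^+ 2 + u ^+ 2.
Proof.
rewrite ler_norml; apply/andP; split; rewrite -subr_ge0.
  rewrite (_ : _ - _ = 2^-1 * ((u + v - w) ^+ 2 + (v + w) ^+ 2 + u ^+ 2)); last by field.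
  by rewrite mulr_ge0// !addr_ge0// sqr_ge0.
rewrite (_ : _ - _ = 2^-1 * ((u - v + w) ^+ 2 + (v + w) ^+ 2 + u ^+ 2)); last by field.
by rewrite mulr_ge0// !addr_ge0// sqr_ge0.
Qed.

Let weak_integrable (A : set T) a b : measurable A ->
  sqintegrable a -> sqintegrable b ->
  mm.-integrable setT
    (fun z => (b z.1 * (\1_A z.2 * ((a z.2 - a z.1) * k z.1 z.2)))%:E).
Proof.
move=> mA ia ib; have [ma _] := ia; have [mb _] := ib.
have mA1 : measurable_fun setT (\1_A : T -> R) by exact: measurable_indic.
apply: (kernel_integrable ia ib).
  apply: measurable_funM; first exact: measurableT_comp.
  apply: measurable_funM; first exact: (measurableT_comp mA1 measurable_snd).
  by apply: measurable_funM => //; exact: mdiff.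
move=> z; rewrite mulrCA mulrA mulrA !normrM (ger0_norm (k0 _ _)) ler_wpM2r//.
apply: (@le_trans _ _ (1 * `|b z.1| * `|a z.2 - a z.1|)).
  rewrite !ler_wpM2r// indicE.
  by case: (z.2 \in A); rewrite /= ?normr1 ?normr0.
rewrite mul1r -normrM; apply: le_trans (mul_sub_le _ _ _) _.
by have := sqr_ge0 (b z.2); lra.
Qed.

(** Exchange of the variables: with [f] the integrand on the right, the integrand of the form is
    [- (f + f \o sw)] by symmetry of [k], and the two summands have the same integral. *)
Lemma dform_weak a b : sqintegrable a -> sqintegrable b ->
  dform a b = - 2 * \int[mm]_z (b z.1 * ((a z.2 - a z.1) * k z.1 z.2)).
Proof.
move=> ia ib; have [ma _] := ia; have [mb _] := ib.
pose f (z : T * T) := b z.1 * ((a z.2 - a z.1) * k z.1 z.2).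
have mf : measurable_fun setT f.
  apply: measurable_funM; first exact: measurableT_comp.
  by apply: measurable_funM => //; exact: mdiff.
pose sw (z : T * T) := (z.2, z.1).
have mfs : measurable_fun setT (f \o sw).
  apply: (measurableT_comp mf).
  exact: (measurable_fun_pair measurable_snd measurable_fst).
have fi : mm.-integrable setT (EFin \o f).
  apply: (kernel_integrable ia ib) => //.
  move=> z; rewrite /f mulrA normrM (ger0_norm (k0 _ _)) ler_wpM2r//.
  apply: le_trans (mul_sub_le _ _ _) _.
  by have := sqr_ge0 (b z.2); lra.
have fsi : mm.-integrable setT (EFin \o (f \o sw)).
  apply: (kernel_integrable ia ib) => //.
  move=> z; rewrite /f/= ksym mulrA normrM (ger0_norm (k0 _ _)) ler_wpM2r//.
  apply: le_trans (mul_sub_le _ _ _) _.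
  by have := sqr_ge0 (b z.1); lra.
have swapE : \int[mm]_z f z = \int[mm]_z (f \o sw) z.
  rewrite /Rintegral; congr fine.
  by rewrite -(integral12_prod_meas1 fi) -(integral21_prod_meas1 fsi).
transitivity (- (\int[mm]_z f z + \int[mm]_z (f \o sw) z)); last first.
  by rewrite -swapE; rewrite -/f; ring.
rewrite -RintegralD// -mulN1r -RintegralZl//.
  by apply: eq_Rintegral => -[x y] _; rewrite /f/= (ksym y x); ring.
exact: integrableDR.
Qed.

(** With [A] the domain, the two inner integrals become the interior and the exterior term of the
    discrete problem. *)
Lemma dform_weak_split (A : set T) a b : measurable A ->
  sqintegrable a -> sqintegrable b ->
  dform a b = - 2 * (\int[m]_x (b x * \int[m]_(y in A) ((a y - a x) * k x y))
    + \int[m]_x (b x * \int[m]_(y in ~` A) ((a y - a x) * k x y))).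
Proof.
move=> mA ia ib; have [ma _] := ia; have [mb _] := ib.
have mA' := measurableC mA.
have split_int (B : set T) : measurable B ->
    \int[m]_x (b x * \int[m]_(y in B) ((a y - a x) * k x y)) =
    \int[mm]_z (b z.1 * (\1_B z.2 * ((a z.2 - a z.1) * k z.1 z.2))).
  move=> mB; have mB1 : measurable_fun setT (\1_B : T -> R) by exact: measurable_indic.
  pose gB (z : T * T) := \1_B z.2 * ((a z.2 - a z.1) * k z.1 z.2).
  rewrite -(Rintegral_iterated (g := gB) mb _ (weak_integrable mB ia ib)).
  - apply: eq_Rintegral => x _; congr (_ * _).
    rewrite Rintegral_mkcond; apply: eq_Rintegral => y _.
    by rewrite /gB/= patchE indicE; case: ifPn => _; rewrite ?mul1r ?mul0r.
  - apply: measurable_funM; first exact: (measurableT_comp mB1 measurable_snd).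
    by apply: measurable_funM => //; exact: mdiff.
  - apply: filterS (dform_section_integrable ia) => x ix _.
    have mx := measurable_int _ ix; have /measurable_EFinP mxR := mx.
    apply: le_integrable ix => //.
      by apply/measurable_EFinP; exact: measurable_funM.
    move=> y _; rewrite /gB/= lee_fin normrM ler_piMl// indicE.
    by case: (y \in B); rewrite /= ?normr1 ?normr0.
rewrite (dform_weak ia ib) !split_int//; congr (_ * _).
rewrite -RintegralD//; try exact: weak_integrable.
apply: eq_Rintegral => z _; rewrite -mulrDr -mulrDl !indicE in_setC.
by case: (z.2 \in A); rewrite /= ?addr0 ?add0r mul1r.
Qed.

Lemma dform_weak_iterated a b : sqintegrable a -> sqintegrable b ->
  dform a b = - 2 * \int[m]_x (b x * \int[m]_y ((a y - a x) * k x y)).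
Proof.
move=> ia ib; rewrite (dform_weak_split measurableT ia ib) setCT; congr (_ * _).
under [X in _ + X]eq_Rintegral do rewrite Rintegral_set0 mulr0.
by rewrite /Rintegral integral0/= addr0.
Qed.

Lemma dform_weak_integrable a b : sqintegrable a -> sqintegrable b ->
  m.-integrable setT (fun x => (b x * \int[m]_y ((a y - a x) * k x y))%:E).
Proof.
move=> ia ib; have [ma _] := ia; have [mb _] := ib.
apply: (@iterated_integrable b (fun z => (a z.2 - a z.1) * k z.1 z.2)) => //.
- by apply: measurable_funM => //; exact: mdiff.
- apply: eq_integrable (weak_integrable measurableT ia ib) => // z _.
  by rewrite indicT mul1r.
- by apply: filterS (dform_section_integrable ia).
Qed.

Lemma dform_youngN (s : R) a b : 0 < s -> sqintegrable a -> sqintegrable b ->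
  - (2 * dform a b) <= s * dform a a + s^-1 * dform b b.
Proof.
move=> s0 ia ib; have ina := sqintegrableN ia.
have E c : sqintegrable c -> dform (\- a) c = - dform a c.
  move=> ic; rewrite /dform -mulN1r -RintegralZl//; last exact: dform_integrable.
  by apply: eq_Rintegral => z _ /=; ring.
have := dform_young s0 ina ib.
rewrite (E b)// (E (\- a))// (dformC a (\- a)) (E a)// opprK.
by rewrite mulrN.
Qed.

(** Parallelogram identity, with the form of [a \- b] discarded. *)
Lemma dform_addle a b : sqintegrable a -> sqintegrable b ->
  dform (a \+ b) (a \+ b) <= 2 * dform a a + 2 * dform b b.
Proof.
move=> ia ib; have iab := sqintegrableD ia ib.
have := dform_ge0 (a \- b); have iamb := sqintegrableB ia ib.
rewrite dformBl// !dformBr// dformDl// !(dformC _ (a \+ b)) !dformDl//.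
by rewrite (dformC b a); lra.
Qed.

(** [phi \- v] and [v] being orthogonal, the energy of [phi] is the sum of theirs. *)
Lemma dform_cea phi v : sqintegrable phi -> sqintegrable v ->
  dform (phi \- v) v = 0 -> dform (phi \- v) (phi \- v) <= dform phi phi.
Proof.
move=> ip iv orth; have ipv := sqintegrableB ip iv.
have := dform_ge0 v; move: orth; rewrite dformBr// dformBl// dformBl// (dformC v phi).
by move=> orth; lra.
Qed.

(* Young's inequality and the Poincare inequality absorb the terms in e0. *)
Lemma dform_stability (S : set T) (cP F A : R) e0 eg :
  sqintegrable e0 -> sqintegrable eg -> measurable S -> (m S = A%:E)%E ->
  0 < cP -> 0 <= F -> (forall x, ~ S x -> e0 x = 0) ->
  (cP%:E * \int[m]_x ((e0 x) ^+ 2)%:E <= (dform e0 e0)%:E)%E ->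
  {ae m, forall x, S x ->
     `|\int[m]_y (((e0 y + eg y) - (e0 x + eg x)) * k x y)| <= F / 2} ->
  dform e0 e0 <= 2 * F ^+ 2 * A / cP + 4 * dform eg eg.
Proof.
move=> i0 ig mS mSA cP0 F0 e0S poinc aeF.
pose e := e0 \+ eg; have ie : sqintegrable e by exact: sqintegrableD.
have [m0 N0fin] := i0; have [me _] := ie.
pose gg (z : T * T) := (e z.2 - e z.1) * k z.1 z.2.
have mgg : measurable_fun setT gg by apply: measurable_funM => //; exact: mdiff.
pose L x := \int[m]_y gg (x, y).
have mL : measurable_fun setT L by exact: measurable_Rintegral_section.
have BE : dform e e0 = - 2 * \int[m]_x (e0 x * L x) by exact: dform_weak_iterated.
have A0 : 0 <= A by rewrite -lee_fin -mSA.
set N := (\int[m]_x ((e0 x) ^+ 2)%:E)%E in poinc.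
have N0 : (0 <= N)%E by apply: integral_ge0 => x _; rewrite lee_fin sqr_ge0.
have [n NE] : exists n, N = n%:E.
  by exists (fine N); rewrite fineK// ge0_fin_numE.
(* The weight in Young's inequality is chosen so that, after the factor 2 of the weak form and the
   Poincare inequality, the term in [e0] costs half of [dform e0 e0]. *)
have key : `|\int[m]_x (e0 x * L x)| <= cP / 4 * n + F ^+ 2 / (4 * cP) * A.
  have le1 : (\int[m]_x `|e0 x * L x|%:E <=
      \int[m]_x ((cP / 4)%:E * ((e0 x) ^+ 2)%:E + (F ^+ 2 / (4 * cP))%:E * (\1_S x)%:E))%E.
    apply: ae_ge0_le_integral => //.
    - by apply/measurable_EFinP; apply: measurableT_comp => //; exact: measurable_funM.
    - move=> x _; rewrite -!EFinM -EFinD lee_fin addr_ge0// mulr_ge0 ?sqr_ge0//.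
        by rewrite divr_ge0// ltW.
      by rewrite divr_ge0 ?sqr_ge0// mulr_ge0// ltW.
    - apply: emeasurable_funD; apply: measurable_funeM; first exact: msq.
      by apply/measurable_EFinP; exact: measurable_indic.
    - apply: filterS aeF => x Lx _; rewrite -!EFinM -EFinD lee_fin.
      have [Sx|nSx] := pselect (S x); last first.
        by rewrite e0S// mul0r normr0 indicE memNset// mulr0 addr0 expr0n/= mulr0.
      rewrite indicE mem_set// mulr1 normrM.
      apply: (@le_trans _ _ (`|e0 x| * (F / 2))); first by rewrite ler_wpM2l// Lx.
      rewrite -(real_normK (num_real (e0 x))) -subr_ge0.
      rewrite (_ : _ - _ = (cP * `|e0 x| - F) ^+ 2 / (4 * cP)).
        by rewrite divr_ge0 ?sqr_ge0// mulr_ge0// ltW.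
      by field; rewrite gt_eqF.
  have rhs : (\int[m]_x ((cP / 4)%:E * ((e0 x) ^+ 2)%:E + (F ^+ 2 / (4 * cP))%:E * (\1_S x)%:E)
      = (cP / 4 * n + F ^+ 2 / (4 * cP) * A)%:E)%E.
    have c1 : 0 <= cP / 4 by rewrite divr_ge0// ltW.
    have c2 : 0 <= F ^+ 2 / (4 * cP) by rewrite divr_ge0 ?sqr_ge0// mulr_ge0// ltW.
    rewrite ge0_integralD//; last 4 first.
    - by move=> x _; rewrite -EFinM lee_fin mulr_ge0 ?sqr_ge0.
    - by apply: measurable_funeM; exact: msq.
    - by move=> x _; rewrite -EFinM lee_fin mulr_ge0.
    - by apply: measurable_funeM; apply/measurable_EFinP; exact: measurable_indic.
    have mS1 : measurable_fun setT (fun x => (\1_S x : R)%:E).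
      by apply/measurable_EFinP; exact: measurable_indic.
    have S10 x : (0 <= (\1_S x : R)%:E)%E by rewrite lee_fin.
    rewrite (ge0_integralZl _ measurableT (msq m0) (fun x _ => msq0 e0 x))//.
    rewrite (ge0_integralZl _ measurableT mS1 (fun x _ => S10 x))//.
    rewrite -/N NE (integral_indic _ measurableT mS).
    by rewrite setIT -[X in (_ + _ * X)%E]/(m S) mSA -!EFinM -EFinD.
  have mF : measurable_fun setT (fun x => e0 x * L x) by exact: measurable_funM.
  have iF : m.-integrable setT (EFin \o (fun x => e0 x * L x)).
    apply/integrableP; split; first exact/measurable_EFinP.
    by apply: le_lt_trans le1 _; rewrite rhs ltry.
  apply: (le_trans (le_normr_Rintegral _ iF)) => //.
  rewrite -lee_fin -rhs; apply: le_trans _ le1.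
  rewrite /Rintegral fineK//.
  by apply: integrable_fin_num => //; exact: (integrable_norm iF).
have BE2 : dform e0 e0 = dform e e0 - dform eg e0 by rewrite dformDl//; lra.
(* With weight 2 the cross term costs a quarter of [dform e0 e0]. The quarter that remains accounts
   for the factors 2 and 4 of the conclusion. *)
have Y := @dform_youngN 2 _ _ ltac:(lra) ig i0.
have P1 : cP * n <= dform e0 e0 by move: poinc; rewrite NE -EFinM lee_fin.
move: key; rewrite ler_norml => /andP[k1 _].
have E1 : F ^+ 2 / (4 * cP) * A = (F ^+ 2 * A / cP) / 4 by field; rewrite gt_eqF.
have E2 : 2 * F ^+ 2 * A / cP = 2 * (F ^+ 2 * A / cP) by field; rewrite gt_eqF.
rewrite E1 in k1; rewrite E2; move: k1 Y P1 BE BE2.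
set Z := F ^+ 2 * A / cP.
set I0 := \int[m]_x _; move: (dform e0 e0) (dform e e0) (dform eg e0) (dform eg eg) => a1 a2 a3 a4.
have -> : cP / 4 * n = cP * n / 4 by field.
by move: (cP * n) Z I0 => p Z I0; lra.
Qed.

End dirichlet_form.

(** * The nonlocal Poincare inequality *)

Section nonlocal_poincare.
Context {R : realType}.
Local Notation PP := (plane R).
Implicit Types (v : PP -> R) (z : PP).

Lemma sqr_sum_le (n : nat) (a : nat -> R) :
  (\sum_(j < n) a j) ^+ 2 <= n%:R * \sum_(j < n) (a j) ^+ 2.
Proof.
elim: n => [|n IH]; first by rewrite !big_ord0 mul0r expr0n.
rewrite !big_ord_recr/=; set S := \sum_(_ < _) _ in IH *.
set Q := \sum_(_ < _) _ in IH *; set b := a n.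
have Q0 : 0 <= Q by apply: sumr_ge0 => i _; exact: sqr_ge0.
have [n0|n0] := posnP n.
  move: IH; rewrite n0 mul0r => S0.
  have : S ^+ 2 == 0 by rewrite eq_le S0 sqr_ge0.
  rewrite sqrf_eq0 => /eqP ->; rewrite add0r.
  by rewrite mul1r lerDr.
have n0' : 0 < n%:R :> R by rewrite ltr0n.
have : 0 <= n%:R^-1 * (S - n%:R * b) ^+ 2.
  by rewrite mulr_ge0 ?invr_ge0 ?sqr_ge0// ltW.
rewrite (_ : _ * _ = n%:R^-1 * S ^+ 2 - 2 * S * b + n%:R * b ^+ 2); last first.
  by field; rewrite gt_eqF.
have : n%:R^-1 * S ^+ 2 <= Q by rewrite mulrC ler_pdivrMr// mulrC.
rewrite -natr1 => h1 h2.
rewrite (_ : (S + b) ^+ 2 = S ^+ 2 + 2 * S * b + b ^+ 2); last by ring.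
by rewrite mulrDl mul1r mulrDr; lra.
Qed.

Let mshift v z : measurable_fun setT v ->
  measurable_fun setT (fun x : PP => v (x + z)).
Proof.
move=> mv; apply: (measurableT_comp mv).
apply: (measurable_fun_pair (f := fun x : PP => x.1 + z.1)
  (g := fun x : PP => x.2 + z.2)).
  by apply: measurable_funD => //; exact: measurable_fst.
by apply: measurable_funD => //; exact: measurable_snd.
Qed.

(** Where [v x] is nonzero, [- v x] is the sum of the [n] increments along [z]. Cauchy-Schwarz costs
    one factor [n]; the increments have equal norms by translation invariance, and adding them costs
    the other. *)
Lemma leb2_telescope v z (n : nat) : measurable_fun setT v ->
  (forall x, v x != 0 -> v (x + z *+ n) = 0) ->
  (\int[leb2]_x ((v x) ^+ 2)%:E <=
    (n%:R ^+ 2)%:E * \int[leb2]_x ((v (x + z)%R - v x) ^+ 2)%:E)%E.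
Proof.
move=> mv vn.
pose a x j := v (x + z *+ j.+1) - v (x + z *+ j).
have ma j : measurable_fun setT (fun x : PP => ((a x j) ^+ 2)%:E).
  apply/measurable_EFinP; apply: measurable_funX; apply: measurable_funB;
    exact: mshift.
have a0 x j : (0 <= ((a x j) ^+ 2)%:E)%E by rewrite lee_fin sqr_ge0.
have mS : measurable_fun setT (fun x : PP => (\sum_(j < n) ((a x j) ^+ 2)%:E)%E).
  apply: (@emeasurable_sum _ _ _ _ _ _ (fun (j : 'I_n) (x : PP) => ((a x j) ^+ 2)%:E)).
  by move=> j; exact: ma.
have le x : (v x) ^+ 2 <= n%:R * \sum_(j < n) (a x j) ^+ 2.
  have [->|vx] := eqVneq (v x) 0.
    rewrite expr0n/= mulr_ge0//; apply: sumr_ge0 => i _; exact: sqr_ge0.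
  apply: le_trans (sqr_sum_le _ _); rewrite /a.
  rewrite -(big_mkord xpredT (fun j => v (x + z *+ j.+1) - v (x + z *+ j))).
  by rewrite (telescope_sumr (fun j => v (x + z *+ j)))// vn// mulr0n addr0 sub0r sqrrN.
have ashift j : (\int[leb2]_x ((a x j) ^+ 2)%:E =
    \int[leb2]_x ((v (x + z)%R - v x) ^+ 2)%:E)%E.
  have mF : measurable_fun setT (fun x : PP => ((v (x + z)%R - v x) ^+ 2)%:E).
    apply/measurable_EFinP; apply: measurable_funX; apply: measurable_funB => //.
    exact: mshift.
  rewrite -(ge0_leb2_shift (z *+ j) mF)//; last first.
    by move=> x; rewrite lee_fin sqr_ge0.
  by apply: eq_integral => x _; rewrite /a mulrSr addrA.
apply: (@le_trans _ _ (\int[leb2]_x (n%:R%:E * \sum_(j < n) ((a x j) ^+ 2)%:E))%E).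
  apply: ge0_le_integral => //.
  - by move=> x _; rewrite lee_fin sqr_ge0.
  - by apply/measurable_EFinP; exact: measurable_funX.
  - exact: measurable_funeM.
  - by move=> x _; rewrite sumEFin -EFinM lee_fin.
have S0 x : (0 <= \sum_(j < n) ((a x j) ^+ 2)%:E)%E by exact: sume_ge0.
rewrite ge0_integralZl//.
rewrite (@ge0_integral_sum _ _ _ _ _ measurableT _
  (fun (j : 'I_n) (x : PP) => ((a x j) ^+ 2)%:E))//.
under eq_bigr do rewrite ashift.
rewrite expr2 EFinM -muleA; apply: lee_wpmul2l; first by rewrite lee_fin.
rewrite mule_natl big_const_ord le_eqVlt; apply/orP; left; apply/eqP.
by elim: (n) => // i IH; rewrite iterS IH; case: i {IH} => //=; rewrite adde0.
Qed.

(* A function supported in the strip |x_1| < D vanishes after translation by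
   n z as soon as n |z_1| >= 2 D. *)
Lemma leb2_translation_lower v z (D : R) : 0 < D -> measurable_fun setT v ->
  (forall x, v x != 0 -> `|x.1| < D) -> `|z.1| <= 2 * D ->
  ((z.1 ^+ 2 / (16 * D ^+ 2))%:E * \int[leb2]_x ((v x) ^+ 2)%:E <=
    \int[leb2]_x ((v (x + z)%R - v x) ^+ 2)%:E)%E.
Proof.
move=> D0 mv vD zD.
have [z0|z0] := eqVneq z.1 0.
  rewrite z0 expr0n/= mul0r mul0e; apply: integral_ge0 => x _.
  by rewrite lee_fin sqr_ge0.
have z0' : 0 < `|z.1| by rewrite normr_gt0.
(* The least integer strictly above [2 * D / |z.1|]. As [|z.1| <= 2 * D], it satisfies
   [n * |z.1| <= 4 * D], whence the constant [16 * D ^+ 2]. *)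
pose n := (Num.truncn (2 * D / `|z.1|)).+1.
have n1 : 2 * D < n%:R * `|z.1|.
  by rewrite -ltr_pdivrMr// truncnS_gt.
have n2 : n%:R * `|z.1| <= 4 * D.
  have : 1 <= 2 * D / `|z.1| by rewrite ler_pdivlMr// mul1r.
  have tr : (Num.truncn (2 * D / `|z.1|))%:R <= 2 * D / `|z.1|.
    by rewrite truncn_le// divr_ge0// ?mulr_ge0// ltW.
  rewrite -ler_pdivlMr// /n -natr1 (_ : 4 * D / `|z.1| = 2 * D / `|z.1| + 2 * D / `|z.1|).
    by lra.
  by field; rewrite gt_eqF.
have vn x : v x != 0 -> v (x + z *+ n) = 0.
  move=> vx; apply/eqP/negP => /negP /vD /=.
  have := vD _ vx.
  have -> : (z *+ n).1 = z.1 *+ n by elim: (n) => // i IH; rewrite !mulrSr/= IH.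
  rewrite -mulr_natl.
  have : n%:R * `|z.1| = `|n%:R * z.1| by rewrite normrM ger0_norm.
  have := ler_norm (n%:R * z.1); have := ler_norm (- (n%:R * z.1)).
  rewrite normrN => _ _ e.
  have : `|n%:R * z.1| <= `|x.1 + n%:R * z.1| + `|x.1|.
    have := ler_normB (x.1 + n%:R * z.1) x.1.
    by rewrite (_ : x.1 + n%:R * z.1 - x.1 = n%:R * z.1)//; ring.
  lra.
have := leb2_telescope mv vn => H.
have n0 : 0 < n%:R :> R by rewrite ltr0n.
apply: (@le_trans _ _ ((n%:R ^+ 2)^-1%:E * \int[leb2]_x ((v x) ^+ 2)%:E)%E).
  apply: lee_wpmul2r; first by apply: integral_ge0 => x _; rewrite lee_fin sqr_ge0.
  rewrite lee_fin ler_pdivrMr ?mulr_gt0 ?exprn_gt0//.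
  rewrite mulrC ler_pdivlMr ?exprn_gt0//.
  rewrite -exprMn -(real_normK (num_real (z.1 * n%:R))) normrM (ger0_norm (ltW n0)).
  rewrite (_ : 16 * D ^+ 2 = (4 * D) ^+ 2); last by ring.
  by rewrite ler_sqr ?nnegrE ?mulr_ge0 ?(ltW D0)// mulrC.
have n20 : (0 <= (n%:R ^+ 2)^-1%:E :> \bar R)%E by rewrite lee_fin invr_ge0 sqr_ge0.
apply: le_trans (lee_wpmul2l n20 H) _.
by rewrite muleA -EFinM mulVf ?mul1e// sqrf_eq0 gt_eqF.
Qed.

(** The kernel is replaced by the translation invariant minorant [kap]. In the variable [z = y - x]
    the energy becomes an integral over [z] of squared norms of increments, each bounded below by
    the translation estimate, and the second moment of [kap] along the first axis is what
    remains. *)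
Theorem nonlocal_poincare v (D : R) (kap : PP -> R) (k : PP -> PP -> R) (M : R) :
  0 < D -> measurable_fun setT v -> (forall x, v x != 0 -> `|x.1| < D) ->
  measurable_fun setT kap -> (forall z, 0 <= kap z) ->
  (forall z, kap z != 0 -> `|z.1| <= 2 * D) ->
  measurable_fun setT (fun z : PP * PP => k z.1 z.2) -> (forall x y, 0 <= k x y) ->
  (forall x y, v x != 0 \/ v y != 0 -> kap (y - x) <= k x y) ->
  (M%:E <= \int[leb2]_z (kap z * z.1 ^+ 2)%:E)%E ->
  ((M / (16 * D ^+ 2))%:E * \int[leb2]_x ((v x) ^+ 2)%:E <=
    \int[leb2]_x \int[leb2]_y ((v y - v x) ^+ 2 * k x y)%:E)%E.
Proof.
move=> D0 mv vD mkap kap0 kapD mk k0 kapk MM.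
have mv1 : measurable_fun setT (fun z : PP * PP => v z.1).
  by apply: (measurableT_comp mv); exact: measurable_fst.
have mv2 : measurable_fun setT (fun z : PP * PP => v z.2).
  by apply: (measurableT_comp mv); exact: measurable_snd.
have madd : measurable_fun setT (fun z : PP * PP => z.1 + z.2 : PP).
  apply: (measurable_fun_pair (f := fun z : PP * PP => z.1.1 + z.2.1)
    (g := fun z : PP * PP => z.1.2 + z.2.2)).
    by apply: measurable_funD; apply: (measurableT_comp measurable_fst).
  by apply: measurable_funD; apply: (measurableT_comp measurable_snd).
have msub : measurable_fun setT (fun z : PP * PP => z.2 - z.1 : PP).
  apply: (measurable_fun_pair (f := fun z : PP * PP => z.2.1 - z.1.1)
    (g := fun z : PP * PP => z.2.2 - z.1.2)).
    by apply: measurable_funB; apply: (measurableT_comp measurable_fst).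
  by apply: measurable_funB; apply: (measurableT_comp measurable_snd).
pose F (z : PP * PP) := ((v z.2 - v z.1) ^+ 2 * k z.1 z.2)%:E.
pose F' (z : PP * PP) := ((v z.2 - v z.1) ^+ 2 * kap (z.2 - z.1))%:E.
pose F'' (z : PP * PP) := ((v (z.1 + z.2) - v z.1) ^+ 2 * kap z.2)%:E.
have mF : measurable_fun setT F.
  apply/measurable_EFinP; apply: measurable_funM => //.
  by apply: measurable_funX; exact: measurable_funB.
have mF' : measurable_fun setT F'.
  apply/measurable_EFinP; apply: measurable_funM => //.
    by apply: measurable_funX; exact: measurable_funB.
  exact: (measurableT_comp mkap).
have mF'' : measurable_fun setT F''.
  apply/measurable_EFinP; apply: measurable_funM => //.
    apply: measurable_funX; apply: measurable_funB => //.
    exact: (measurableT_comp mv).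
  exact: (measurableT_comp mkap).
have F0 (z : PP * PP) : (0 <= F z)%E by rewrite lee_fin mulr_ge0// sqr_ge0.
have F'0 (z : PP * PP) : (0 <= F' z)%E by rewrite lee_fin mulr_ge0// sqr_ge0.
have F''0 (z : PP * PP) : (0 <= F'' z)%E by rewrite lee_fin mulr_ge0// sqr_ge0.
apply: (@le_trans _ _ (\int[leb2s]_x \int[leb2s]_y F' (x, y))%E); last first.
  apply: ge0_le_integral => //.
  - by move=> x _; exact: integral_ge0.
  - exact: (measurable_fun_fubini_tonelli_F (m2 := leb2s) F').
  - exact: (measurable_fun_fubini_tonelli_F (m2 := leb2s) F).
  - move=> x _; apply: ge0_le_integral => //.
    + exact: (measurableT_comp mF' (pair1_measurable x)).
    + exact: (measurableT_comp mF (pair1_measurable x)).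
    + move=> y _; rewrite lee_fin/=.
      (* The minorant is available only where [v x] or [v y] is nonzero, which is the case as soon
         as the increment is. *)
      have [->|vyx] := eqVneq (v y) (v x); first by rewrite subrr expr0n/= !mul0r.
      apply: ler_wpM2l; first exact: sqr_ge0.
      apply: kapk; apply/orP; apply: contraNT vyx.
      by rewrite negb_or !negbK => /andP[/eqP -> /eqP ->].
have -> : (\int[leb2s]_x \int[leb2s]_y F' (x, y) =
    \int[leb2s]_x \int[leb2s]_y F'' (x, y))%E.
  apply: eq_integral => x _.
  rewrite -[LHS](@ge0_leb2_shift R x (fun y => F' (x, y)))//.
    by apply: eq_integral => y _; rewrite /F' /F''/= addrK (addrC x).
  exact: (measurableT_comp mF' (pair1_measurable x)).
rewrite (fubini_tonelli (m1 := leb2s) (m2 := leb2s) F'')//.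
set N := (\int[leb2]_x ((v x) ^+ 2)%:E)%E.
have N0 : (0 <= N)%E by apply: integral_ge0 => x _; rewrite lee_fin sqr_ge0.
apply: (@le_trans _ _ (\int[leb2s]_z ((kap z * z.1 ^+ 2)%:E * ((16 * D ^+ 2)^-1%:E * N)))%E).
  have m1 : measurable_fun setT (fun z : PP => (kap z * z.1 ^+ 2)%:E).
    apply/measurable_EFinP; apply: measurable_funM => //.
    by apply: measurable_funX; exact: measurable_fst.
  have c0 : 0 <= (16 * D ^+ 2)^-1 by rewrite invr_ge0 mulr_ge0// sqr_ge0.
  rewrite ge0_integralZr//; last 2 first.
  - by move=> z _; rewrite lee_fin mulr_ge0// sqr_ge0.
  - by rewrite mule_ge0// lee_fin.
  rewrite EFinM -muleA; apply: lee_wpmul2r => //.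
  by rewrite mule_ge0// lee_fin.
apply: ge0_le_integral => //.
- move=> z _; apply: mule_ge0; first by rewrite lee_fin mulr_ge0// sqr_ge0.
  by rewrite mule_ge0// lee_fin invr_ge0 mulr_ge0// sqr_ge0.
- rewrite (_ : (fun _ => _) = (fun z : PP => ((16 * D ^+ 2)^-1%:E * N) * (kap z * z.1 ^+ 2)%:E)%E).
    apply: measurable_funeM; apply/measurable_EFinP; apply: measurable_funM => //.
    by apply: measurable_funX; exact: measurable_fst.
  by apply/funext => z; rewrite muleC.
- exact: (measurable_fun_fubini_tonelli_G (m1 := leb2s) F'').
- move=> z _; rewrite /F''/=.
  under eq_integral do rewrite mulrC EFinM.
  rewrite ge0_integralZl//; last 3 first.
  - apply/measurable_EFinP; apply: measurable_funX; apply: measurable_funB => //.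
    exact: mshift.
  - by move=> x _; rewrite lee_fin sqr_ge0.
  - by rewrite lee_fin.
  have [->|kz] := eqVneq (kap z) 0; first by rewrite !mul0r !mul0e.
  rewrite EFinM -muleA; apply: lee_wpmul2l; first by rewrite lee_fin.
  by rewrite muleA -EFinM; apply: leb2_translation_lower => //; exact: kapD.
Qed.

End nonlocal_poincare.

(** * Inscribed polygons *)

Section convex_hull.
Context {R : realType}.
Local Notation P := (R * R)%type.
Implicit Types (A : set P) (p q : P).

Lemma sub_conv_hull A : A `<=` conv_hull A.
Proof.
move=> p Ap; exists 1%N, (fun=> p), (fun=> 1); split => //.
- by rewrite big_ord1.
- by rewrite !big_ord1 !mul1r; case: p Ap.
Qed.

Lemma conv_hull_convex A p q (t : R) : 0 <= t <= 1 ->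
  conv_hull A p -> conv_hull A q ->
  conv_hull A ((1 - t) * p.1 + t * q.1, (1 - t) * p.2 + t * q.2).
Proof.
move=> /andP[t0 t1] [m [v [w [vA w0 w1 ->]]]] [n [v' [w' [v'A w'0 w'1 ->]]]]/=.
exists (m + n)%N, (fun i => match fintype.split i with inl j => v j | inr j => v' j end).
exists (fun i => match fintype.split i with
  | inl j => (1 - t) * w j | inr j => t * w' j end).
have E (f : P -> R) : \sum_(i < m + n) (match fintype.split i with
    inl j => (1 - t) * w j | inr j => t * w' j end) *
    f (match fintype.split i with inl j => v j | inr j => v' j end) =
    (1 - t) * (\sum_(i < m) w i * f (v i)) + t * (\sum_(i < n) w' i * f (v' i)).
  rewrite big_split_ord/= !mulr_sumr; congr (_ + _); apply: eq_bigr => i _.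
    by rewrite -[lshift _ _]/(unsplit (inl i)) unsplitK mulrA.
  by rewrite -[rshift _ _]/(unsplit (inr i)) unsplitK mulrA.
split.
- by move=> i; case: fintype.split.
- move=> i; case: fintype.split => j; rewrite mulr_ge0//; lra.
- have := E (fun=> 1); under eq_bigr do rewrite mulr1; move=> ->.
  under eq_bigr do rewrite mulr1.
  under [X in _ + _ * X]eq_bigr do rewrite mulr1.
  by rewrite w1 w'1; ring.
- by rewrite (E fst) (E snd).
Qed.


Lemma conv_hull_affine_le A p (a b c : R) :
  (forall q, A q -> a + b * q.1 + c * q.2 <= 0) -> conv_hull A p ->
  a + b * p.1 + c * p.2 <= 0.
Proof.
move=> H [m [v [w [vA w0 w1 ->]]]] /=.
rewrite -[a]mulr1 -w1 !mulr_sumr -!big_split/=; apply: sumr_le0 => i _.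
have := H _ (vA i); have := w0 i => wi vi.
rewrite (_ : _ + _ = w i * (a + b * (v i).1 + c * (v i).2)); last by ring.
by rewrite mulr_ge0_le0.
Qed.

End convex_hull.

Section inscribed_polygon.
Context {R : realType}.
Local Notation P := (R * R)%type.

Lemma sin_le (x : R) : 0 <= x -> sin x <= x.
Proof.
rewrite le_eqVlt => /predU1P[<-|x0]; first by rewrite sin0.
have : exists2 c, c \in `]0, x[ & sin x - sin 0 = cos c * (x - 0).
  apply: (MVT x0 (fun c _ => is_derive_sin c)).
  by apply: continuous_subspaceT; exact: continuous_sin.
move=> [c _]; rewrite sin0 !subr0 => ->.
by rewrite ger_pMl// cos_le1.
Qed.

(** Without such a [k], a nonnegative value is always followed by a positive one; positivity then
    propagates from [i] up to [n], hence to 0, and from there to [j]. *)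
Lemma cyclic_sign_change (n : nat) (C : nat -> R) i j :
  (i < n)%N -> (j < n)%N -> C n = C 0%N -> 0 <= C i -> C j <= 0 ->
  exists2 k, (k < n)%N & 0 <= C k /\ C k.+1 <= 0.
Proof.
move=> ilt jlt Cn Ci Cj; apply: contrapT => H.
have step k : (k < n)%N -> 0 <= C k -> 0 < C k.+1.
  move=> kn Ck; rewrite ltNge; apply/negP => Ck1; apply: H.
  by exists k.
have fromi k : (k < n - i)%N -> 0 < C (i + k).+1.
  elim: k => [|k IH] kn; first by rewrite addn0; exact: step.
  rewrite addnS; apply: step; last by apply/ltW/IH; exact: ltn_trans kn.
  by rewrite -addnS; move: kn; rewrite ltn_subRL.
have C0 : 0 < C 0%N.
  have ni : (0 < n - i)%N by rewrite subn_gt0.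
  have := fromi (n - i).-1; rewrite -addnS prednK// subnKC ?(ltnW ilt)// Cn.
  by apply; rewrite leqnn.
have all k : (k <= n)%N -> 0 < C k.
  elim: k => // k IH kn; apply: step => //; exact/ltW/IH/ltnW.
by have := all j (ltnW jlt); rewrite ltNge Cj.
Qed.


Let cross (p q : P) : R := p.1 * q.2 - p.2 * q.1.

Lemma angle_mono (Q : polygon) i j : polygon_ok Q ->
  (i <= j <= sides Q)%N -> (angle Q i <= angle Q j :> R).
Proof.
move=> [_ incr _] /andP[ij jn]; elim: j ij jn => [|j IH].
  by rewrite leqn0 => /eqP ->.
rewrite leq_eqVlt => /predU1P[->//|ij] jn.
by rewrite (le_trans (IH _ (ltnW jn)))// ltW// incr.
Qed.

Lemma cos_le0_pihalf (x : R) : pi / 2 <= x <= 3 * (pi / 2) -> cos x <= 0.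
Proof.
move=> x2; have : 0 <= cos (x - pi) by apply: cos_ge0_pihalf; lra.
by rewrite -[in cos x](subrK pi x) cosDpi; lra.
Qed.

(* If some gap between consecutive angles were at least pi, the polygon would
   lie in a half plane having the center on its boundary. *)
Lemma angle_gap_lt_pi (d r : R) x Q k : 0 < d -> 0 < r -> polygon_ok Q ->
  disc x r `<=` poly_set d x Q -> (k < sides Q)%N ->
  angle Q k.+1 - angle Q k < pi.
Proof.
move=> d0 r0 Qok xr kn; have [n3 incr per] := Qok.
rewrite ltNge; apply/negP => gap.
set a := angle Q k in gap; set b := angle Q k.+1 in gap.
(* Direction of the bisector of the gap: up to sign, every vertex makes with it an angle between
   [pi / 2] and [3 * pi / 2]. *)
pose m := (a + b) / 2.
have neg j : (j < sides Q)%N -> cos (angle Q j - m) <= 0.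
  move=> jn; have p0 := @pi_gt0 R; have [jk|kj] := leqP j k.
    have h1 : angle Q j <= a by apply: angle_mono => //; rewrite jk ltnW.
    have h2 : angle Q 0 <= angle Q j by apply: angle_mono => //; rewrite leq0n ltnW.
    have h3 : b <= angle Q (sides Q) by apply: angle_mono => //; rewrite kn leqnn.
    rewrite -cosN opprB; apply: cos_le0_pihalf; rewrite /m; lra.
  have h1 : b <= angle Q j by apply: angle_mono => //; rewrite kj ltnW.
  have h2 : angle Q 0 <= a by apply: angle_mono => //; rewrite leq0n ltnW.
  have h3 : angle Q j <= angle Q (sides Q) by apply: angle_mono => //; rewrite leqnn ltnW.
  by apply: cos_le0_pihalf; rewrite /m; lra.
have xm : disc x r (x.1 + r / 2 * cos m, x.2 + r / 2 * sin m).
  rewrite /disc/= /ed/= (_ : _ + _ = (r / 2) ^+ 2 * (cos m ^+ 2 + sin m ^+ 2)).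
    by rewrite cos2Dsin2 mulr1 sqrtr_sqr ger0_norm; lra.
  by ring.
move: (xr _ xm); move/(@conv_hull_affine_le _ _ _ (- (x.1 * cos m + x.2 * sin m)) (cos m) (sin m)).
rewrite /=.
have -> : - (x.1 * cos m + x.2 * sin m) + cos m * (x.1 + r / 2 * cos m) +
  sin m * (x.2 + r / 2 * sin m) = r / 2.
  transitivity (r / 2 * (cos m ^+ 2 + sin m ^+ 2)); first by ring.
  by rewrite cos2Dsin2 mulr1.
move=> H; suff : r / 2 <= 0 by lra.
apply: H => _ [j /= jn <-]; rewrite /vertex/=.
rewrite [X in X <= 0](_ : _ = d * cos (angle Q j - m)); last by rewrite cosB; ring.
by rewrite mulr_ge0_le0 ?neg// ltW.
Qed.

(** A side seen from the center under the angle [2 * e] has length [2 * d * sin e] and lies at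
    distance [d * cos e]; from [sin e <= S] one gets [cos e >= cos e ^+ 2 >= 1 - S ^+ 2]. A point
    this close to the center is thus in the triangle spanned by the center and the side whose sector
    contains it. *)
Lemma inscribed_polygon_disc (d r S : R) x y Q :
  0 < d -> 0 < r -> polygon_ok Q -> disc x r `<=` poly_set d x Q ->
  longest_side d x Q <= 2 * d * S ->
  ed x y < d * (1 - S ^+ 2) -> poly_set d x Q y.
Proof.
move=> d0 r0 Qok xr LS xy; have [n3 incr per] := Qok.
have xP : poly_set d x Q x.
  by apply: xr; rewrite /disc/= /ed !subrr !expr0n/= addr0 sqrtr0.
(* [C k] is nonnegative when the direction of [y] is counterclockwise from that of vertex [k], so a
   change of sign locates the sector of [y]. *)
pose C k := cross (vertex d x Q k - x) (y - x).
have [k kn [Ck Ck1]] : exists2 k, (k < sides Q)%N & 0 <= C k /\ C k.+1 <= 0.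
  have Cn : C (sides Q) = C 0%N.
    rewrite /C /vertex per.
    by rewrite (_ : 2 * pi = pi *+ 2) ?mulr_natl// cosD2pi sinD2pi.
  (* The center is a convex combination of vertices, so an affine form vanishing at the center
     cannot have the same strict sign at all of them. *)
  have H (s : R) : (forall j, (j < sides Q)%N -> s * C j < 0) -> False.
    move=> neg; have := xP.
    move=> [m [v [w [vA w0 w1 xE]]]].
    have vC i : s * cross (v i - x) (y - x) < 0.
      by have [j /= jn <-] := vA i; exact: neg.
    have : \sum_(i < m) w i * (s * cross (v i - x) (y - x)) = 0.
      pose f (p : P) := s * cross (p - x) (y - x).
      have fE (p : P) : f p = s * (- x.1 * (y.2 - x.2) + x.2 * (y.1 - x.1)) +
          s * (y.2 - x.2) * p.1 - s * (y.1 - x.1) * p.2 by rewrite /f /cross/=; ring.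
      have -> : \sum_(i < m) w i * (s * cross (v i - x) (y - x)) =
          s * (- x.1 * (y.2 - x.2) + x.2 * (y.1 - x.1)) * \sum_(i < m) w i +
          s * (y.2 - x.2) * (\sum_(i < m) w i * (v i).1) -
          s * (y.1 - x.1) * (\sum_(i < m) w i * (v i).2).
        rewrite !mulr_sumr -big_split -sumrB/=; apply: eq_bigr => i _.
        by rewrite -/(f (v i)) fE; ring.
      have [-> ->] : (\sum_(i < m) w i * (v i).1 = x.1) /\
          (\sum_(i < m) w i * (v i).2 = x.2).
        by split; [exact: esym (congr1 fst xE)|exact: esym (congr1 snd xE)].
      by rewrite w1; ring.
    have [i wi] : exists i, 0 < w i.
      apply: contrapT => nw; have : \sum_(i < m) w i = 0.
        apply: big1 => i _; apply/eqP; rewrite eq_le w0 andbT leNgt.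
        by apply/negP => wi; apply: nw; exists i.
      by rewrite w1 => /eqP; rewrite oner_eq0.
    rewrite (bigD1 i)//= => E.
    have : \sum_(j < m | j != i) w j * (s * cross (v j - x) (y - x)) <= 0.
      by apply: sumr_le0 => j _; rewrite mulr_ge0_le0 ?w0// ltW.
    have : w i * (s * cross (v i - x) (y - x)) < 0 by rewrite pmulr_rlt0.
    by lra.
  have [i iln Ci] : exists2 i, (i < sides Q)%N & 0 <= C i.
    apply: contrapT => nC; apply: (H 1) => j jn; rewrite mul1r ltNge.
    by apply/negP => Cj; apply: nC; exists j.
  have [j jln Cj] : exists2 i, (i < sides Q)%N & C i <= 0.
    apply: contrapT => nC; apply: (H (-1)) => j jn; rewrite mulN1r oppr_lt0 ltNge.
    by apply/negP => Cj; apply: nC; exists j.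
  exact: (cyclic_sign_change iln jln Cn Ci Cj).
have gap := angle_gap_lt_pi d0 r0 Qok xr kn.
have gap0 := incr _ kn.
pose m := (angle Q k + angle Q k.+1) / 2.
pose e := (angle Q k.+1 - angle Q k) / 2.
have aE : angle Q k = m - e by rewrite /m /e; lra.
have bE : angle Q k.+1 = m + e by rewrite /m /e; lra.
have ce0 : 0 < cos e by apply: cos_gt0_pihalf; rewrite /e; lra.
have se0 : 0 < sin e by apply: sin_gt0_pihalf; rewrite /e; lra.
have m1 := cos2Dsin2 m; have e1 := cos2Dsin2 e.
have VE : vertex d x Q k = (x.1 + d * (cos m * cos e + sin m * sin e),
   x.2 + d * (sin m * cos e - cos m * sin e)).
  by rewrite /vertex aE cosB sinB.
have WE : vertex d x Q k.+1 = (x.1 + d * (cos m * cos e - sin m * sin e),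
   x.2 + d * (sin m * cos e + cos m * sin e)).
  by rewrite /vertex bE cosD sinD.
have sS : sin e <= S.
  have : ed (vertex d x Q k) (vertex d x Q k.+1) <= 2 * d * S.
    apply: le_trans LS; rewrite /longest_side.
    exact: (le_bigmax (0 : R) (fun i : 'I_(sides Q) =>
      ed (vertex d x Q i) (vertex d x Q i.+1)) (Ordinal kn)).
  rewrite VE WE /ed/= (_ : _ + _ = (2 * d * sin e) ^+ 2); last first.
    transitivity ((2 * d * sin e) ^+ 2 * (cos m ^+ 2 + sin m ^+ 2)); first by ring.
    by rewrite m1 mulr1.
  rewrite sqrtr_sqr ger0_norm; last by rewrite !mulr_ge0// ltW.
  by rewrite ler_pM2l// mulr_gt0.
have cS : 1 - S ^+ 2 <= cos e.
  have : cos e ^+ 2 <= cos e by rewrite expr2 ger_pMr// cos_le1.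
  have : sin e ^+ 2 <= S ^+ 2 by rewrite ler_sqr ?nnegrE ?(ltW se0)// (le_trans (ltW se0)).
  by lra.
set cm := cos m in m1 VE WE; set sm := sin m in m1 VE WE.
set ce := cos e in e1 ce0 cS VE WE; set se := sin e in e1 se0 VE WE.
pose z1 := y.1 - x.1; pose z2 := y.2 - x.2.
(* Cramer's rule for [y - x] in the basis formed by the two vertices seen from the center; the
   denominator is their determinant [d ^+ 2 * sin (2 * e)]. *)
pose al := - C k.+1 / (2 * d ^+ 2 * ce * se).
pose be := C k / (2 * d ^+ 2 * ce * se).
have den : 0 < 2 * d ^+ 2 * ce * se by rewrite !mulr_gt0.
have al0 : 0 <= al by rewrite divr_ge0 ?oppr_ge0// ltW.
have be0 : 0 <= be by rewrite divr_ge0// ltW.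
have abE : al + be = (z1 * cm + z2 * sm) / (d * ce).
  rewrite /al /be /C VE WE /cross/= -/z1 -/z2; field.
  by rewrite !gt_eqF.
have zm : z1 * cm + z2 * sm <= ed x y.
  apply: le_trans (ler_norm _) _.
  rewrite -(sqrtr_sqr (_ + _)) /ed -/z1 -/z2; apply: ler_wsqrtr.
  rewrite -subr_ge0 (_ : _ - _ = (z1 * sm - z2 * cm) ^+ 2) ?sqr_ge0//.
  transitivity ((z1 ^+ 2 + z2 ^+ 2) * (cm ^+ 2 + sm ^+ 2) - (z1 * cm + z2 * sm) ^+ 2).
    by rewrite m1 mulr1.
  by ring.
have ab1 : al + be <= 1.
  rewrite abE ler_pdivrMr ?mulr_gt0// mul1r (le_trans zm)// (le_trans (ltW xy))//.
  by rewrite ler_wpM2l// ltW.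
have yE : (y.1 = x.1 + al * ((vertex d x Q k).1 - x.1) + be * ((vertex d x Q k.+1).1 - x.1)) *
   (y.2 = x.2 + al * ((vertex d x Q k).2 - x.2) + be * ((vertex d x Q k.+1).2 - x.2)).
  rewrite /al /be /C VE WE /cross/= -/z1 -/z2.
  rewrite -[y.1](subrK x.1) -[y.2](subrK x.2) -/z1 -/z2; split.
    transitivity (x.1 + z1 * (cm ^+ 2 + sm ^+ 2)); first by rewrite m1 mulr1 addrC.
    by field; rewrite !gt_eqF.
  transitivity (x.2 + z2 * (cm ^+ 2 + sm ^+ 2)); first by rewrite m1 mulr1 addrC.
  by field; rewrite !gt_eqF.
have VP : poly_set d x Q (vertex d x Q k).
  by apply: sub_conv_hull; exists k.
have WP : poly_set d x Q (vertex d x Q k.+1).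
  apply: sub_conv_hull; have [kn'|] := ltnP k.+1 (sides Q); first by exists k.+1.
  move=> nk; have kE : k.+1 = sides Q by apply/eqP; rewrite eqn_leq kn.
  exists 0%N => /=; first by rewrite -kE.
  by rewrite kE /vertex per (_ : 2 * pi = pi *+ 2) ?mulr_natl// cosD2pi sinD2pi.
have [ab0|abn0] := eqVneq (al + be) 0.
  have a0 : al = 0 by lra.
  have b0 : be = 0 by lra.
  suff -> : y = x by [].
  by rewrite (surjective_pairing y) (surjective_pairing x) !yE a0 b0 !mul0r !addr0.
have ab : 0 < al + be by rewrite lt_neqAle eq_sym abn0 addr_ge0.
(* The point where the ray from the center through [y] meets the side; [y] lies on the segment from
   the center to it, with parameter [al + be]. *)
have U : poly_set d x Q
    ((1 - be / (al + be)) * (vertex d x Q k).1 + be / (al + be) * (vertex d x Q k.+1).1,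
     (1 - be / (al + be)) * (vertex d x Q k).2 + be / (al + be) * (vertex d x Q k.+1).2).
  apply: conv_hull_convex => //; rewrite divr_ge0//= ?(ltW ab)//.
  by rewrite ler_pdivrMr// mul1r lerDr.
have := conv_hull_convex (t := al + be) _ xP U => /=.
rewrite ab1 (ltW ab) => /(_ isT); congr (poly_set d x Q _).
have key (a b X V W : R) : a + b != 0 -> (1 - (a + b)) * X +
    (a + b) * ((1 - b / (a + b)) * V + b / (a + b) * W) = X + a * (V - X) + b * (W - X).
  by move=> abn; field.
by rewrite (surjective_pairing y); congr (_, _); rewrite !yE; exact: key.
Qed.

End inscribed_polygon.

(** * Taylor expansions *)

Section taylor.
Context {R : realType}.
Local Notation P := (R * R)%type.
Implicit Types (D : set P) (p q e : P) (f g : P -> R).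

Lemma is_derive_path f p e (t l : R) :
  is_derive (p + t *: e) e f l -> is_derive t 1 (fun s => f (p + s *: e)) l.
Proof.
have E : (fun h : R => h^-1 *: (f (h *: e + (p + t *: e)) - f (p + t *: e))) =
    (fun h : R => h^-1 *: (f (p + (h *: (1 : R) + t) *: e) - f (p + t *: e))).
  apply/funext => h; congr (_ *: (f _ - _)).
  by rewrite scalerDl /= [in RHS]/GRing.scale/= mulr1 addrCA.
move=> [fd <-]; apply: DeriveDef; rewrite /derivable /derive/= -?E//.
Qed.

(** One integration in the proof of Taylor's formula, done by the mean value theorem; the factor
    [1 / n.+1] of an exact integration is given up. *)
Lemma derive_bound_step (F dF : R -> R) (M t : R) (n : nat) : F 0 = 0 -> 0 <= M ->
  (forall s : R, `|s| <= `|t| -> is_derive s 1 F (dF s)) ->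
  (forall s, `|s| <= `|t| -> `|dF s| <= M * `|s| ^+ n) ->
  `|F t| <= M * `|t| ^+ n.+1.
Proof.
move=> F0 M0 Fd Fb.
have cont s : `|s| <= `|t| -> {for s, continuous F}.
  move=> st; have [dFs _] := Fd s st.
  exact/differentiable_continuous/derivable1_diffP.
have [c ct Fc] : exists2 c, `|c| <= `|t| & F t - F 0 = dF c * (t - 0).
  have [t0|t0|<-] := ltgtP 0 t.
  - have [c c0 cE] : exists2 c, c \in `]0, t[ & F t - F 0 = dF c * (t - 0).
      apply: MVT => //.
        move=> s; rewrite in_itv/= => /andP[s0 st]; apply: Fd.
        by rewrite !ger0_norm ?ltW.
      apply: continuous_in_subspaceT => s; rewrite inE/= in_itv/= => /andP[s0 st].
      by apply: cont; rewrite !ger0_norm ?(ltW t0).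
    exists c => //; move: c0; rewrite in_itv/= => /andP[c0 ct].
    by rewrite !ger0_norm ?ltW.
  - have [c c0 cE] : exists2 c, c \in `]t, 0[ & F 0 - F t = dF c * (0 - t).
      apply: MVT => //.
        move=> s; rewrite in_itv/= => /andP[s0 st]; apply: Fd.
        by rewrite !ltr0_norm// lerN2 ltW.
      apply: continuous_in_subspaceT => s; rewrite inE/= in_itv/= => /andP[s0 st].
      by apply: cont; rewrite (ler0_norm st) (ltr0_norm t0) lerN2.
    exists c; last by lra.
    move: c0; rewrite in_itv/= => /andP[c0 ct].
    by rewrite !ltr0_norm// lerN2 ltW.
  - by exists 0; rewrite ?normr0// !subrr mulr0.
have -> : F t = dF c * t by move: Fc; rewrite F0 !subr0.
rewrite normrM exprSr mulrA ler_wpM2r// (le_trans (Fb _ ct))// ler_wpM2l//.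
by rewrite lerXn2r// nnegrE.
Qed.

Definition has_partial D e f g := forall x, D x -> is_derive x e f (g x).

Lemma has_partial_path D e f g p (t : R) : has_partial D e f g ->
  D (p + t *: e) -> is_derive t 1 (fun s => f (p + s *: e)) (g (p + t *: e)).
Proof. by move=> fg Dp; apply: is_derive_path; exact: fg. Qed.

Lemma taylor1 D e f0 f1 p (M t : R) : 0 <= M -> has_partial D e f0 f1 ->
  (forall x, D x -> `|f1 x| <= M) ->
  (forall s, `|s| <= `|t| -> D (p + s *: e)) ->
  `|f0 (p + t *: e) - f0 p| <= M * `|t|.
Proof.
move=> M0 f01 fM Dp; rewrite -[X in _ * X]expr1.
apply: (@derive_bound_step (fun s => f0 (p + s *: e) - f0 p)
  (fun s => f1 (p + s *: e)) M t 0) => //.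
- by rewrite scale0r addr0 subrr.
- move=> s st; have := has_partial_path f01 (Dp _ st) => dF.
  by apply: is_derive_eq; rewrite subr0.
- by move=> s st; rewrite expr0 mulr1; exact/fM/Dp.
Qed.

(** The derivative of this remainder is the remainder of one order less for [f1]; the next two
    orders are reached in the same way. *)
Lemma taylor2 D e f0 f1 f2 p (M t : R) : 0 <= M -> has_partial D e f0 f1 ->
  has_partial D e f1 f2 -> (forall x, D x -> `|f2 x| <= M) ->
  (forall s, `|s| <= `|t| -> D (p + s *: e)) ->
  `|f0 (p + t *: e) - f0 p - t * f1 p| <= M * `|t| ^+ 2.
Proof.
move=> M0 f01 f12 fM Dp.
apply: (@derive_bound_step (fun s => f0 (p + s *: e) - f0 p - s * f1 p)
  (fun s => f1 (p + s *: e) - f1 p) M t 1) => //.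
- by rewrite scale0r addr0 mul0r !subrr.
- move=> s st; have := has_partial_path f01 (Dp _ st) => dF.
  by apply: is_derive_eq; rewrite /GRing.scale/=; ring.
- move=> s st; rewrite expr1; apply: (taylor1 M0 f12 fM) => r rs.
  exact/Dp/(le_trans rs).
Qed.

Lemma taylor3 D e f0 f1 f2 f3 p (M t : R) : 0 <= M -> has_partial D e f0 f1 ->
  has_partial D e f1 f2 -> has_partial D e f2 f3 ->
  (forall x, D x -> `|f3 x| <= M) ->
  (forall s, `|s| <= `|t| -> D (p + s *: e)) ->
  `|f0 (p + t *: e) - f0 p - t * f1 p - t ^+ 2 / 2 * f2 p| <= M * `|t| ^+ 3.
Proof.
move=> M0 f01 f12 f23 fM Dp.
apply: (@derive_bound_step (fun s => f0 (p + s *: e) - f0 p - s * f1 p - s ^+ 2 / 2 * f2 p)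
  (fun s => f1 (p + s *: e) - f1 p - s * f2 p) M t 2) => //.
- by rewrite scale0r addr0 !expr2 !mul0r !subrr.
- move=> s st; have := has_partial_path f01 (Dp _ st) => dF.
  by apply: is_derive_eq; rewrite /GRing.scale/=; field.
- move=> s st; apply: (taylor2 M0 f12 f23 fM) => r rs.
  exact/Dp/(le_trans rs).
Qed.

Lemma taylor4 D e f0 f1 f2 f3 f4 p (M t : R) : 0 <= M -> has_partial D e f0 f1 ->
  has_partial D e f1 f2 -> has_partial D e f2 f3 -> has_partial D e f3 f4 ->
  (forall x, D x -> `|f4 x| <= M) ->
  (forall s, `|s| <= `|t| -> D (p + s *: e)) ->
  `|f0 (p + t *: e) - f0 p - t * f1 p - t ^+ 2 / 2 * f2 p - t ^+ 3 / 6 * f3 p| <= M * `|t| ^+ 4.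
Proof.
move=> M0 f01 f12 f23 f34 fM Dp.
apply: (@derive_bound_step (fun s => f0 (p + s *: e) - f0 p - s * f1 p - s ^+ 2 / 2 * f2 p
    - s ^+ 3 / 6 * f3 p)
  (fun s => f1 (p + s *: e) - f1 p - s * f2 p - s ^+ 2 / 2 * f3 p) M t 3) => //.
- by rewrite scale0r addr0 !exprS !mul0r !subrr.
- move=> s st; have := has_partial_path f01 (Dp _ st) => dF.
  by apply: is_derive_eq; rewrite /GRing.scale/=; field.
- move=> s st; apply: (taylor3 M0 f12 f23 f34 fM) => r rs.
  exact/Dp/(le_trans rs).
Qed.

End taylor.

Section taylor_plane.
Context {R : realType}.
Local Notation P := (R * R)%type.
Implicit Types (D : set P) (u : P -> R) (x : P).

Lemma CbS n D u : Cb n.+1 D u ->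
  [/\ Cb n D ('D_(@e1 R) u), Cb n D ('D_(@e2 R) u),
      has_partial D (@e1 R) u ('D_(@e1 R) u) &
      has_partial D (@e2 R) u ('D_(@e2 R) u)].
Proof.
move=> [_ _ [ud u1 u2]]; split => // x Dx; have [d1 d2] := ud x Dx;
  exact: DeriveDef.
Qed.

Lemma Cb_bounded n D u : Cb n D u ->
  exists2 M : R, 0 <= M & forall x, D x -> `|u x| <= M.
Proof.
case: n => [|n] [_ [M uM] _]; exists `|M| => // x /uM/le_trans; apply; exact: ler_norm.
Qed.

Lemma shift_e1 x (t : R) : x + t *: @e1 R = (x.1 + t, x.2).
Proof.
by rewrite [LHS]surjective_pairing /= /GRing.scale/= mulr1 mulr0 addr0.
Qed.

Lemma shift_e2 x (t : R) : x + t *: @e2 R = (x.1, x.2 + t).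
Proof.
by rewrite [LHS]surjective_pairing /= /GRing.scale/= mulr1 mulr0 addr0.
Qed.

(* The expansion is taken first along e1 at (x.1, x.2 + b) and then along e2 at
   x, so that neither the chain rule nor the symmetry of mixed derivatives is
   needed.  In the fourth-order estimate every term that does not come from the
   Laplacian is odd in a or odd in b. *)
Lemma taylor_plane D (u u1 u2 u11 u12 u22 u111 u112 u122 u222
    u1111 u1112 u1122 u1222 u2222 : P -> R) (M : R) x : 0 <= M ->
  has_partial D (@e1 R) u u1 -> has_partial D (@e2 R) u u2 ->
  has_partial D (@e1 R) u1 u11 -> has_partial D (@e2 R) u1 u12 ->
  has_partial D (@e2 R) u2 u22 ->
  has_partial D (@e1 R) u11 u111 -> has_partial D (@e2 R) u11 u112 ->
  has_partial D (@e2 R) u12 u122 -> has_partial D (@e2 R) u22 u222 ->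
  has_partial D (@e1 R) u111 u1111 -> has_partial D (@e2 R) u111 u1112 ->
  has_partial D (@e2 R) u112 u1122 -> has_partial D (@e2 R) u122 u1222 ->
  has_partial D (@e2 R) u222 u2222 ->
  (forall y, D y -> `|u1 y| <= M) -> (forall y, D y -> `|u2 y| <= M) ->
  (forall y, D y -> `|u11 y| <= M) -> (forall y, D y -> `|u12 y| <= M) ->
  (forall y, D y -> `|u22 y| <= M) -> (forall y, D y -> `|u1111 y| <= M) ->
  (forall y, D y -> `|u1112 y| <= M) -> (forall y, D y -> `|u1122 y| <= M) ->
  (forall y, D y -> `|u1222 y| <= M) -> (forall y, D y -> `|u2222 y| <= M) ->
  exists c : nat -> R, forall a b : R,
  (forall s t, `|s| <= `|a| -> `|t| <= `|b| -> D (x.1 + s, x.2 + t)) ->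
  [/\ `|u (x.1 + a, x.2 + b) - u x| <= M * (`|a| + `|b|),
      `|u (x.1 + a, x.2 + b) - u x - a * u1 x - b * u2 x| <=
        2 * M * (a ^+ 2 + b ^+ 2)
    & `|u (x.1 + a, x.2 + b) - u x
       - (a ^+ 2 / 2 * u11 x + b ^+ 2 / 2 * u22 x)
       - a * (c 0%N + c 1%N * b + c 2%N * b ^+ 2 + c 3%N * a ^+ 2)
       - b * (c 4%N + c 5%N * b ^+ 2 + c 6%N * a ^+ 2)| <=
       5 * M * (a ^+ 2 + b ^+ 2) ^+ 2].
Proof.
move=> Mp p1 p2 p11 p12 p22 p111 p112 p122 p222 p1111 p1112 p1122 p1222 p2222.
move=> b1 b2 b11 b12 b22 b1111 b1112 b1122 b1222 b2222.
(* Coefficients of the monomials [a], [a b], [a b^2], [a^3], [b], [b^3] and [a^2 b], each odd in [a]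
   or in [b]. *)
exists (fun n => nth 0 [:: u1 x; u12 x; u122 x / 2; u111 x / 6; u2 x; u222 x / 6; u112 x / 2] n).
move=> a b box /=.
pose q : P := (x.1, x.2 + b).
have qE : q = x + b *: @e2 R by rewrite shift_e2.
have zE : (x.1 + a, x.2 + b) = q + a *: @e1 R by rewrite shift_e1.
have box1 s : `|s| <= `|a| -> D (q + s *: @e1 R).
  by move=> sa; rewrite shift_e1/=; exact: box.
have box2 s : `|s| <= `|b| -> D (x + s *: @e2 R).
  by move=> sb; rewrite shift_e2 -[x.1]addr0; apply: box => //; rewrite normr0.
rewrite zE.
split.
- have := taylor1 Mp p1 b1 box1.
  have := taylor1 Mp p2 b2 box2; rewrite -qE => h1 h2.
  rewrite (_ : u (q + a *: @e1 R) - u x = (u (q + a *: @e1 R) - u q) + (u q - u x)); last by ring.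
  by apply: le_trans (ler_normD _ _) _; lra.
- have := taylor2 Mp p1 p11 b11 box1.
  have := taylor2 Mp p2 p22 b22 box2.
  have := taylor1 Mp p12 b12 box2; rewrite -qE => h1 h2 h3.
  rewrite (_ : _ - _ = (u (q + a *: @e1 R) - u q - a * u1 q) + (u q - u x - b * u2 x)
    + a * (u1 q - u1 x)); last by ring.
  apply: le_trans (ler_normD _ _) _.
  apply: le_trans (lerD (ler_normD _ _) (lexx _)) _; rewrite normrM.
  have : `|a| * `|u1 q - u1 x| <= `|a| * (M * `|b|) by rewrite ler_wpM2l.
  have : M * (`|a| * `|b|) <= M * (2^-1 * (`|a| ^+ 2 + `|b| ^+ 2)).
    rewrite ler_wpM2l//; have := sqr_ge0 (`|a| - `|b|).
    rewrite (_ : (`|a| - `|b|) ^+ 2 = `|a| ^+ 2 + `|b| ^+ 2 - 2 * (`|a| * `|b|)); first lra.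
    by ring.
  rewrite -(real_normK (num_real a)) -(real_normK (num_real b)) => h4 h5.
  have := mulr_ge0 Mp (sqr_ge0 `|a|); have := mulr_ge0 Mp (sqr_ge0 `|b|).
  by lra.
- have := taylor4 Mp p1 p11 p111 p1111 b1111 box1.
  have := taylor4 Mp p2 p22 p222 p2222 b2222 box2.
  have := taylor3 Mp p12 p122 p1222 b1222 box2.
  have := taylor2 Mp p112 p1122 b1122 box2.
  have := taylor1 Mp p1112 b1112 box2.
  rewrite -qE => h1 h2 h3 h4 h5.
  (* [u] is expanded along [e1] at [q]; then [u], [u1], [u11] and [u111] are expanded along [e2] at
     [x], with remainders of orders 4, 3, 2 and 1. The five remainders account for the factor 5. *)
  rewrite (_ : _ - b * _ =
   (u (q + a *: @e1 R) - u q - a * u1 q - a ^+ 2 / 2 * u11 q - a ^+ 3 / 6 * u111 q)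
   + (u q - u x - b * u2 x - b ^+ 2 / 2 * u22 x - b ^+ 3 / 6 * u222 x)
   + a * (u1 q - u1 x - b * u12 x - b ^+ 2 / 2 * u122 x)
   + a ^+ 2 / 2 * (u11 q - u11 x - b * u112 x)
   + a ^+ 3 / 6 * (u111 q - u111 x)); last by field.
  have tri5 (A B C E F : R) : `|A + B + C + E + F| <= `|A| + `|B| + `|C| + `|E| + `|F|.
    do 4 (apply: le_trans (ler_normD _ _) _; apply: lerD => //).
  apply: le_trans (tri5 _ _ _ _ _) _.
  move: h1 h2 h3 h4 h5; set w1 := u111 q - _; set w2 := u11 q - _ - _.
  set w3 := u1 q - _ - _ - _; set w4 := u q - _ - _ - _ - _.
  set w5 := u (q + _) - _ - _ - _ - _ => h1 h2 h3 h4 h5.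
  have N2 : `|a ^+ 2 / 2 * w2| = `|a| ^+ 2 / 2 * `|w2|.
    by rewrite normrM normrM normrX normfV (ger0_norm (_ : 0 <= 2)).
  have N3 : `|a ^+ 3 / 6 * w1| = `|a| ^+ 3 / 6 * `|w1|.
    by rewrite normrM normrM normrX normfV (ger0_norm (_ : 0 <= 6)).
  rewrite N2 N3 (normrM a) {N2 N3}.
  rewrite -(real_normK (num_real a)) -(real_normK (num_real b)).
  move: h1 h2 h3 h4 h5; set al := `|a|; set be := `|b| => h1 h2 h3 h4 h5.
  have al0 : 0 <= al by exact: normr_ge0.
  have be0 : 0 <= be by exact: normr_ge0.
  set S := al ^+ 2 + be ^+ 2.
  have sa : al ^+ 2 <= S by rewrite /S lerDl sqr_ge0.
  have sb : be ^+ 2 <= S by rewrite /S lerDr sqr_ge0.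
  have S0 : 0 <= S by rewrite /S addr_ge0 ?sqr_ge0.
  have sab : al * be <= S.
    have := sqr_ge0 (al - be); rewrite sqrrB /S -mulr_natr.
    by have := mulr_ge0 al0 be0; lra.
  have ab0 : 0 <= al * be by exact: mulr_ge0.
  have q1 : al ^+ 4 <= S ^+ 2.
    by rewrite (_ : al ^+ 4 = al ^+ 2 * al ^+ 2) ?expr2 ?ler_pM ?sqr_ge0//; ring.
  have q2 : be ^+ 4 <= S ^+ 2.
    by rewrite (_ : be ^+ 4 = be ^+ 2 * be ^+ 2) ?expr2 ?ler_pM ?sqr_ge0//; ring.
  have q3 : al * be ^+ 3 <= S ^+ 2.
    rewrite (_ : al * be ^+ 3 = al * be * be ^+ 2); last by ring.
    by rewrite expr2 ler_pM ?sqr_ge0.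
  have q4 : al ^+ 2 * be ^+ 2 <= S ^+ 2.
    by rewrite [leRHS]expr2 ler_pM ?sqr_ge0.
  have q5 : al ^+ 3 * be <= S ^+ 2.
    rewrite (_ : al ^+ 3 * be = al * be * al ^+ 2); last by ring.
    by rewrite [leRHS]expr2 ler_pM ?sqr_ge0.
  have e3 : al * `|w3| <= M * S ^+ 2.
    apply: (@le_trans _ _ (al * (M * be ^+ 3))); first by rewrite ler_wpM2l.
    by rewrite mulrCA ler_wpM2l.
  have e2 : al ^+ 2 / 2 * `|w2| <= M * S ^+ 2.
    apply: (@le_trans _ _ (al ^+ 2 * (M * be ^+ 2))); last by rewrite mulrCA ler_wpM2l.
    by rewrite ler_pM// ?divr_ge0 ?sqr_ge0// ler_pdivrMr// ler_peMr ?sqr_ge0// ler1n.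
  have e1' : al ^+ 3 / 6 * `|w1| <= M * S ^+ 2.
    apply: (@le_trans _ _ (al ^+ 3 * (M * be))); last by rewrite mulrCA ler_wpM2l.
    by rewrite ler_pM// ?divr_ge0 ?exprn_ge0// ler_pdivrMr// ler_peMr ?exprn_ge0// ler1n.
  have e4 : `|w4| <= M * S ^+ 2 by rewrite (le_trans h4)// ler_wpM2l.
  have e5 : `|w5| <= M * S ^+ 2 by rewrite (le_trans h5)// ler_wpM2l.
  by lra.
Qed.

Lemma Cb4_taylor D u : Cb 4 D u -> exists2 M : R, 0 <= M & forall x, D x ->
  [/\ `|u x| <= M, `|laplacian u x| <= M & exists c : nat -> R, forall a b : R,
  (forall s t, `|s| <= `|a| -> `|t| <= `|b| -> D (x.1 + s, x.2 + t)) ->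
  [/\ `|u (x.1 + a, x.2 + b) - u x| <= M * (`|a| + `|b|),
      `|u (x.1 + a, x.2 + b) - u x - a * 'D_(@e1 R) u x - b * 'D_(@e2 R) u x| <=
        2 * M * (a ^+ 2 + b ^+ 2)
    & `|u (x.1 + a, x.2 + b) - u x
       - (a ^+ 2 / 2 * 'D_(@e1 R) ('D_(@e1 R) u) x + b ^+ 2 / 2 * 'D_(@e2 R) ('D_(@e2 R) u) x)
       - a * (c 0%N + c 1%N * b + c 2%N * b ^+ 2 + c 3%N * a ^+ 2)
       - b * (c 4%N + c 5%N * b ^+ 2 + c 6%N * a ^+ 2)| <=
       5 * M * (a ^+ 2 + b ^+ 2) ^+ 2]].
Proof.
move=> uC; have [M0 M00 b0] := Cb_bounded uC.
have [C1 C2 p1 p2] := CbS uC.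
have [M1 M10 b1] := Cb_bounded C1; have [M2 M20 b2] := Cb_bounded C2.
have [C11 C12 p11 p12] := CbS C1; have [_ C22 _ p22] := CbS C2.
have [M11 M110 b11] := Cb_bounded C11; have [M12 M120 b12] := Cb_bounded C12.
have [M22 M220 b22] := Cb_bounded C22.
have [C111 C112 p111 p112] := CbS C11.
have [_ C122 _ p122] := CbS C12; have [_ C222 _ p222] := CbS C22.
have [C1111 C1112 p1111 p1112] := CbS C111.
have [_ C1122 _ p1122] := CbS C112; have [_ C1222 _ p1222] := CbS C122.
have [_ C2222 _ p2222] := CbS C222.
have [M1111 M11110 b1111] := Cb_bounded C1111.
have [M1112 M11120 b1112] := Cb_bounded C1112.
have [M1122 M11220 b1122] := Cb_bounded C1122.
have [M1222 M12220 b1222] := Cb_bounded C1222.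
have [M2222 M22220 b2222] := Cb_bounded C2222.
pose M := M0 + M1 + M2 + M11 + M12 + M22 + M1111 + M1112 + M1122 + M1222 + M2222.
have L (f : P -> R) m : (forall x, D x -> `|f x| <= m) -> m <= M ->
    forall x, D x -> `|f x| <= M by move=> fm mM x /fm/le_trans; apply.
exists M => [|x Dx]; first by rewrite /M; lra.
split; first by apply: (L _ _ b0) => //; rewrite /M; lra.
  apply: le_trans (ler_normD _ _) _.
  apply: le_trans (lerD (b11 _ Dx) (b22 _ Dx)) _.
  by rewrite /M; lra.
apply: (taylor_plane x _ p1 p2 p11 p12 p22 p111 p112 p122 p222 p1111 p1112 p1122 p1222 p2222).
- by rewrite /M; lra.
- by apply: (L _ _ b1); rewrite /M; lra.
- by apply: (L _ _ b2); rewrite /M; lra.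
- by apply: (L _ _ b11); rewrite /M; lra.
- by apply: (L _ _ b12); rewrite /M; lra.
- by apply: (L _ _ b22); rewrite /M; lra.
- by apply: (L _ _ b1111); rewrite /M; lra.
- by apply: (L _ _ b1112); rewrite /M; lra.
- by apply: (L _ _ b1122); rewrite /M; lra.
- by apply: (L _ _ b1222); rewrite /M; lra.
- by apply: (L _ _ b2222); rewrite /M; lra.
Qed.

End taylor_plane.

(** * Polygonal domains *)

Section plane_borel.
Context {R : realType}.
Local Notation P := (R * R)%type.
Local Notation PP := (plane R).
Implicit Types (A D Om : set P) (p q x y z : P).

Lemma ball_prodE x (e : R) y : ball x e y <-> `|x.1 - y.1| < e /\ `|x.2 - y.2| < e.
Proof. by []. Qed.

Definition box (x : P) (r : R) : set P :=
  `]x.1 - r, x.1 + r[%classic `*` `]x.2 - r, x.2 + r[%classic.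

Lemma boxP x r y : box x r y <-> `|y.1 - x.1| < r /\ `|y.2 - x.2| < r.
Proof.
by rewrite /box/= !in_itv/= !ltr_distl; split; case=> ? ?; split.
Qed.

Lemma measurable_box x r : measurable (box x r : set PP).
Proof. exact: measurableX. Qed.

Lemma leb2_box x r : 0 <= r -> @leb2 R (box x r) = (4 * r ^+ 2)%:E.
Proof.
move=> r0; rewrite /box leb2X// !lebesgue_measure_itv/= !lte_fin.
have E (a : R) : (if a - r < a + r then ((a + r)%:E - (a - r)%:E)%E else 0%E) = (2 * r)%:E.
  case: ifPn => [_|]; first by rewrite -EFinB; congr EFin; ring.
  by rewrite -leNgt => h; congr EFin; lra.
by rewrite !E -EFinM; congr EFin; ring.
Qed.

(** The measurable sets of [plane R] come from the product structure, so an open set is written as a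
    countable union of boxes with rational data. *)
Lemma open_measurable_plane A : open A -> measurable (A : set PP).
Proof.
move=> oA.
pose F (q1 q2 e : rat) : set P :=
  if `[< box (ratr q1, ratr q2) (ratr e) `<=` A >] then box (ratr q1, ratr q2) (ratr e) else set0.
have -> : A = \bigcup_q1 \bigcup_q2 \bigcup_e F q1 q2 e.
  apply/seteqP; split => [x Ax|x [q1 _ [q2 _ [e _]]]]; last first.
    by rewrite /F; case: ifPn => // /asboolP; apply.
  have /nbhs_ballP[r /= r0 rA] : nbhs x A by apply: open_nbhs_nbhs.
  have [e] : exists e : rat, ratr e \in `](0:R), (r/2)[.
    by apply: rat_in_itvoo; rewrite divr_gt0.
  rewrite in_itv/= => /andP[e0 er].
  have [q1] : exists q : rat, ratr q \in `](x.1 - ratr e), x.1 + ratr e[.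
    by apply: rat_in_itvoo; lra.
  rewrite in_itv/= => /andP[q11 q12].
  have [q2] : exists q : rat, ratr q \in `](x.2 - ratr e), x.2 + ratr e[.
    by apply: rat_in_itvoo; lra.
  rewrite in_itv/= => /andP[q21 q22].
  exists q1 => //; exists q2 => //; exists e => //; rewrite /F.
  case: ifPn => [_|/asboolPn]; first by apply/boxP => /=; rewrite !ltr_norml; lra.
  case=> y /boxP/= []; rewrite !ltr_norml => y1 y2; apply: rA; apply/ball_prodE.
  by rewrite !ltr_norml; lra.
apply: bigcupT_measurable_rat => q1; apply: bigcupT_measurable_rat => q2.
apply: bigcupT_measurable_rat => e; rewrite /F; case: ifP => // _.
exact: measurable_box.
Qed.

Lemma closed_measurable_plane A : closed A -> measurable (A : set PP).
Proof.
move=> cA; rewrite -[A]setCK; apply: measurableC.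
by apply: open_measurable_plane; exact: closed_openC.
Qed.

Lemma continuous_within_measurable_plane D (f : P -> R) : measurable (D : set PP) ->
  {within D, continuous f} -> measurable_fun (D : set PP) (f : PP -> R).
Proof.
move=> mD /continuousP cf; apply: (measurability _ (RGenOpens.measurableE R)).
move=> _ [_ [a [b ->] <-]].
have /open_subspaceP[V oV VD] := cf _ (@interval_open _ (BRight a) (BLeft b) isT isT).
rewrite setIC -[X in measurable X]VD; apply: measurableI => //.
exact: open_measurable_plane.
Qed.

Lemma edC x y : ed x y = ed y x.
Proof. by rewrite /ed -(sqrrN (y.1 - _)) -(sqrrN (y.2 - _)) !opprB. Qed.

Lemma ed_ge0 x y : 0 <= ed x y. Proof. exact: sqrtr_ge0. Qed.

Lemma edxx x : ed x x = 0.
Proof. by rewrite /ed !subrr !expr0n/= addr0 sqrtr0. Qed.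

Lemma norm1_le_ed x y : `|y.1 - x.1| <= ed x y.
Proof. exact: (norm1_le_enorm (y - x)). Qed.

Lemma norm2_le_ed x y : `|y.2 - x.2| <= ed x y.
Proof. exact: (norm2_le_enorm (y - x)). Qed.

Lemma ed_le_norm x y : ed x y <= `|y.1 - x.1| + `|y.2 - x.2|.
Proof.
rewrite /ed -[leRHS]ger0_norm ?addr_ge0// -[leRHS]sqrtr_sqr; apply: ler_wsqrtr.
rewrite [leRHS]sqrrD !real_normK ?num_real// addrAC lerDl.
by rewrite mulrn_wge0// mulr_ge0.
Qed.

Lemma ed_triangle x y z : ed x z <= ed x y + ed y z.
Proof.
set a1 := y.1 - x.1; set a2 := y.2 - x.2; set b1 := z.1 - y.1; set b2 := z.2 - y.2.
have e0 : 0 <= ed x y + ed y z by rewrite addr_ge0 ?ed_ge0.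
rewrite -(ger0_norm e0) -sqrtr_sqr {1}/ed; apply: ler_wsqrtr.
rewrite [leRHS]sqrrD /ed !sqr_sqrtr ?addr_ge0 ?sqr_ge0// -/a1 -/a2 -/b1 -/b2 -sqrtrM ?addr_ge0 ?sqr_ge0//.
have -> : z.1 - x.1 = a1 + b1 by rewrite /a1 /b1; ring.
have -> : z.2 - x.2 = a2 + b2 by rewrite /a2 /b2; ring.
have : a1 * b1 + a2 * b2 <= Num.sqrt ((a1 ^+ 2 + a2 ^+ 2) * (b1 ^+ 2 + b2 ^+ 2)).
  apply: le_trans (ler_norm _) _; rewrite -sqrtr_sqr; apply: ler_wsqrtr.
  rewrite -subr_ge0 (_ : _ - _ = (a1 * b2 - a2 * b1) ^+ 2) ?sqr_ge0//; ring.
rewrite mulr2n; set s := Num.sqrt _ => h.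
rewrite (_ : (a1 + b1) ^+ 2 + _ = a1 ^+ 2 + a2 ^+ 2 + (b1 ^+ 2 + b2 ^+ 2)
  + 2 * (a1 * b1 + a2 * b2)); last by ring.
by lra.
Qed.

Lemma disc_open x (d : R) : open (disc x d).
Proof.
rewrite openE => y /= yd; apply/nbhs_ballP; exists ((d - ed x y) / 2) => /=.
  by rewrite divr_gt0// subr_gt0.
move=> z /ball_prodE[z1 z2]; rewrite /disc/=.
apply: le_lt_trans (ed_triangle x y z) _.
have := ed_le_norm y z; rewrite !(distrC _ y.1) !(distrC _ y.2) in z1 z2 *.
by lra.
Qed.

Lemma dist_ltP y F (d : R) : F !=set0 ->
  dist y F < d <-> exists2 z, F z & ed y z < d.
Proof.
move=> [z0 Fz0]; split => [|[z Fz yz]].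
  move=> /inf_lt[]; first by exists (ed y z0), z0.
  by move=> _ [z Fz <-] yz; exists z.
apply: le_lt_trans yz; apply: ge_inf; last by exists z.
by exists 0 => _ [w _ <-]; exact: ed_ge0.
Qed.

(** The point sought is the last one on the segment from [x] to [y] that lies in the closure: were
    it in [Om], a slightly later point would still be. Being on the segment, it is no farther from
    either end than the ends are from each other. *)
Lemma frontier_crossing Om x y : open Om -> closure Om x -> ~ Om y ->
  exists2 z, frontier Om z & ed x z <= ed x y /\ ed y z <= ed x y.
Proof.
move=> oOm cx ny.
pose g (t : R) : P := (x.1 + t * (y.1 - x.1), x.2 + t * (y.2 - x.2)).
have gcont : continuous g.
  move=> t; apply: (cvg_pair (F := nbhs t) (G := nbhs (g t).1) (H := nbhs (g t).2)).
    by apply: cvgD; [exact: cvg_cst|apply: cvgM; [exact: cvg_id|exact: cvg_cst]].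
  by apply: cvgD; [exact: cvg_cst|apply: cvgM; [exact: cvg_id|exact: cvg_cst]].
have g0 : g 0 = x by rewrite /g !mul0r !addr0 -surjective_pairing.
have g1 : g 1 = y by rewrite /g !mul1r !subrKC -surjective_pairing.
pose A := `[0, 1]%classic `&` (g @^-1` closure Om).
have A0 : A 0 by split => /=; rewrite ?in_itv/= ?lexx ?ler01// g0.
have cA : closed A.
  apply: closedI; first exact: itv_closed.
  by apply: closed_comp => //; exact: closed_closure.
have ubA : ubound A 1 by move=> t [/=]; rewrite in_itv/= => /andP[].
have hA : has_ubound A by exists 1.
pose s := sup A.
have As : A s.
  by rewrite ((closure_id A).1 cA); apply: closure_sup => //; exists 0.
have [/= s01 Cs] := As; move: s01; rewrite in_itv/= => /andP[s0 s1].
exists (g s).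
  split => // iOm; have Oms : Om (g s) by exact: interior_subset iOm.
  have sl1 : s < 1.
    by rewrite lt_neqAle s1 andbT; apply/eqP => s1'; apply: ny; rewrite -g1 -s1'.
  have : \forall t \near s, Om (g t) by apply: gcont; apply: open_nbhs_nbhs.
  move=> /nbhs_ballP[e /= e0 sub].
  pose t := s + Num.min (e / 2) (1 - s).
  have m0 : 0 < Num.min (e / 2) (1 - s) by rewrite lt_min divr_gt0//= subr_gt0.
  have : A t.
    split => /=.
      rewrite in_itv/=; apply/andP; split; first by rewrite /t addr_ge0// ltW.
      by rewrite /t -lerBrDl ge_min lexx orbT.
    apply: subset_closure; apply: sub; rewrite /ball/= /t opprD addrA subrr sub0r normrN.
    rewrite gtr0_norm// gt_min; apply/orP; left; lra.
  move=> /(ub_le_sup hA); rewrite -/s /t; lra.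
have e1 : ed x (g s) = s * ed x y.
  rewrite !edE -enormZ//; congr enorm; rewrite /g/=.
  by congr (_, _) => /=; ring.
have e2 : ed y (g s) = (1 - s) * ed x y.
  rewrite edC !edE -enormZ ?subr_ge0//; congr enorm; rewrite /g/=.
  by congr (_, _) => /=; ring.
rewrite e1 e2; have := ed_ge0 x y => exy; split.
  by rewrite ler_piMl// ?lerBlDr ?lerDl.
by rewrite ler_piMl// ?lerBlDr ?lerDl.
Qed.

Lemma segmentP p q z : segment p q z ->
  exists2 t : R, 0 <= t <= 1 & z = (p.1 + t * (q.1 - p.1), p.2 + t * (q.2 - p.2)).
Proof.
move=> [m [v [w [vA w0 w1 ->]]]].
pose b i : bool := `[< v i <> p >].
have vE i : v i = (p.1 + (b i)%:R * (q.1 - p.1), p.2 + (b i)%:R * (q.2 - p.2)).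
  rewrite /b; case: asboolP => [vp|/contrapT ->]; last first.
    by rewrite !mul0r !addr0 -surjective_pairing.
  by have [//|->] := vA i; rewrite !mul1r !subrKC -surjective_pairing.
exists (\sum_i w i * (b i)%:R).
  apply/andP; split; first by apply: sumr_ge0 => i _; rewrite mulr_ge0.
  rewrite -[leRHS]w1; apply: ler_sum => i _; apply: ler_piMr => //.
  by case: (b i) => /=; rewrite ?lexx ?ler01.
congr (_, _).
  rewrite mulr_suml -[p.1 in X in _ = X + _]mulr1 -[X in p.1 * X]w1 mulr_sumr -big_split/=.
  by apply: eq_bigr => i _; rewrite {1}vE/=; ring.
rewrite mulr_suml -[p.2 in X in _ = X + _]mulr1 -[X in p.2 * X]w1 mulr_sumr -big_split/=.
by apply: eq_bigr => i _; rewrite {1}vE/=; ring.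
Qed.

(** The centers are division points of the segment with spacing at most [d] in each coordinate, so a
    point within [d] of the segment is within [2 * d] of one of them in each coordinate. The bound
    on their number times [d] keeps the area of the cover of order [d]. *)
Lemma segment_tube_cover p q (d : R) : 0 < d -> exists n (c : nat -> P),
  n%:R * d <= `|q.1 - p.1| + `|q.2 - p.2| + 2 * d /\
  [set y | exists2 z, segment p q z & ed y z < d] `<=`
    \big[setU/set0]_(i < n) box (c i) (2 * d).
Proof.
move=> d0; set L := `|q.1 - p.1| + `|q.2 - p.2|.
pose n := (Num.truncn (L / d)).+1.
have L0 : 0 <= L by rewrite addr_ge0.
have n0 : 0 < n%:R :> R by rewrite ltr0n.
have nL : L / n%:R <= d.
  by rewrite ler_pdivrMr// mulrC -ler_pdivrMr// ltW// truncnS_gt.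
exists n.+1, (fun i => (p.1 + i%:R / n%:R * (q.1 - p.1), p.2 + i%:R / n%:R * (q.2 - p.2))).
split.
  have : (Num.truncn (L / d))%:R * d <= L.
    by rewrite -ler_pdivlMr// truncn_le// divr_ge0// ltW.
  by rewrite /n -!natr1 !mulrDl mul1r; lra.
move=> y /= [z /segmentP[t /andP[t0 t1] zE] yz].
pose i := Num.truncn (t * n%:R).
have tn0 : 0 <= t * n%:R by rewrite mulr_ge0// ltW.
have it : i%:R <= t * n%:R by rewrite truncn_le.
have ti : t * n%:R < i.+1%:R by rewrite truncnS_gt.
have ilt : (i < n.+1)%N.
  rewrite ltnS -(ler_nat R); apply: le_trans it _.
  by rewrite ler_piMl// ltW.
have tin : `|t - i%:R / n%:R| <= n%:R^-1.
  rewrite ger0_norm; last by rewrite subr_ge0 ler_pdivrMr.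
  rewrite lerBlDr -[X in X + _]mul1r -mulrDl ler_pdivlMr// addrC natr1.
  exact: ltW.
have bnd (a : R) : `|a| <= L -> `|t * a - i%:R / n%:R * a| <= d.
  move=> aL; rewrite -mulrBl normrM; apply: le_trans nL.
  by rewrite mulrC ler_pM.
rewrite -(bigcup_mkord n.+1 (fun i => box (p.1 + i%:R / n%:R * (q.1 - p.1), p.2 + i%:R / n%:R * (q.2 - p.2)) (2 * d))).
exists i => //; apply/boxP => /=.
have y1 := norm1_le_ed y z; have y2 := norm2_le_ed y z.
have b1 : `|q.1 - p.1| <= L by rewrite lerDl.
have b2 : `|q.2 - p.2| <= L by rewrite lerDr.
have := bnd _ b1; have := bnd _ b2.
move: y1 y2; rewrite zE/=; move: (i%:R / n%:R) yz => e; rewrite zE.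
move: (q.1 - p.1) (q.2 - p.2) (ed y _) => u1 u2 r rd.
rewrite !ler_norml !ltr_norml => y1 y2 b3 b4.
have E1 : t * u1 - e * u1 + e * u1 = t * u1 by ring.
have E2 : t * u2 - e * u2 + e * u2 = t * u2 by ring.
by split; lra.
Qed.

Lemma leb2_segment_tube p q : exists2 C : R, 0 <= C & forall d : R, 0 < d <= 1 ->
  exists2 B : set PP, measurable B &
    [set y | exists2 z, segment p q z & ed y z < d] `<=` B /\
    (@leb2 R B <= (C * d)%:E)%E.
Proof.
exists (16 * (`|q.1 - p.1| + `|q.2 - p.2| + 2)); first by rewrite mulr_ge0// !addr_ge0.
move=> d /andP[d0 d1]; have [n [c [nd cov]]] := segment_tube_cover p q d0.
exists (\big[setU/set0]_(i < n) box (c i) (2 * d)).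
  by apply: bigsetU_measurable => i _; exact: measurable_box.
split => //.
have mB i : (i < n)%N -> measurable (box (c i) (2 * d) : set PP).
  by move=> _; exact: measurable_box.
apply: le_trans (@Boole_inequality _ _ _ (@leb2 R) (fun i => box (c i) (2 * d)) n mB) _.
rewrite /=; under eq_bigr do rewrite leb2_box ?mulr_ge0 ?(ltW d0)//.
rewrite sumEFin lee_fin sumr_const card_ord.
rewrite (_ : _ *+ n = 16 * d * (n%:R * d)); last by rewrite -mulr_natr; ring.
rewrite (_ : 16 * _ * d = 16 * d * (`|q.1 - p.1| + `|q.2 - p.2| + 2)); last by ring.
rewrite ler_wpM2l ?mulr_ge0 ?(ltW d0)// (le_trans nd)// lerD2l.
by rewrite ler_piMr.
Qed.

End plane_borel.

(** * Measurability and area of the domain, of its strip and of its frontier *)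

Section polygonal_domain.
Context {R : realType}.
Local Notation P := (R * R)%type.
Local Notation PP := (plane R).
Variable Om : set P.
Hypothesis hOm : open_polygon Om.
Implicit Types (x y z : P) (d : R).

Lemma polygon_open : open Om. Proof. by case: hOm. Qed.

Lemma polygon_frontier0 : frontier Om !=set0.
Proof.
have [_ _ _ [m [v [m3 _ -> _]]]] := hOm.
exists (v (Ordinal (ltn_trans (isT : (0 < 2)%N) m3))).
exists (Ordinal (ltn_trans (isT : (0 < 2)%N) m3)) => //.
by apply: sub_conv_hull; left.
Qed.

Lemma OcP y d : Oc Om d y <-> ~ Om y /\ exists2 z, frontier Om z & ed y z < d.
Proof. by rewrite /Oc/=; split => -[ny /(dist_ltP _ _ polygon_frontier0)]. Qed.

Lemma OhP y d : Oh Om d y <-> Om y \/ exists2 z, frontier Om z & ed y z < d.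
Proof.
split; first by case=> [|/OcP[_]]; [left|right].
case=> [|h]; first by left.
by have [|ny] := pselect (Om y); [left|right; apply/OcP].
Qed.

Lemma Oh_open d : open (Oh Om d).
Proof.
have -> : Oh Om d = Om `|` \bigcup_(z in frontier Om) disc z d.
  apply/seteqP; split => y; first by case/OhP => [|[z Fz]]; [left|rewrite edC => yz; right; exists z].
  case=> [Oy|[z Fz yz]]; apply/OhP; [by left|right; exists z => //].
  by rewrite edC.
apply: openU; first exact: polygon_open.
by apply: bigcup_open => z _; exact: disc_open.
Qed.

Lemma measurable_Om : measurable (Om : set PP).
Proof. by apply: open_measurable_plane; exact: polygon_open. Qed.

Lemma measurable_Oh d : measurable (Oh Om d : set PP).
Proof. by apply: open_measurable_plane; exact: Oh_open. Qed.

Lemma OcE d : Oc Om d = Oh Om d `\` Om.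
Proof.
apply/seteqP; split => y; first by move=> yc; split; [right|case: yc].
by case=> -[].
Qed.

Lemma measurable_Oc d : measurable (Oc Om d : set PP).
Proof. by rewrite OcE; apply: measurableD; [exact: measurable_Oh|exact: measurable_Om]. Qed.


(** A point of the disc outside [Om] has a frontier point between it and [x]. Hence the horizon of a
    point of [Om] never leaves [Oh Om d]. *)
Lemma disc_sub_Oh x d : closure Om x -> disc x d `<=` Oh Om d.
Proof.
move=> cx y xy; apply/OhP; have [|ny] := pselect (Om y); [by left|right].
have [z Fz [_ yz]] := frontier_crossing polygon_open cx ny.
by exists z => //; exact: le_lt_trans xy.
Qed.

Lemma Oh_mono d d' : d <= d' -> Oh Om d `<=` Oh Om d'.
Proof.
move=> dd y /OhP[|[z Fz yz]]; first by left.
by apply/OhP; right; exists z => //; exact: lt_le_trans dd.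
Qed.

Lemma frontier_sub_Oc d : 0 < d -> frontier Om `<=` Oc Om d.
Proof.
move=> d0 z Fz; apply/OcP; split; last by exists z; rewrite ?edxx.
case: Fz => _ ni Oz; apply: ni; apply: open_nbhs_nbhs; split => //.
exact: polygon_open.
Qed.

Lemma polygon_strip : exists2 D : R, 0 < D & forall x, Om x -> `|x.1| < D /\ `|x.2| < D.
Proof.
have [_ _ [M [_ MO]] _] := hOm.
exists (`|M| + 2); first by rewrite ltr_wpDl.
move=> x Ox; have : `|x| <= `|M| + 1.
  by apply: MO => //; rewrite (le_lt_trans (ler_norm _))// ltrDl.
rewrite prod_normE ge_max => /andP[h1 h2]; split; lra.
Qed.

Lemma leb2_Om_fin : (@leb2 R Om < +oo)%E.
Proof.
have [D D0 DO] := polygon_strip.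
apply: (@le_lt_trans _ _ (@leb2 R (box 0 D))).
  apply: le_measure; rewrite ?inE; [exact: measurable_Om|exact: measurable_box|].
  by move=> x /DO[x1 x2]; apply/boxP; rewrite !subr0.
by rewrite leb2_box ?ltry// ltW.
Qed.

(** The strip is covered by tubes around the sides, whose areas are at most linear in [d]. *)
Lemma leb2_Oc_le : exists2 C : R, 0 <= C & forall d, 0 < d <= 1 ->
  (@leb2 R (Oc Om d) <= (C * d)%:E)%E.
Proof.
have [_ _ _ [m [v [m3 _ fE _]]]] := hOm.
have /choice[C HC] (i : 'I_m) : exists C : R, 0 <= C /\ forall d : R, 0 < d <= 1 ->
    exists2 B : set PP, measurable B &
    [set y | exists2 z, segment (v i) (v (ordS i)) z & ed y z < d] `<=` B /\
    (@leb2 R B <= (C * d)%:E)%E.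
  by have [C C0 H] := leb2_segment_tube (v i) (v (ordS i)); exists C.
exists (\sum_(i < m) C i); first by apply: sumr_ge0 => i _; have [] := HC i.
move=> d d01.
have /choice[B HB] (i : 'I_m) : exists B : set PP, [/\ measurable B,
    [set y | exists2 z, segment (v i) (v (ordS i)) z & ed y z < d] `<=` B &
    (@leb2 R B <= (C i * d)%:E)%E].
  by have [_ /(_ _ d01)[B mB [sB lB]]] := HC i; exists B.
case: m v m3 fE C HC B HB => // m v m3 fE C HC B HB.
pose B' i := B (inord i).
have mB i : (i < m.+1)%N -> measurable (B' i) by move=> _; case: (HB (inord i)).
have mU : measurable (\big[setU/set0]_(i < m.+1) B' i).
  by apply: bigsetU_measurable => i _; exact: mB.
apply: (@le_trans _ _ (@leb2 R (\big[setU/set0]_(i < m.+1) B' i))).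
  apply: le_measure; rewrite ?inE//; first exact: measurable_Oc.
  move=> y /OcP[_ [z]]; rewrite fE => -[i _ iz] yz.
  rewrite -bigcup_mkord; exists i => /=; first exact: ltn_ord.
  rewrite /B' inord_val.
  by have [_ sB _] := HB i; apply: sB; exists z.
apply: le_trans (Boole_inequality _ mB) _.
rewrite mulr_suml -sumEFin; apply: lee_sum => i _.
by rewrite /B' inord_val; case: (HB i).
Qed.

(** The frontier lies in [Oc Om d] for every positive [d], and the areas of these strips tend to
    0. *)
Lemma leb2_frontier0 : @leb2 R (frontier Om) = 0%E.
Proof.
have [C C0 HC] := leb2_Oc_le.
apply/eqP; rewrite eq_le measure_ge0 andbT; apply/lee_addgt0Pr => e e0.
rewrite add0e; pose d := Num.min 1 (e / (C + 1)).
have C1 : 0 < C + 1 by rewrite ltr_wpDl.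
have d0 : 0 < d by rewrite lt_min ltr01 divr_gt0.
have d1 : d <= 1 by rewrite ge_min lexx.
apply: (@le_trans _ _ (@leb2 R (Oc Om d))).
  apply: le_measure; rewrite ?inE; [|exact: measurable_Oc|exact: frontier_sub_Oc].
  apply: measurableD; first by apply: closed_measurable_plane; exact: closed_closure.
  by apply: open_measurable_plane; exact: open_interior.
apply: le_trans (HC d _) _; first by rewrite d0 d1.
rewrite lee_fin; apply: (@le_trans _ _ ((C + 1) * (e / (C + 1)))).
  by rewrite ler_pM ?(ltW d0)// ?lerDl// ge_min lexx orbT.
by rewrite mulrC divfK// gt_eqF.
Qed.

Lemma leb2_Oh_fin d : 0 < d <= 1 -> (@leb2 R (Oh Om d) < +oo)%E.
Proof.
move=> d01; have [C C0 HC] := leb2_Oc_le.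
apply: (@le_lt_trans _ _ (@leb2 R Om + @leb2 R (Oc Om d))%E).
  by apply: measureU2; [exact: measurable_Om|exact: measurable_Oc].
apply: lte_add_pinfty; first exact: leb2_Om_fin.
by apply: le_lt_trans (HC d d01) _; rewrite ltry.
Qed.

End polygonal_domain.

(** * Piecewise linear interpolation *)

Section interpolation.
Context {R : realType}.
Local Notation P := (R * R)%type.
Implicit Types (t : P * P * P) (p q x : P) (T : set (P * P * P)).

Definition affine_fun (c : R * R * R) (x : P) : R := c.1.1 + c.1.2 * x.1 + c.2 * x.2.

Lemma affine_fun_conv (c : R * R * R) m (w : 'I_m -> R) (v : 'I_m -> P) :
  \sum_i w i = 1 ->
  affine_fun c (\sum_i w i * (v i).1, \sum_i w i * (v i).2) =
  \sum_i w i * affine_fun c (v i).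
Proof.
move=> w1; rewrite /affine_fun/= -[X in X + _ + _]mulr1 -[X in c.1.1 * X]w1.
by rewrite !mulr_sumr -!big_split/=; apply: eq_bigr => i _; ring.
Qed.

Lemma affine_fun_eq_hull (A : set P) (c c' : R * R * R) :
  (forall q, A q -> affine_fun c q = affine_fun c' q) ->
  forall p, conv_hull A p -> affine_fun c p = affine_fun c' p.
Proof.
move=> H p [m [v [w [vA w0 w1 ->]]]]; rewrite !affine_fun_conv//.
by apply: eq_bigr => i _; rewrite H.
Qed.

Lemma affine_fun_continuous (c : R * R * R) : continuous (affine_fun c).
Proof.
move=> x; apply: cvgD.
  apply: cvgD; first exact: cvg_cst.
  by apply: cvgM; [exact: cvg_cst|exact: cvg_fst].
by apply: cvgM; [exact: cvg_cst|exact: cvg_snd].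
Qed.

Definition tri_det t : R :=
  (t.1.2.1 - t.1.1.1) * (t.2.2 - t.1.1.2) - (t.1.2.2 - t.1.1.2) * (t.2.1 - t.1.1.1).

(** Were the determinant 0, the vertices and hence the whole triangle would lie on a line with
    normal [n]; but moving the center of the disc along [n] within the disc leaves that line. *)
Lemma tri_det_neq0 t z (r : R) : 0 < r -> disc z r `<=` tri t -> tri_det t != 0.
Proof.
move=> r0 zt; apply/negP => /eqP det0.
(* A normal to the first nonzero edge issued from the first vertex, or any nonzero vector if both
   edges vanish. *)
have [n [n0 nv]] : exists n : P, n.1 ^+ 2 + n.2 ^+ 2 != 0 /\
    forall q, verts t q -> n.1 * (q.1 - t.1.1.1) + n.2 * (q.2 - t.1.1.2) = 0.
  have nz (a b : R) : (a != 0) || (b != 0) -> a ^+ 2 + b ^+ 2 != 0.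
    by rewrite paddr_eq0 ?sqr_ge0// !sqrf_eq0 negb_and.
  have [e|] := boolP ((t.1.2.1 - t.1.1.1 != 0) || (t.1.2.2 - t.1.1.2 != 0)).
    exists (- (t.1.2.2 - t.1.1.2), t.1.2.1 - t.1.1.1); split => /=.
      by apply: nz; rewrite oppr_eq0 orbC.
    by move=> q [[->|->]|->]; [ring|ring|rewrite -[RHS]det0 /tri_det; ring].
  rewrite negb_or !negbK => /andP[/eqP e1 /eqP e2].
  have [e|] := boolP ((t.2.1 - t.1.1.1 != 0) || (t.2.2 - t.1.1.2 != 0)).
    exists (- (t.2.2 - t.1.1.2), t.2.1 - t.1.1.1); split => /=.
      by apply: nz; rewrite oppr_eq0 orbC.
    by move=> q [[->|->]|->]; [ring|rewrite e1 e2; ring|ring].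
  rewrite negb_or !negbK => /andP[/eqP e3 /eqP e4].
  exists (1, 0); split => /=; first by apply: nz; rewrite oner_eq0.
  by move=> q [[->|->]|->]; rewrite ?e1 ?e2 ?e3 ?e4; ring.
have line p : tri t p -> n.1 * (p.1 - t.1.1.1) + n.2 * (p.2 - t.1.1.2) = 0.
  pose c := (- (n.1 * t.1.1.1 + n.2 * t.1.1.2), n.1, n.2).
  have E q : n.1 * (q.1 - t.1.1.1) + n.2 * (q.2 - t.1.1.2) = affine_fun c q.
    by rewrite /affine_fun/=; ring.
  move=> tp; rewrite E (affine_fun_eq_hull (c' := (0, 0, 0)) _ tp).
    by rewrite /affine_fun/= !mul0r !addr0.
  by move=> q /nv; rewrite E => ->; rewrite /affine_fun/= !mul0r !addr0.
have n0' : 0 < n.1 ^+ 2 + n.2 ^+ 2 by rewrite lt_neqAle eq_sym n0 addr_ge0 ?sqr_ge0.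
pose e := r / (2 * Num.sqrt (n.1 ^+ 2 + n.2 ^+ 2)).
have e0 : 0 < e by rewrite divr_gt0// mulr_gt0// sqrtr_gt0.
have /zt/line/= : disc z r (z.1 + e * n.1, z.2 + e * n.2).
  rewrite /disc/= edE.
  rewrite (_ : _ - z = (e * n.1, e * n.2)); last by congr (_, _) => /=; ring.
  rewrite enormZ ?(ltW e0)// /enorm /e; set s := Num.sqrt _.
  have s0 : 0 < s by rewrite sqrtr_gt0.
  by rewrite -subr_gt0 (_ : _ - _ = r / 2) ?divr_gt0//; field; rewrite gt_eqF.
have : n.1 * (z.1 - t.1.1.1) + n.2 * (z.2 - t.1.1.2) = 0.
  by apply/line/zt; rewrite /disc/= edxx.
move=> L1 L2; have : e * (n.1 ^+ 2 + n.2 ^+ 2) = 0.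
  transitivity (n.1 * (z.1 + e * n.1 - t.1.1.1) + n.2 * (z.2 + e * n.2 - t.1.1.2)
    - (n.1 * (z.1 - t.1.1.1) + n.2 * (z.2 - t.1.1.2))); first by ring.
  by rewrite L1 L2 subrr.
by apply/eqP; rewrite mulf_neq0 ?gt_eqF.
Qed.

Lemma affine_interpolation t (u : P -> R) : tri_det t != 0 ->
  exists c, forall q, verts t q -> affine_fun c q = u q.
Proof.
move=> det0.
pose b := ((u t.1.2 - u t.1.1) * (t.2.2 - t.1.1.2) - (u t.2 - u t.1.1) * (t.1.2.2 - t.1.1.2)) / tri_det t.
pose c := ((u t.2 - u t.1.1) * (t.1.2.1 - t.1.1.1) - (u t.1.2 - u t.1.1) * (t.2.1 - t.1.1.1)) / tri_det t.
exists (u t.1.1 - b * t.1.1.1 - c * t.1.1.2, b, c).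
have e1 : b * (t.1.2.1 - t.1.1.1) + c * (t.1.2.2 - t.1.1.2) = u t.1.2 - u t.1.1.
  by rewrite /b /c; move: det0; rewrite /tri_det => d0; field.
have e2 : b * (t.2.1 - t.1.1.1) + c * (t.2.2 - t.1.1.2) = u t.2 - u t.1.1.
  by rewrite /b /c; move: det0; rewrite /tri_det => d0; field.
move=> q [[->|->]|->]; rewrite /affine_fun/=.
- by ring.
- by rewrite -[RHS](subrK (u t.1.1)) -e1; ring.
- by rewrite -[RHS](subrK (u t.1.1)) -e2; ring.
Qed.

(* A nondegenerate triangle is cut out by its barycentric coordinates. *)
Lemma tri_closed t : tri_det t != 0 -> closed (tri t).
Proof.
move=> det0.
pose D := tri_det t.
pose cB := ((- t.1.1.1 * (t.2.2 - t.1.1.2) + t.1.1.2 * (t.2.1 - t.1.1.1)) / D,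
  (t.2.2 - t.1.1.2) / D, - (t.2.1 - t.1.1.1) / D).
pose cC := ((- t.1.1.2 * (t.1.2.1 - t.1.1.1) + t.1.1.1 * (t.1.2.2 - t.1.1.2)) / D,
  - (t.1.2.2 - t.1.1.2) / D, (t.1.2.1 - t.1.1.1) / D).
pose cA := (1 - cB.1.1 - cC.1.1, - cB.1.2 - cC.1.2, - cB.2 - cC.2).
have AE p : affine_fun cA p = 1 - affine_fun cB p - affine_fun cC p.
  by rewrite /affine_fun/=; ring.
have HB q : verts t q -> affine_fun cB q = (q == t.1.2)%:R /\ affine_fun cC q = (q == t.2)%:R.
  have ne12 : t.1.1 != t.1.2.
    by apply: contraNneq det0 => e; rewrite /tri_det e !subrr !mul0r subrr.
  have ne13 : t.1.1 != t.2.
    by apply: contraNneq det0 => e; rewrite /tri_det e !subrr !mulr0 subrr.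
  have ne23 : t.1.2 != t.2.
    by apply: contraNneq det0 => e; rewrite /tri_det e mulrC subrr.
  move=> [[->|->]|->]; rewrite ?eqxx ?(negbTE ne12) ?(negbTE ne13) ?(negbTE ne23)
    1?eq_sym ?(negbTE ne23); move: det0; rewrite /affine_fun/= /D /tri_det => d0;
    split; by field.
have -> : tri t = (affine_fun cA @^-1` [set r | r >= 0]) `&`
   ((affine_fun cB @^-1` [set r | r >= 0]) `&` (affine_fun cC @^-1` [set r | r >= 0])).
  apply/seteqP; split => p.
    move=> [m [v [w [vA w0 w1 ->]]]] /=; rewrite !affine_fun_conv//.
    split; [|split]; apply: sumr_ge0 => i _; apply: mulr_ge0 => //.
    - rewrite AE; have [-> ->] := HB _ (vA i).
      have [->|_] := eqVneq (v i) t.1.2; last by case: eqP; rewrite /= ?subr0 ?subrr.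
      rewrite (_ : (t.1.2 == t.2) = false) ?subr0 ?subrr//.
      by apply/negbTE; apply: contraNneq det0 => e; rewrite /tri_det e mulrC subrr.
    - by have [-> _] := HB _ (vA i).
    - by have [_ ->] := HB _ (vA i).
  move=> [/= p1 [p2 p3]].
  exists 3%N, (fun i : 'I_3 => nth t.1.1 [:: t.1.1; t.1.2; t.2] i).
  exists (fun i : 'I_3 => nth 0 [:: affine_fun cA p; affine_fun cB p; affine_fun cC p] i).
  split.
  - by move=> [[|[|[|//]]] ?] /=; [left; left|left; right|right].
  - by move=> [[|[|[|//]]] ?].
  - by rewrite !big_ord_recl big_ord0/= AE; ring.
  - rewrite [LHS]surjective_pairing !big_ord_recl !big_ord0/= AE.
    move: det0; rewrite /affine_fun/= /D /tri_det => d0; congr (_, _); by field.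
have cge : closed [set r : R | r >= 0] by exact: closed_ge.
have cc c : closed (affine_fun c @^-1` [set r | r >= 0]).
  by apply: closed_comp => // x _; exact: affine_fun_continuous.
by do !apply: closedI.
Qed.

Lemma mesh_edge T t p q : 0 < mesh_size T -> T t -> verts t p -> verts t q ->
  ed p q <= mesh_size T.
Proof.
move=> h0 Tt tp tq; rewrite /mesh_size; apply: ub_le_sup; last first.
  by exists t; split => //; exists p, q.
apply: contrapT => nub; move: h0; rewrite /mesh_size sup_out ?ltxx//.
by move=> [_ ub].
Qed.

Lemma tri_vert_close t p q (h : R) : (forall a b, verts t a -> verts t b -> ed a b <= h) ->
  tri t p -> verts t q -> `|q.1 - p.1| <= h /\ `|q.2 - p.2| <= h.
Proof.
move=> th tp tq.
have B (c1 c2 : R) : (forall v, verts t v -> c1 * (v.1 - q.1) + c2 * (v.2 - q.2) <= h) ->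
    c1 * (p.1 - q.1) + c2 * (p.2 - q.2) <= h.
  move=> H; rewrite -subr_le0.
  rewrite (_ : _ - h = (- h - c1 * q.1 - c2 * q.2) + c1 * p.1 + c2 * p.2); last by ring.
  apply: conv_hull_affine_le tp => v /H; lra.
have b1 v : verts t v -> `|v.1 - q.1| <= h /\ `|v.2 - q.2| <= h.
  move=> tv; split; apply: le_trans (th q v tq tv).
    exact: norm1_le_ed.
  exact: norm2_le_ed.
split; rewrite ler_norml; apply/andP; split.
- have H2 : 1 * (p.1 - q.1) + 0 * (p.2 - q.2) <= h; last by lra.
  by apply: B => v /b1[]; rewrite ler_norml => /andP[]; lra.
- have H2 : -1 * (p.1 - q.1) + 0 * (p.2 - q.2) <= h; last by lra.
  by apply: B => v /b1[]; rewrite ler_norml => /andP[]; lra.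
- have H2 : 0 * (p.1 - q.1) + 1 * (p.2 - q.2) <= h; last by lra.
  by apply: B => v /b1[] _; rewrite ler_norml => /andP[]; lra.
- have H2 : 0 * (p.1 - q.1) + -1 * (p.2 - q.2) <= h; last by lra.
  by apply: B => v /b1[] _; rewrite ler_norml => /andP[]; lra.
Qed.

Lemma within_bigcup_continuous (s : seq (P * P * P)) (f : P -> R) :
  (forall t, t \in s -> closed (tri t) /\ {within tri t, continuous f}) ->
  {within \bigcup_(t in [set` s]) tri t, continuous f} /\
  closed (\bigcup_(t in [set` s]) tri t).
Proof.
elim: s => [|t s IH] H.
  rewrite set_nil bigcup_set0; split; last exact: closed0.
  exact: continuous_subspace0.
have [] := IH (fun t' st => H t' (mem_behead (s := t :: s) st)) => fs cs.
have [ct ft] := H t (mem_head _ _).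
rewrite (_ : \bigcup_(t0 in [set` (t :: s)]) tri t0 = tri t `|` \bigcup_(t in [set` s]) tri t).
  by split; [exact: withinU_continuous|exact: closedU].
apply/seteqP; split => x /=.
  move=> [t' /=]; rewrite inE => /predU1P[-> tx|st tx]; first by left.
  by right; exists t'.
case=> [tx|[t' /= st tx]]; first by exists t => //=; rewrite mem_head.
by exists t' => //=; rewrite inE st orbT.
Qed.

(** The affine interpolants on two triangles agree on the intersection, which by conformity is the
    hull of the common vertices. At [x] the interpolant averages the vertex values with weights for
    which the mean of the vertices is [x], so the first-order terms of the expansion at [x] cancel
    and only the quadratic remainder is left. *)
Lemma V0_interpolant (Om : set P) (d h kappa M : R) T (u : P -> R) :
  0 < h -> 0 < kappa -> 0 <= M -> triangulation Om d T -> mesh_size T = h ->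
  quasi_uniform kappa T ->
  (forall p, closure Om p -> exists g1 g2 : R, forall a b : R, `|a| <= h -> `|b| <= h ->
    `|u (p.1 + a, p.2 + b) - u p - a * g1 - b * g2| <= M * (a ^+ 2 + b ^+ 2)) ->
  exists2 w, V0 Om T w & forall x, closure Om x -> `|w x - u x| <= 2 * M * h ^+ 2.
Proof.
move=> h0 k0 M0 TT mh qu taylor; have [Tf Tc _ _ Ti] := TT.
have det0 t : T t -> tri_det t != 0.
  by move=> /qu[z]; apply: tri_det_neq0; rewrite mh mulr_gt0.
have /choice[cf cfP] t : exists c, T t -> forall q, verts t q -> affine_fun c q = u q.
  have [Tt|nT] := pselect (T t); last by exists (0, 0, 0).
  by have [c cP] := affine_interpolation u (det0 _ Tt); exists c.
have /choice[tf tfP] x : exists t, closure Om x -> inner Om T t /\ tri t x.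
  have [cx|nx] := pselect (closure Om x); last by exists ((x, x), x).
  by have := cx; rewrite Ti => -[t it tx]; exists t.
pose w x := if `[< closure Om x >] then affine_fun (cf (tf x)) x else 0.
have sub t : inner Om T t -> tri t `<=` closure Om by case.
have wE t : inner Om T t -> forall x, tri t x -> w x = affine_fun (cf t) x.
  move=> it x tx; have cx : closure Om x by exact: sub tx.
  rewrite /w asboolT//; have [it' tx'] := tfP _ cx.
  have xx : (tri (tf x) `&` tri t) x by split.
  have [Tt _] := it; have [Tt' _] := it'.
  rewrite Tc// in xx; apply: affine_fun_eq_hull xx => q [q1 q2].
  by rewrite (cfP _ Tt')// (cfP _ Tt).
exists w.
  split.
  - have [s sE] : exists s : seq (P * P * P), inner Om T = [set` s].
      apply/finite_seqP; apply: sub_finite_set Tf; by move=> t [].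
    rewrite Ti sE; apply: (within_bigcup_continuous _).1 => t ts.
    have it : inner Om T t by rewrite sE.
    split; first by apply: tri_closed; apply: det0; case: it.
    apply: (@subspace_eq_continuous _ _ _ (affine_fun (cf t))).
      by move=> x /set_mem tx; exact/esym/(wE t it x tx).
    by apply: continuous_subspaceT; exact: affine_fun_continuous.
  - move=> t it; exists (cf t).1.1, (cf t).1.2, (cf t).2 => x tx.
    exact: wE.
  - by move=> x nx; rewrite /w asboolF.
move=> x cx; rewrite /w asboolT//; have [[Tt _] tx] := tfP _ cx.
move: (tf x) Tt tx => t Tt tx.
have [g1 [g2 G]] := taylor _ cx.
have close v : verts t v -> `|v.1 - x.1| <= h /\ `|v.2 - x.2| <= h.
  move=> tv; apply: tri_vert_close tx tv => a b ta tb.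
  by rewrite -mh; apply: (@mesh_edge T t) => //; rewrite mh.
have [m [v [c [vA c0 c1 xE]]]] := tx.
have x1E := congr1 fst xE; have x2E := congr1 snd xE.
rewrite /= in x1E x2E.
rewrite {1}xE affine_fun_conv//.
have -> : \sum_i c i * affine_fun (cf t) (v i) - u x =
    \sum_i c i * (u (v i) - u x - ((v i).1 - x.1) * g1 - ((v i).2 - x.2) * g2).
  have E i : c i * (u (v i) - u x - ((v i).1 - x.1) * g1 - ((v i).2 - x.2) * g2) =
     c i * u (v i) - c i * (u x - x.1 * g1 - x.2 * g2) - c i * (v i).1 * g1 - c i * (v i).2 * g2.
    by ring.
  under [RHS]eq_bigr do rewrite E.
  rewrite !sumrB -!mulr_suml c1 -x1E -x2E.
  under eq_bigr do rewrite (cfP _ Tt)//.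
  by ring.
apply: le_trans (ler_norm_sum _ _ _) _.
rewrite -[leRHS]mul1r -[X in _ <= X * _]c1 mulr_suml; apply: ler_sum => i _.
rewrite normrM ger0_norm// ler_wpM2l//.
have [h1 h2] := close _ (vA i).
have := G _ _ h1 h2; rewrite !subrKC -surjective_pairing => /le_trans; apply.
rewrite [leRHS](_ : _ = M * (h ^+ 2 + h ^+ 2)); last by ring.
rewrite ler_wpM2l// lerD// -real_normK ?num_real// lerXn2r ?nnegrE// ltW//.
Qed.

End interpolation.

(** * Moments of the kernel *)

Section radial_kernel.
Context {R : realType}.
Local Notation P := (R * R)%type.
Local Notation mu := (@lebesgue_measure R).
Local Notation RR := (measurableTypeR R).
Local Notation PP := (plane R).
Variables (d : R) (gam : P -> P -> R) (gt g : R -> R).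
Hypothesis d0 : 0 < d.
Hypothesis kc : kernel_conditions d gam gt g.

(** Total version of the radial profile, for which the kernel is radial at all pairs of points: the
    value [gt 0] is kept because (K2) also covers the diagonal, and (K1) imposes 0 beyond the
    horizon. *)
Definition profile (s : R) : R := if s == 0 then gt 0 else (gt \_ `]0, d[) s.

Definition radial (z : P) : R := profile (enorm z).

Lemma gam_radial x y : gam x y = radial (y - x).
Proof.
rewrite /radial /profile -edE patchE mem_setE in_itv/=.
have [xy|nxy] := pselect (disc x d y).
  rewrite (kernel_K2_radial kc xy); case: eqVneq => [->//|e0].
  by rewrite lt_neqAle eq_sym e0 ed_ge0/= xy.
rewrite (kernel_K1 kc nxy); have dxy : d <= ed x y by rewrite leNgt; apply/negP.
rewrite (gt_eqF (lt_le_trans d0 dxy)).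
by rewrite [ed x y < d]ltNge dxy andbF.
Qed.

Lemma radial_ge0 z : 0 <= radial z.
Proof. by have := kernel_ge0 kc 0 z; rewrite gam_radial subr0. Qed.

Lemma radialN z : radial (- z) = radial z.
Proof. by rewrite /radial /enorm/= !sqrrN. Qed.

Lemma radial_supp z : radial z != 0 -> enorm z < d.
Proof.
move=> rz; rewrite ltNge; apply/negP => dz; move: rz; rewrite /radial /profile.
rewrite (gt_eqF (lt_le_trans d0 dz)).
by rewrite patchE mem_setE in_itv/= [_ < d]ltNge dz andbF eqxx.
Qed.

Lemma measurable_gt : measurable_fun (`]0, d[%classic : set RR) (gt : RR -> R).
Proof. by apply/measurable_EFinP; have /integrableP[] := kernel_K2_L1 kc. Qed.

Lemma measurable_profile : measurable_fun setT (profile : RR -> R).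
Proof.
apply: measurable_fun_ifT => //.
  by apply: (measurable_fun_eqr (g := cst 0)).
by apply/(measurable_restrictT _ _).1 => //; exact: measurable_gt.
Qed.

Lemma measurable_radial : measurable_fun setT (radial : PP -> R).
Proof. exact: (measurableT_comp measurable_profile measurable_enorm). Qed.

Lemma gt_ge0 s : 0 < s < d -> 0 <= gt s.
Proof. by move=> sd; rewrite ltW// (kernel_K2_gt0 kc). Qed.

(** Up to the factor [2 * pi], the second moment of the kernel on the disc of radius [t] in polar
    coordinates. It is extended-real valued because its finiteness has to be derived from (K2). *)
Definition cubic_moment (t : R) : \bar R :=
  (\int[mu]_(s in `]0%R, t[) (s ^+ 3 * gt s)%:E)%E.

Lemma measurable_cubic (t : R) : t <= d ->
  measurable_fun (`]0, t[%classic : set RR) (fun s : RR => (s ^+ 3 * gt s)%:E).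
Proof.
move=> td; apply/measurable_EFinP; apply: measurable_funM.
  by apply: measurable_funX; apply: measurable_funTS; exact: measurable_id.
apply: measurable_funS measurable_gt => // s /=; rewrite !in_itv/= => /andP[-> st].
exact: lt_le_trans td.
Qed.

Lemma radial_moment (t : R) : 0 < t <= d ->
  (\int[leb2]_z (if enorm z < t then radial z * enorm z ^+ 2 else 0)%:E =
   (2 * pi)%:E * cubic_moment t)%E.
Proof.
move=> /andP[t0 td].
pose F (s : RR) : \bar R := (if (s : R) < t then profile s * s ^+ 2 else 0)%:E.
have F' s : F s = (profile s * s ^+ 2 * \1_(`]-oo, t[%classic : set R) s)%:E.
  by rewrite /F indicE mem_setE in_itv/=; case: ifP; rewrite ?mulr1 ?mulr0.
have pro0 (s : R) : 0 <= profile s * s ^+ 2.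
  rewrite mulr_ge0 ?sqr_ge0// /profile; case: eqP => [_|_].
    by have := radial_ge0 0; rewrite /radial /enorm/= !expr0n/= addr0 sqrtr0 /profile eqxx.
  by rewrite patchE; case: ifPn => //; rewrite inE/= in_itv/=; exact: gt_ge0.
have mF : measurable_fun setT F.
  apply/measurable_EFinP; apply: measurable_fun_ifT => //.
    by apply: measurable_fun_ltr.
  by apply: measurable_funM => //; exact: measurable_profile.
have F0 s : (0 <= F s)%E by rewrite /F lee_fin; case: ifP.
rewrite (ge0_integral_polar mF F0); congr (_ * _)%E.
rewrite /cubic_moment integral_mkcond [RHS]integral_mkcond.
apply: eq_integral => s _; rewrite !patchE !mem_setE !in_itv/= andbT /F.
have [s0|s0] := ltP 0 s => //=.
case: ifPn => st; last by rewrite mule0.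
rewrite -EFinM /profile gt_eqF// patchE mem_setE in_itv/= s0 (lt_le_trans st td)/=.
by congr EFin; ring.
Qed.

End radial_kernel.

(** * Second moments and odd moments of the radial kernel *)

Section radial_moments.
Context {R : realType}.
Local Notation P := (R * R)%type.
Local Notation mu := (@lebesgue_measure R).
Local Notation RR := (measurableTypeR R).
Local Notation PP := (plane R).
Variables (d : R) (gam : P -> P -> R) (gt g : R -> R).
Hypothesis d0 : 0 < d.
Hypothesis kc : kernel_conditions d gam gt g.
Local Notation radial := (radial d gt).

(** The powers of [d] cancel: [d] from the substitution [s = d * r], [d ^+ 3] from the weight and
    [d ^- 4] from (K3). This makes the moments independent of the horizon. *)
Lemma cubic_moment_scale (t : R) : 0 < t <= 1 ->
  cubic_moment gt (t * d) = (\int[mu]_(r in `]0%R, t[) (r ^+ 3 * g r)%:E)%E.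
Proof.
move=> /andP[t0 t1].
have td : t * d <= d by rewrite ger_pMl.
pose F := (fun s : RR => (s ^+ 3 * gt s)%:E) \_ `]0, (t * d)[.
have mF : measurable_fun setT F.
  by apply/(measurable_restrictT _ _).1 => //; exact: (measurable_cubic kc).
have F0 s : (0 <= F s)%E.
  rewrite /F patchE; case: ifPn => //; rewrite inE/= in_itv/= => /andP[s0 st].
  rewrite lee_fin mulr_ge0 ?exprn_ge0 ?(ltW s0)//; apply: (gt_ge0 kc).
  by rewrite s0 (lt_le_trans st td).
rewrite /cubic_moment integral_mkcond -/F [RHS]integral_mkcond.
have := ge0_integral_affine 0 d0 mF F0.
move=> /(congr1 (fun x => d%:E * x)%E); rewrite [RHS]muleA -EFinM mulfV ?gt_eqF// mul1e => <-.
have mphi : measurable_fun setT (fun x : RR => (d * x + 0 : RR)).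
  by apply: measurable_funD => //; apply: measurable_funM.
have mFphi := measurableT_comp mF mphi.
rewrite -ge0_integralZl ?lee_fin ?(ltW d0)//.
apply: eq_integral => s _; rewrite /F !patchE !mem_setE !in_itv/= addr0.
rewrite pmulr_rgt0// (mulrC t) ltr_pM2l//.
case: ifPn => [/andP[s0 st]|_]; last by rewrite mule0.
have sd : 0 < d * s < d by rewrite mulr_gt0//= gtr_pMr// (lt_le_trans st t1).
rewrite (kernel_K3 kc sd) -EFinM; congr EFin.
rewrite (_ : d * s / d = s); last by field; rewrite gt_eqF.
by field; rewrite gt_eqF.
Qed.

Lemma cubic_moment_d : cubic_moment gt d = (pi^-1)%:E.
Proof.
have := kernel_K2_moment kc; rewrite /Rintegral -/(cubic_moment gt d).
have p0 := @pi_gt0 R.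
(* An infinite moment would give the real-valued integral the default value 0, and the product in
   (K2) could not be 2. *)
case: (cubic_moment gt d) => [r|/=|/=]; last 2 first.
- by rewrite mulr0 => e; exfalso; lra.
- by rewrite mulr0 => e; exfalso; lra.
move=> /=; move: (pi : R) p0 => p p0 e; congr EFin.
have -> : r = 2 * p * r / (2 * p) by field; rewrite gt_eqF.
by rewrite e; field; rewrite gt_eqF.
Qed.

Lemma cubic_moment_Phi (t : R) : 0 < t <= 1 ->
  cubic_moment gt (t * d) = (Phi g t / pi)%:E.
Proof.
move=> t01; have p0 := @pi_gt0 R; have /andP[t0 t1] := t01.
have td : t * d <= d by rewrite ger_pMl.
rewrite /Phi mulrAC mulfV ?gt_eqF// mul1r /Rintegral -cubic_moment_scale// fineK//.
rewrite ge0_fin_numE; last first.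
  apply: integral_ge0 => s; rewrite /= in_itv/= => /andP[s0 st].
  rewrite lee_fin mulr_ge0 ?exprn_ge0 ?(ltW s0)//; apply: (gt_ge0 kc).
  by rewrite s0 (lt_le_trans st td).
apply: (@le_lt_trans _ _ (cubic_moment gt d)); last by rewrite cubic_moment_d ltry.
apply: ge0_subset_integral => //.
- exact: (measurable_cubic kc).
- move=> s; rewrite /= in_itv/= => /andP[s0 sd].
  by rewrite lee_fin mulr_ge0 ?exprn_ge0 ?(ltW s0)//; apply: (gt_ge0 kc); rewrite s0.
- by move=> s /=; rewrite !in_itv/= => /andP[-> st]; exact: lt_le_trans st td.
Qed.

Lemma Phi1 : Phi g 1 = 1.
Proof.
have := @cubic_moment_Phi 1; rewrite mul1r ltr01 lexx => /(_ isT).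
have p0 := @pi_gt0 R.
rewrite cubic_moment_d => -[]; move: (Phi g 1) (pi : R) p0 => F p p0 e.
have -> : F = F / p * p by rewrite divfK// gt_eqF.
by rewrite -e mulVf// gt_eqF.
Qed.

(** The integrand is positive on an interval of positive length, so its integral cannot be 0. This
    makes the Poincare constant positive. *)
Lemma Phi_gt0 (t : R) : 0 < t <= 1 -> 0 < Phi g t.
Proof.
move=> t01; have p0 := @pi_gt0 R; have /andP[t0 t1] := t01.
have td : t * d <= d by rewrite ger_pMl.
have td0 : 0 < t * d by rewrite mulr_gt0.
have pos s : 0 < s < t * d -> 0 < s ^+ 3 * gt s.
  move=> /andP[s0 st]; rewrite mulr_gt0 ?exprn_gt0//; apply: (kernel_K2_gt0 kc).
  by rewrite s0 (lt_le_trans st td).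
have E0 : (0 <= cubic_moment gt (t * d))%E.
  apply: integral_ge0 => s; rewrite /= in_itv/= => /pos; rewrite lee_fin; exact: ltW.
have Phi0 : 0 <= Phi g t.
  by move: E0; rewrite cubic_moment_Phi// lee_fin pmulr_lge0// invr_gt0.
rewrite lt_neqAle Phi0 andbT; apply/eqP => e.
have : cubic_moment gt (t * d) = 0%E by rewrite cubic_moment_Phi// -e mul0r.
have mf := measurable_cubic kc td.
rewrite /cubic_moment => I0.
have /(ae_eq_integral_abs mu (measurable_itv _) mf).1 : (\int[mu]_(s in `]0%R, (t * d)%R[) `|(s ^+ 3 * gt s)%:E| = 0)%E.
  rewrite -[RHS]I0; apply: eq_integral => s; rewrite inE/= in_itv/= => /pos h.
  by rewrite ger0_norm// ltW.
move=> [N [mN N0 sub]].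
have : (mu (`]0%R, (t * d)%R[%classic : set RR) <= mu N)%E.
  apply: le_measure; rewrite ?inE//.
  move=> s sI; apply: sub => /(_ sI) /=; move: sI; rewrite /= in_itv/= => /pos h [] h0.
  by move: h; rewrite h0 ltxx.
rewrite N0 lebesgue_measure_itv/= lte_fin td0 sube0 lee_fin => h.
by move: td0; rewrite ltNge h.
Qed.

(* The kernel being even in each coordinate, this kills its odd moments. *)
Lemma leb2_odd1 (f : PP -> R) : measurable_fun setT f ->
  (forall z, f (- z.1, z.2) = - f z) -> \int[@leb2 R]_z f z = 0.
Proof.
move=> mf fN; rewrite /Rintegral integralE.
have mfE : measurable_fun setT (EFin \o f) by exact/measurable_EFinP.
have e : (\int[leb2]_z (EFin \o f)^\- z = \int[leb2]_z (EFin \o f)^\+ z)%E.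
  rewrite -(ge0_leb2_opp1 (measurable_funepos mfE))//.
  by apply: eq_integral => z _; rewrite funeposE funenegE/= fN.
(* If the common value of the two parts is infinite, the real-valued integral is 0 by convention. *)
rewrite [X in (_ - X)%E]e; set I := (\int[_]_z _)%E; case: I => [r||] //=.
by rewrite subrr.
Qed.

Lemma leb2_odd2 (f : PP -> R) : measurable_fun setT f ->
  (forall z, f (z.1, - z.2) = - f z) -> \int[@leb2 R]_z f z = 0.
Proof.
move=> mf fN; rewrite /Rintegral integralE.
have mfE : measurable_fun setT (EFin \o f) by exact/measurable_EFinP.
have e : (\int[leb2]_z (EFin \o f)^\- z = \int[leb2]_z (EFin \o f)^\+ z)%E.
  rewrite -(ge0_leb2_opp2 (measurable_funepos mfE))//.
  by apply: eq_integral => z _; rewrite funeposE funenegE/= fN.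
rewrite [X in (_ - X)%E]e; set I := (\int[_]_z _)%E; case: I => [r||] //=.
by rewrite subrr.
Qed.

Lemma radial_disc_moment (t : R) : 0 < t <= 1 ->
  (\int[leb2]_z (if (enorm z < t * d)%R then radial z * enorm z ^+ 2 else 0)%:E =
   (2 * Phi g t)%:E)%E.
Proof.
move=> t01; have /andP[t0 t1] := t01; have p0 := @pi_gt0 R.
rewrite (radial_moment d0 kc); last by rewrite mulr_gt0// ger_pMl.
rewrite cubic_moment_Phi// -EFinM; congr EFin.
by move: (pi : R) p0 => p p0; field; rewrite gt_eqF.
Qed.

(** The two coordinates have equal moments by the swap of the axes, and these add up to the moment
    of the Euclidean norm. *)
Lemma radial_coord_moment (t : R) (c : P -> R) : 0 < t <= 1 -> c = fst \/ c = snd ->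
  (\int[leb2]_z (if (enorm z < t * d)%R then radial z * c z ^+ 2 else 0)%:E =
   (Phi g t)%:E)%E.
Proof.
move=> t01 hc.
have rad0 := radial_ge0 d0 kc; have mr := measurable_radial kc.
pose f (c : P -> R) (z : PP) := (if (enorm z < t * d)%R then radial z * c z ^+ 2 else 0)%:E.
have f0 c' z : (0 <= f c' z)%E by rewrite /f lee_fin; case: ifP => // _; rewrite mulr_ge0// sqr_ge0.
have mf c' : measurable_fun setT (c' : PP -> R) -> measurable_fun setT (f c').
  move=> mc; apply/measurable_EFinP; apply: measurable_fun_ifT => //.
    by apply: measurable_fun_ltr => //; exact: measurable_enorm.
  by apply: measurable_funM => //; exact: measurable_funX.
have m1 := mf _ measurable_fst; have m2 := mf _ measurable_snd.
have sw : (\int[leb2]_z f snd z = \int[leb2]_z f fst z)%E.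
  rewrite -(ge0_leb2_swap m1)//; apply: eq_integral => z _.
  by rewrite /f /radial /enorm/= addrC.
have : (\int[leb2]_z f fst z + \int[leb2]_z f snd z = (2 * Phi g t)%:E)%E.
  rewrite -ge0_integralD// -radial_disc_moment//; apply: eq_integral => z _.
  by rewrite /f; case: ifP => _; rewrite -EFinD ?addr0// sqr_enorm mulrDr.
rewrite sw => H; have {H}E : (\int[leb2]_z f fst z = (Phi g t)%:E)%E.
  move: H; case: (\int[_]_z _)%E => [r||] //= [] e; congr EFin; lra.
by case: hc => ->; rewrite -/(f _) ?sw.
Qed.

End radial_moments.

(** * Truncation error *)

Section truncated_kernel.
Context {R : realType}.
Local Notation P := (R * R)%type.
Local Notation mu := (@lebesgue_measure R).
Local Notation RR := (measurableTypeR R).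
Local Notation PP := (plane R).
Variables (Om : set P) (d : R) (gam : P -> P -> R) (gt g : R -> R).
Variable (Q : P -> @polygon R).
Hypothesis hOm : open_polygon Om.
Hypothesis d0 : 0 < d.
Hypothesis kc : kernel_conditions d gam gt g.
Hypothesis mQ : measurable ([set z | Oh Om d z.1 /\ poly_set d z.1 (Q z.1) z.2]
                : set (PP * PP)).
Local Notation radial := (radial d gt).
Local Notation Px x := (poly_set d x (Q x)).

Lemma gamma_nE x y : gamma_n d gam Q x y =
  2^-1 * radial (y - x) * (\1_(Px x) y + \1_(Px y) x).
Proof.
rewrite /gamma_n (gam_radial d0 kc).
have [->|r0] := eqVneq (radial (y - x)) 0; first by rewrite !mulr0 !mul0r.
congr (_ * (_ + _)); have := radial_supp d0 r0; rewrite -edE => xy.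
rewrite !indicE; congr (nat_of_bool _)%:R; apply/idP/idP; rewrite !inE/=; first by case.
by move=> yx; split.
Qed.

Lemma radial_sub_sym x y : radial (y - x) = radial (x - y).
Proof. by rewrite -opprB radialN. Qed.

Lemma gamma_n_sym x y : gamma_n d gam Q x y = gamma_n d gam Q y x.
Proof. by rewrite !gamma_nE radial_sub_sym [X in _ * X]addrC. Qed.

Let ind01 (A : set P) x : 0 <= (\1_A x : R) <= 1.
Proof. by rewrite indicE; case: (_ \in _); rewrite /= ?ler01 ?lexx. Qed.

Lemma gamma_n_ge0 x y : 0 <= gamma_n d gam Q x y.
Proof.
rewrite gamma_nE; apply: mulr_ge0.
  by rewrite mulr_ge0 ?invr_ge0 ?(radial_ge0 d0 kc).
by rewrite addr_ge0.
Qed.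

Lemma gamma_n_le x y : gamma_n d gam Q x y <= radial (y - x).
Proof.
rewrite gamma_nE -mulrA mulrCA ler_piMr ?(radial_ge0 d0 kc)//.
by have := ind01 (Px x) y; have := ind01 (Px y) x; lra.
Qed.

Lemma gamma_n_full x y : Px x y -> Px y x -> gamma_n d gam Q x y = radial (y - x).
Proof.
by move=> xy yx; rewrite gamma_nE !indicE !mem_set//=; field.
Qed.

(* Cutting the kernel off outside Oh Om d lets all the integrals range over the
   whole plane. *)
Definition kn x y : R := gamma_n d gam Q x y * \1_(Oh Om d) x * \1_(Oh Om d) y.

Lemma kn_sym x y : kn x y = kn y x.
Proof. by rewrite /kn gamma_n_sym mulrAC. Qed.

Lemma kn_ge0 x y : 0 <= kn x y.
Proof. by apply: mulr_ge0 => //; apply: mulr_ge0 => //; exact: gamma_n_ge0. Qed.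

Lemma kn_in x y : Oh Om d x -> Oh Om d y -> kn x y = gamma_n d gam Q x y.
Proof. by move=> xO yO; rewrite /kn !indicE !mem_set// !mulr1. Qed.

Lemma gamma_n_supp x y : gamma_n d gam Q x y != 0 -> ed x y < d.
Proof.
rewrite gamma_nE edE => h; apply: (@radial_supp _ _ gt d0).
by apply: contraNneq h => ->; rewrite mulr0 mul0r.
Qed.

(** By [disc_sub_Oh], the cutoff is invisible from the points of [Om]. *)
Lemma kn_Om x y : Om x -> kn x y = gamma_n d gam Q x y.
Proof.
move=> xO; have [e|/gamma_n_supp xy] := eqVneq (gamma_n d gam Q x y) 0.
  by rewrite /kn e !mul0r.
apply: kn_in; first by left.
by apply: (disc_sub_Oh hOm (x := x)) => //; exact: subset_closure.
Qed.

Lemma measurable_diff : measurable_fun setT (fun z : PP * PP => z.2 - z.1 : PP).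
Proof.
apply: (measurable_fun_pair (f := fun z : PP * PP => z.2.1 - z.1.1)
    (g := fun z : PP * PP => z.2.2 - z.1.2)).
  by apply: measurable_funB; apply: (measurableT_comp measurable_fst).
by apply: measurable_funB; apply: (measurableT_comp measurable_snd).
Qed.

Lemma measurable_kn : measurable_fun setT (fun z : PP * PP => kn z.1 z.2).
Proof.
pose S : set (PP * PP) := [set z | Oh Om d z.1 /\ poly_set d z.1 (Q z.1) z.2].
have mS0 : measurable S by exact: mQ.
have mO : measurable (Oh Om d : set PP) by exact: measurable_Oh.
have mS : measurable_fun setT (\1_S : PP * PP -> R) by exact: measurable_indic.
have msw : measurable_fun setT (fun z : PP * PP => (z.2, z.1)).
  exact: (measurable_fun_pair measurable_snd measurable_fst).
have mS' := measurableT_comp mS msw.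
have mI : measurable_fun setT (\1_(Oh Om d) : PP -> R) by exact: measurable_indic.
have mr : measurable_fun setT (fun z : PP * PP => radial (z.2 - z.1)).
  exact: (measurableT_comp (measurable_radial kc) measurable_diff).
(* Joint measurability is granted only for the polygons of the points of [Oh Om d], that is for [S].
   The cutoff is redistributed so that only [S] and its transpose appear. *)
rewrite (_ : (fun _ => _) = (fun z : PP * PP => 2^-1 * radial (z.2 - z.1) *
   (\1_S z * \1_(Oh Om d) z.2 + \1_S (z.2, z.1) * \1_(Oh Om d) z.1))).
  apply: measurable_funM; first exact: measurable_funM.
  apply: measurable_funD; apply: measurable_funM => //.
    exact: (measurableT_comp mI).
  exact: (measurableT_comp mI).
apply/funext => -[x y]; rewrite /kn gamma_nE/=.
have E (a b : P) : \1_S (a, b) = \1_(Oh Om d) a * \1_(Px a) b :> R.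
  rewrite !indicE -natrM mulnb; congr (nat_of_bool _)%:R.
  by apply/idP/andP; rewrite !inE.
by rewrite !E; ring.
Qed.

(** The disc around a point of [Om] lies in [Oh Om d], so the bound on [Gker], which integrates over
    that set only, controls the full mass of the radial kernel. *)
Lemma radial_int (G : R) x : Om x -> (Gker Om d gam <= G%:E)%E ->
  (\int[leb2]_z (radial z)%:E <= G%:E)%E.
Proof.
move=> xO; apply: le_trans.
have mrE : measurable_fun setT (fun z : PP => (radial z)%:E).
  by apply/measurable_EFinP; exact: (measurable_radial kc).
rewrite -(ge0_leb2_shift (- x) mrE); last by move=> z; rewrite lee_fin (radial_ge0 d0 kc).
apply: (@le_trans _ _ (\int[leb2]_(y in disc x d `&` Oh Om d) (gam x y)%:E)%E); last first.
  by apply: ereal_sup_ubound; exists x => //; left.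
rewrite [X in (_ <= X)%E]integral_mkcond le_eqVlt; apply/orP; left; apply/eqP.
apply: eq_integral => y _; rewrite patchE; case: ifPn.
  by rewrite -(gam_radial d0 kc).
move=> /negP; rewrite inE => ny; congr EFin.
apply: contra_notP ny => /eqP r0; have := radial_supp d0 r0; rewrite -edE => xy.
by split => //; apply: (disc_sub_Oh hOm (x := x)) => //; exact: subset_closure.
Qed.

Lemma kn_int (G : R) x : 0 <= G -> (Gker Om d gam <= G%:E)%E ->
  (\int[leb2]_y (kn x y)%:E <= G%:E)%E.
Proof.
move=> G0 hG.
have [xO|nxO] := pselect (Oh Om d x); last first.
  rewrite integral0_eq ?lee_fin// => y _.
  by rewrite /kn [\1_(_) x]indicE memNset// mulr0 mul0r.
apply: le_trans hG.
apply: (@le_trans _ _ (\int[leb2]_(y in disc x d `&` Oh Om d) (gam x y)%:E)%E); last first.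
  by apply: ereal_sup_ubound; exists x.
rewrite [X in (_ <= X)%E]integral_mkcond; apply: ge0_le_integral => //.
- by move=> y _; rewrite lee_fin kn_ge0.
- exact: (measurableT_comp ((measurable_EFinP _ _).2 measurable_kn) (pair1_measurable x)).
- apply/(measurable_restrictT _ _).1.
    apply: measurableI; last exact: measurable_Oh.
    by apply: open_measurable_plane; exact: disc_open.
  apply: measurable_funTS; apply/measurable_EFinP.
  rewrite (_ : gam x = (fun z : PP * PP => radial (z.2 - z.1)) \o pair x); last first.
    by apply/funext => y; rewrite (gam_radial d0 kc).
  apply: measurableT_comp; last exact: pair1_measurable.
  exact: (measurableT_comp (measurable_radial kc) measurable_diff).
- move=> y _; rewrite patchE; case: ifPn => [_|/negP].
    rewrite lee_fin (gam_radial d0 kc); apply: le_trans (gamma_n_le x y).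
    have /andP[? ?] := ind01 (Oh Om d) x; have /andP[? ?] := ind01 (Oh Om d) y.
    by rewrite /kn -mulrA ler_piMr ?gamma_n_ge0// mulr_ile1.
  rewrite inE => ny; rewrite lee_fin le_eqVlt; apply/orP; left.
  apply/negPn; apply: contra_notN ny => kxy; split.
    apply: gamma_n_supp; apply: contra kxy => /eqP e; by rewrite /kn e !mul0r.
  apply: contrapT => nyO; move/eqP: kxy; apply.
  by rewrite /kn [\1_(_) y]indicE memNset// mulr0.
Qed.

End truncated_kernel.

(** * Pointwise error of the truncated operator *)

Section truncation_error.
Context {R : realType}.
Local Notation P := (R * R)%type.
Local Notation PP := (plane R).

Lemma Rintegral_leb2_shift (p : P) (f : PP -> R) : measurable_fun setT f ->
  \int[@leb2 R]_z f (z + p) = \int[@leb2 R]_z f z.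
Proof.
move=> mf; rewrite /Rintegral; congr fine.
have mfE : measurable_fun setT (EFin \o f) by exact/measurable_EFinP.
rewrite integralE [RHS]integralE; congr (_ - _)%E.
  rewrite -(ge0_leb2_shift p (measurable_funepos mfE))//.
  by apply: eq_integral => z _; rewrite !funeposE.
rewrite -(ge0_leb2_shift p (measurable_funeneg mfE))//.
by apply: eq_integral => z _; rewrite !funenegE.
Qed.

Lemma integrable_ge0_eq d (T : measurableType d) (m : {measure set T -> \bar R})
    (f : T -> R) (c : R) : measurable_fun setT f -> (forall x, 0 <= f x) ->
  (\int[m]_x (f x)%:E = c%:E)%E ->
  m.-integrable setT (EFin \o f) /\ \int[m]_x f x = c.
Proof.
move=> mf f0 fc; split; last by rewrite /Rintegral fc.
apply/integrableP; split; first exact/measurable_EFinP.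
rewrite (_ : (\int[m]_x _ = c%:E)%E) ?ltry// -fc.
by apply: eq_integral => x _; rewrite /= ger0_norm.
Qed.

Lemma integrable_le_integrable d (T : measurableType d) (m : {measure set T -> \bar R})
    (f b : T -> R) : measurable_fun setT f -> (forall x, `|f x| <= b x) ->
  m.-integrable setT (EFin \o b) -> m.-integrable setT (EFin \o f).
Proof.
move=> mf fb bi; apply: le_integrable bi => //; first exact/measurable_EFinP.
move=> x _ /=; rewrite lee_fin (le_trans (fb x))//; exact: ler_norm.
Qed.

Variables (Om : set P) (d : R) (gam : P -> P -> R) (gt g : R -> R).
Variable (Q : P -> @polygon R).
Hypothesis hOm : open_polygon Om.
Hypothesis d0 : 0 < d.
Hypothesis d1 : d <= 1.
Hypothesis kc : kernel_conditions d gam gt g.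
Hypothesis mQ : measurable ([set z | Oh Om d z.1 /\ poly_set d z.1 (Q z.1) z.2]
                : set (PP * PP)).
Local Notation radial := (radial d gt).
Local Notation Px x := (poly_set d x (Q x)).

(** The integrand [w * kap] is compared with the Taylor polynomial against the full radial kernel,
    whose odd terms integrate to 0 and whose even terms give half the sum of the second derivatives.
    The difference [Err] is the fourth-order remainder against the radial kernel plus the increment
    [w] against the missing part of the kernel, which lives where [|z| >= tau * d]. *)
Theorem truncation_error (G M tau u11 u22 : R) (u : P -> R) (D : set P) (x : P)
    (c : nat -> R) :
  Om x -> 0 <= M -> (Gker Om d gam <= G%:E)%E ->
  measurable_fun setT (u \_ D : PP -> R) -> disc x d `<=` D ->
  2^-1 <= tau <= 1 -> (forall y, ed x y < tau * d -> Px x y /\ Px y x) ->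
  (forall a b : R, enorm (a, b) < d ->
    `|u (x.1 + a, x.2 + b) - u x| <= M * (`|a| + `|b|) /\
    `|u (x.1 + a, x.2 + b) - u x - (a ^+ 2 / 2 * u11 + b ^+ 2 / 2 * u22)
       - a * (c 0%N + c 1%N * b + c 2%N * b ^+ 2 + c 3%N * a ^+ 2)
       - b * (c 4%N + c 5%N * b ^+ 2 + c 6%N * a ^+ 2)| <=
       5 * M * (a ^+ 2 + b ^+ 2) ^+ 2) ->
  `|Lop d gam Q u x - (u11 + u22)| <= 20 * M * d ^+ 2 + 16 * M / d * (1 - Phi g tau).
Proof.
move=> xO M0 hG muD xD /andP[tau2 tau1] full taylor.
have tau0 : 0 < tau by lra.
have r0 := radial_ge0 d0 kc; have mr := measurable_radial kc.
(* Only the restriction of [u] to [D] is known to be measurable; it agrees with [u] wherever the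
   kernel is nonzero. *)
pose v := u \_ D.
have xDx : D x by apply: xD; rewrite /disc/= edxx.
have vx : v x = u x by rewrite /v patchE mem_set.
pose w (z : PP) : R := v (z + x) - v x.
pose kap (z : PP) : R := gamma_n d gam Q x (z + x).
have knE y : gamma_n d gam Q x y = kn Om d gam Q x y by rewrite (kn_Om _ hOm d0 kc).
have mkx : measurable_fun setT (fun y : PP => gamma_n d gam Q x y).
  rewrite (_ : (fun _ => _) = (fun z : PP * PP => kn Om d gam Q z.1 z.2) \o pair x).
    exact: (measurableT_comp (measurable_kn hOm d0 kc mQ) (pair1_measurable x)).
  by apply/funext => y; rewrite knE.
have msh : measurable_fun setT (fun z : PP => z + x : PP).
  apply: (measurable_fun_pair (f := fun z : PP => z.1 + x.1) (g := fun z : PP => z.2 + x.2)).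
    by apply: measurable_funD => //; exact: measurable_fst.
  by apply: measurable_funD => //; exact: measurable_snd.
have mw : measurable_fun setT w.
  by apply: measurable_funB => //; exact: (measurableT_comp muD msh).
have mkap : measurable_fun setT kap by exact: (measurableT_comp mkx msh).
have LopE : Lop d gam Q u x = 2 * \int[@leb2 R]_z (w z * kap z).
  rewrite /Lop; congr (_ * _).
  rewrite (Rintegral_leb2_shift x (f := fun y : PP => (v y - v x) * gamma_n d gam Q x y)); last first.
    by apply: measurable_funM => //; exact: measurable_funB.
  apply: eq_Rintegral => y _.
  have [->|/(gamma_n_supp d0 kc) xy] := eqVneq (gamma_n d gam Q x y) 0; first by rewrite !mulr0.
  by rewrite vx /v patchE mem_set//; exact: xD.
pose E (z : PP) : R := u11 / 2 * z.1 ^+ 2 + u22 / 2 * z.2 ^+ 2.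
pose O1 (z : PP) : R := z.1 * (c 0%N + c 1%N * z.2 + c 2%N * z.2 ^+ 2 + c 3%N * z.1 ^+ 2).
pose O2 (z : PP) : R := z.2 * (c 4%N + c 5%N * z.2 ^+ 2 + c 6%N * z.1 ^+ 2).
have m1 : measurable_fun setT (fst : PP -> R) by exact: measurable_fst.
have m2 : measurable_fun setT (snd : PP -> R) by exact: measurable_snd.
have mE : measurable_fun setT E.
  by apply: measurable_funD; apply: measurable_funM => //; exact: measurable_funX.
have mO1 : measurable_fun setT O1.
  apply: measurable_funM => //; apply: measurable_funD; last first.
    by apply: measurable_funM => //; exact: measurable_funX.
  apply: measurable_funD; last by apply: measurable_funM => //; exact: measurable_funX.
  by apply: measurable_funD => //; apply: measurable_funM.
have mO2 : measurable_fun setT O2.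
  apply: measurable_funM => //; apply: measurable_funD; last first.
    by apply: measurable_funM => //; exact: measurable_funX.
  by apply: measurable_funD => //; apply: measurable_funM => //; exact: measurable_funX.
pose Err (z : PP) : R := w z * kap z - (E z + O1 z + O2 z) * radial z.
have mErr : measurable_fun setT Err.
  apply: measurable_funB; apply: measurable_funM => //.
  by apply: measurable_funD => //; exact: measurable_funD.
pose q t (z : PP) : R := if enorm z < t * d then radial z * enorm z ^+ 2 else 0.
have q0 t z : 0 <= q t z by rewrite /q; case: ifP => // _; rewrite mulr_ge0// sqr_ge0.
have mq t : measurable_fun setT (q t).
  apply: measurable_fun_ifT => //.
    by apply: measurable_fun_ltr => //; exact: measurable_enorm.
  by apply: measurable_funM => //; apply: measurable_funX; exact: measurable_enorm.
have tau01 : 0 < tau <= 1 by rewrite tau0.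
have t101 : 0 < (1 : R) <= 1 by rewrite ltr01 lexx.
have [iqt Iqt] := integrable_ge0_eq (mq tau) (q0 tau) (radial_disc_moment d0 kc tau01).
have [iq1 Iq1] := integrable_ge0_eq (mq 1) (q0 1) (radial_disc_moment d0 kc t101).
have P1 := Phi1 d0 kc.
(* [q t] has integral [2 * Phi g t]. On the annulus [|z| >= d / 2], because [tau >= 1 / 2], so the
   first-order bound [2 * M * |z|] is at most [4 * M / d * |z| ^+ 2]. *)
pose b (z : PP) : R := 5 * M * d ^+ 2 * q 1 z + 4 * M / d * (q 1 z + -1 * q tau z).
have ib' : leb2.-integrable setT (fun z => (q 1 z + -1 * q tau z)%:E).
  by apply: integrableDR => //; exact: integrableZlR.
have ib : leb2.-integrable setT (EFin \o b).
  by apply: integrableDR; apply: integrableZlR.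
have Ib : \int[@leb2 R]_z b z = 10 * M * d ^+ 2 + 8 * M / d * (1 - Phi g tau).
  rewrite /b RintegralD//; [|exact: integrableZlR|exact: integrableZlR].
  rewrite RintegralZl// RintegralZl// RintegralD//; last exact: integrableZlR.
  by rewrite RintegralZl// Iq1 Iqt P1; field; rewrite gt_eqF.
have Errb z : `|Err z| <= b z.
  have [dz|zd] := leP d (enorm z).
    have rz : radial z = 0.
      by apply/eqP/negPn; apply: contraTN dz => /(radial_supp d0); rewrite ltNge.
    have kz : kap z = 0.
      apply/eqP/negPn; apply: contraTN dz => /(gamma_n_supp d0 kc).
      by rewrite edE addrK ltNge.
    rewrite /Err rz kz !mulr0 subrr normr0 /b /q mul1r [enorm z < d]ltNge dz/=.
    rewrite [enorm z < _]ltNge (le_trans _ dz) ?ger_pMl//=.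
    by rewrite !(mulr0, addr0).
  have zE : z + x = (x.1 + z.1, x.2 + z.2).
    by rewrite [LHS]surjective_pairing /= (addrC z.1) (addrC z.2).
  have zx : disc x d (z + x) by rewrite /disc/= edE addrK.
  have wE : w z = u (x.1 + z.1, x.2 + z.2) - u x.
    by rewrite /w vx -zE /v patchE mem_set//; exact: xD.
  have zz : enorm (z.1, z.2) < d by [].
  have [T1 T2] := taylor z.1 z.2 zz.
  rewrite -wE in T1 T2.
  have kr : kap z <= radial z.
    by have := gamma_n_le Q d0 kc x (z + x); rewrite addrK.
  have k0 : 0 <= kap z by exact: (gamma_n_ge0 Q d0 kc).
  have e0 := enorm_ge0 z.
  have w1 : `|w z| <= 2 * M * enorm z.
    apply: le_trans T1 _; rewrite (_ : 2 * M * _ = M * (enorm z + enorm z)); last by ring.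
    by rewrite ler_wpM2l// lerD// ?norm1_le_enorm ?norm2_le_enorm.
  have -> : Err z = (w z - (z.1 ^+ 2 / 2 * u11 + z.2 ^+ 2 / 2 * u22)
       - z.1 * (c 0%N + c 1%N * z.2 + c 2%N * z.2 ^+ 2 + c 3%N * z.1 ^+ 2)
       - z.2 * (c 4%N + c 5%N * z.2 ^+ 2 + c 6%N * z.1 ^+ 2)) * radial z
     + w z * (kap z - radial z) by rewrite /Err /E /O1 /O2; field.
  apply: le_trans (ler_normD _ _) _; rewrite /b; apply: lerD.
    rewrite normrM (ger0_norm (r0 z)).
    apply: (@le_trans _ _ (5 * M * (z.1 ^+ 2 + z.2 ^+ 2) ^+ 2 * radial z)).
      by rewrite ler_wpM2r.
    rewrite -sqr_enorm /q mul1r zd.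
    rewrite (_ : _ * radial z = 5 * M * enorm z ^+ 2 * (radial z * enorm z ^+ 2)); last by ring.
    rewrite ler_wpM2r ?mulr_ge0 ?sqr_ge0// ler_wpM2l ?mulr_ge0//.
    by rewrite lerXn2r ?nnegrE// ltW.
  rewrite normrM /q mul1r zd.
  case: ifPn => [ztau|].
    have zt : ed x (z + x) < tau * d by rewrite edE addrK.
    have [f1 f2] := full _ zt.
    rewrite /kap (gamma_n_full d0 kc f1 f2) addrK subrr normr0 mulr0.
    by rewrite mulN1r subrr mulr0.
  rewrite -leNgt => ztau; rewrite mulr0 addr0.
  have nk : `|kap z - radial z| <= radial z by rewrite ler0_norm ?subr_le0// opprB gerBl.
  apply: (@le_trans _ _ (2 * M * enorm z * radial z)).
    by rewrite ler_pM.
  rewrite (_ : 4 * M / d * _ = 2 * M * enorm z * radial z * (2 * enorm z / d)); last first.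
    by field; rewrite gt_eqF.
  rewrite ler_peMr ?mulr_ge0// ler_pdivlMr// mul1r.
  have : 2^-1 * d <= tau * d by rewrite ler_wpM2r// ltW.
  by move=> /le_trans/(_ ztau); rewrite ler_pdivrMl.
have iErr := integrable_le_integrable mErr Errb ib.
have IErr : `|\int[@leb2 R]_z Err z| <= 10 * M * d ^+ 2 + 8 * M / d * (1 - Phi g tau).
  rewrite -Ib; apply: le_trans (le_normr_Rintegral _ iErr) _ => //.
  apply: le_Rintegral => //.
  by apply: integrable_le_integrable ib => [|z]; [exact: measurableT_comp|rewrite normr_id].
(* As [d <= 1], polynomials are bounded on the horizon, so the finite mass of the radial kernel
   makes every term of the Taylor polynomial integrable separately. *)
have iG : leb2.-integrable setT (EFin \o (radial : PP -> R)).
  apply/integrableP; split; first exact/measurable_EFinP.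
  apply: le_lt_trans (ltry G); apply: le_trans (radial_int hOm d0 kc xO hG).
  by rewrite le_eqVlt; apply/orP; left; apply/eqP; apply: eq_integral => z _ /=; rewrite ger0_norm.
have small (z : PP) : radial z != 0 -> `|z.1| <= 1 /\ `|z.2| <= 1.
  move=> /(radial_supp d0) zd; split.
    by rewrite (le_trans (norm1_le_enorm z))// (le_trans (ltW zd)).
  by rewrite (le_trans (norm2_le_enorm z))// (le_trans (ltW zd)).
have dominated (f : PP -> R) (K : R) : measurable_fun setT f ->
    (forall z : PP, `|z.1| <= 1 -> `|z.2| <= 1 -> `|f z| <= K) ->
    leb2.-integrable setT (fun z => (f z * radial z)%:E).
  move=> mf fK; apply: (@integrable_le_integrable _ PP leb2 (fun z => f z * radial z) (fun z => K * radial z)).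
  - exact: measurable_funM.
  - move=> z; rewrite normrM (ger0_norm (r0 z)).
    have [->|rz] := eqVneq (radial z) 0; first by rewrite !mulr0.
    by have [z1 z2] := small _ rz; rewrite ler_wpM2r// fK.
  - exact: integrableZlR.
have N1 (r : R) : `|r| <= 1 -> `|r ^+ 2| <= 1.
  by move=> r1; rewrite normrX exprn_ile1.
have Nm (r s : R) : `|r| <= 1 -> `|s * r| <= `|s|.
  by move=> r1; rewrite normrM ler_piMr.
have iO1 : leb2.-integrable setT (fun z => (O1 z * radial z)%:E).
  apply: (dominated _ (`|c 0%N| + `|c 1%N| + `|c 2%N| + `|c 3%N|)) => // z z1 z2.
  rewrite /O1 mulrC; apply: le_trans (Nm _ _ z1) _.
  do 3 (apply: le_trans (ler_normD _ _) _; apply: lerD; rewrite ?Nm ?N1//).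
have iO2 : leb2.-integrable setT (fun z => (O2 z * radial z)%:E).
  apply: (dominated _ (`|c 4%N| + `|c 5%N| + `|c 6%N|)) => // z z1 z2.
  rewrite /O2 mulrC; apply: le_trans (Nm _ _ z2) _.
  do 2 (apply: le_trans (ler_normD _ _) _; apply: lerD; rewrite ?Nm ?N1//).
have iE : leb2.-integrable setT (fun z => (E z * radial z)%:E).
  apply: (dominated _ (`|u11 / 2| + `|u22 / 2|)) => // z z1 z2.
  by apply: le_trans (ler_normD _ _) _; apply: lerD; rewrite Nm ?N1.
have IO1 : \int[@leb2 R]_z (O1 z * radial z) = 0.
  apply: leb2_odd1; first exact: measurable_funM.
  by move=> z; rewrite /O1 /radial /enorm/= sqrrN; ring.
have IO2 : \int[@leb2 R]_z (O2 z * radial z) = 0.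
  apply: leb2_odd2; first exact: measurable_funM.
  by move=> z; rewrite /O2 /radial /enorm/= sqrrN; ring.
have coord (cc : P -> R) : cc = fst \/ cc = snd ->
    leb2.-integrable setT (fun z : PP => (radial z * cc z ^+ 2)%:E) /\
    \int[@leb2 R]_z (radial z * cc z ^+ 2) = 1.
  move=> hc.
  have mcc : measurable_fun setT (cc : PP -> R) by case: hc => ->.
  apply: (@integrable_ge0_eq _ PP).
  - by apply: measurable_funM => //; exact: measurable_funX.
  - by move=> z; rewrite mulr_ge0// sqr_ge0.
  - rewrite -P1 -(radial_coord_moment d0 kc t101 hc); apply: eq_integral => z _; congr EFin.
    rewrite mul1r; case: ifPn => // zd.
    have -> : radial z = 0 by apply/eqP/negPn; apply: contra zd; exact: radial_supp.
    by rewrite mul0r.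
have [ic1 Ic1] := coord fst (or_introl erefl).
have [ic2 Ic2] := coord snd (or_intror erefl).
have IE : \int[@leb2 R]_z (E z * radial z) = (u11 + u22) / 2.
  transitivity (\int[@leb2 R]_z (u11 / 2 * (radial z * z.1 ^+ 2) + u22 / 2 * (radial z * z.2 ^+ 2))).
    by apply: eq_Rintegral => z _; rewrite /E; ring.
  rewrite RintegralD//; [|exact: (integrableZlR _ ic1)|exact: (integrableZlR _ ic2)].
  rewrite (RintegralZl _ _ ic1)// (RintegralZl _ _ ic2)// Ic1 Ic2.
  by field.
have : \int[@leb2 R]_z (w z * kap z) = \int[@leb2 R]_z Err z + (u11 + u22) / 2.
  transitivity (\int[@leb2 R]_z (Err z + (E z * radial z + (O1 z * radial z + O2 z * radial z)))).
    by apply: eq_Rintegral => z _; rewrite /Err; ring.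
  have iO : leb2.-integrable setT (fun z => (O1 z * radial z + O2 z * radial z)%:E).
    exact: integrableDR.
  have iEO : leb2.-integrable setT (fun z => (E z * radial z + (O1 z * radial z + O2 z * radial z))%:E).
    exact: integrableDR.
  rewrite (RintegralD measurableT iErr iEO) (RintegralD measurableT iE iO).
  by rewrite (RintegralD measurableT iO1 iO2) IO1 IO2 IE; ring.
move=> I; rewrite LopE I.
rewrite (_ : _ - _ = 2 * \int[@leb2 R]_z Err z); last by field.
rewrite (_ : 20 * M * d ^+ 2 + _ =
    2 * (10 * M * d ^+ 2 + 8 * M / d * (1 - Phi g tau))); last by ring.
by rewrite normrM ger0_norm// ler_wpM2l.
Qed.

End truncation_error.

(** * One-sided Taylor bounds at 1 *)

Section left_taylor.
Context {R : realType}.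
Implicit Types (F : R -> R) (P : R -> Prop).

Lemma near_at_left P (x : R) : (\forall t \near x^'-, P t) ->
  exists2 e, 0 < e & forall t, x - e < t < x -> P t.
Proof.
move=> [e /= e0 He]; exists e => // t /andP[t1 t2]; apply: He => //=.
by rewrite /ball_/= gtr0_norm; lra.
Qed.


(** A convergent difference quotient is bounded near the point, here by [|a| + 1]. *)
Lemma left_taylor1 F (a : R) : (F t - F 1) / (t - 1) @[t --> (1:R)^'-] --> a ->
  exists K e, [/\ 0 <= K, 0 < e &
    forall th, 0 <= th < e -> `|F 1 - F (1 - th)| <= K * th].
Proof.
move=> /cvgrPdist_le/(_ 1 ltac:(lra))/near_at_left[e e0 He].
have a10 : 0 <= `|a| + 1 by rewrite addr_ge0.
exists (`|a| + 1), e; split=> //.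
move=> th /andP[]; rewrite le_eqVlt => /predU1P[<- _|th0 the].
  by rewrite subr0 subrr normr0 mulr0.
have /He : 1 - e < 1 - th < 1 by apply/andP; split; lra.
set q := (_ / _) => Hq.
have qE : F 1 - F (1 - th) = q * th.
  by rewrite /q (_ : 1 - th - 1 = - th); [field; rewrite gt_eqF|ring].
rewrite qE normrM (gtr0_norm th0) ler_pM2r//.
have := ler_normB a (a - q); rewrite opprB addrCA subrr addr0 => h.
by apply: le_trans h _; rewrite lerD2l.
Qed.

(** The mean value theorem on [[1 - th, 1]] gives the increment as [th] times the derivative at some
    [c], which is at most [(|b| + 1) * (1 - c)] in absolute value. The left continuity of [F] at 1
    comes from the first-order bound. *)
Lemma left_taylor2 F (b : R) : left_derivatives_at1 F 0 b ->
  exists K e, [/\ 0 <= K, 0 < e &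
    forall th, 0 <= th < e -> `|F 1 - F (1 - th)| <= K * th ^+ 2].
Proof.
move=> [/near_at_left[e1 e10 He1] /left_taylor1[K1 [e2 [K10 e20 He2]]]].
move=> /cvgrPdist_le/(_ 1 ltac:(lra))/near_at_left[e3 e30 He3].
exists (`|b| + 1), (Num.min e1 (Num.min e2 e3)).
have b10 : 0 <= `|b| + 1 by rewrite addr_ge0.
split=> //; first by rewrite !lt_min e10 e20.
move=> th /andP[]; rewrite le_eqVlt => /predU1P[<- _|th0].
  by rewrite subr0 subrr normr0 expr0n/= mulr0.
rewrite !lt_min => /and3P[h1 h2 h3].
have der t : 1 - th <= t < 1 -> derivable F t 1.
  by move=> /andP[? ?]; apply: He1; apply/andP; split; lra.
have [||c ci cE] := @MVT R F (derive1 F) (1 - th) 1 ltac:(lra).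
- move=> x; rewrite in_itv/= => /andP[x1 x2].
  by rewrite derive1E; apply: derivableP; apply: der; rewrite (ltW x1).
- apply/continuous_within_itvP; first lra.
  split.
  + move=> x; rewrite in_itv/= => /andP[x1 x2]; apply: differentiable_continuous.
    by apply/derivable1_diffP; apply: der; rewrite (ltW x1).
  + apply: cvg_at_right_filter; apply: differentiable_continuous.
    by apply/derivable1_diffP; apply: der; apply/andP; split; lra.
  + apply/cvgrPdist_le => eps eps0; near=> t.
    have t1 : t < 1 by [].
    have t2 : 1 - e2 < t by near: t; apply: nbhs_left_gt; lra.
    have t3 : K1 * (1 - t) <= eps.
      have : 1 - eps / (K1 + 1) < t by near: t; apply: nbhs_left_gt; rewrite gtrBl divr_gt0//; lra.
      rewrite ltrBlDr -ltrBlDl ltr_pdivlMr; last lra.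
      nra.
    have th' : 0 <= 1 - t < e2 by apply/andP; split; lra.
    by have := He2 _ th'; rewrite subKr => /le_trans; apply.
move: ci; rewrite in_itv/= => /andP[c1 c2].
have /He3 : 1 - e3 < c < 1 by apply/andP; split; lra.
rewrite subr0 cE subKr normrM (gtr0_norm th0); set q := (_ / _) => Hq.
have -> : derive1 F c = q * (c - 1) by rewrite /q; field; rewrite subr_eq0 lt_eqF.
rewrite normrM expr2 mulrA ler_pM2r//.
have q1 : `|q| <= `|b| + 1.
  have := ler_normB b (b - q); rewrite opprB addrCA subrr addr0 => h.
  by apply: le_trans h _; rewrite lerD2l.
apply: ler_pM => //; rewrite ltr0_norm; lra.
Unshelve. all: by end_near. Qed.

(** The bounds are taken at distance [s ^+ 2] from 1, the relative defect of the apothem: the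
    first-order bound gives the exponent 2 and, when the first derivative vanishes, the second-order
    one gives 4. *)
Lemma left_remainder F a b lambda : left_derivatives_at1 F a b ->
  (a != 0 /\ lambda = 2%N) \/ [/\ a = 0, b != 0 & lambda = 4%N] ->
  exists K e, [/\ 0 <= K, 0 < e &
    forall s, 0 <= s -> s ^+ 2 < e -> `|F 1 - F (1 - s ^+ 2)| <= K * s ^+ lambda].
Proof.
move=> Fab [[_ ->]|[a0 _ ->]].
  case: Fab => _ /left_taylor1[K [e [K0 e0 H]]] _; exists K, e; split=> // s s0 se.
  by apply: H; rewrite sqr_ge0.
move: Fab; rewrite a0 => /left_taylor2[K [e [K0 e0 H]]]; exists K, e; split=> // s s0 se.
by rewrite (exprM s 2 2); apply: H; rewrite sqr_ge0.
Qed.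

End left_taylor.

(** * Galerkin approximation *)

Section square_integrable_restriction.
Context {R : realType}.
Local Notation P := (R * R)%type.
Local Notation PP := (plane R).
Implicit Types (D : set P) (u : P -> R).

Lemma L2normE D u : L2norm D u =
  ((\int[leb2]_x (((u \_ D) (x : PP)) ^+ 2)%:E) `^ 2^-1)%E.
Proof.
rewrite /L2norm unlock; congr (_ `^ _)%E; apply: eq_integral => x _ /=.
by rewrite powR_mulrn// real_normK// num_real.
Qed.

Lemma poweR_half_le (x : \bar R) (c : R) : (0 <= x)%E -> 0 <= c ->
  (x <= (c ^+ 2)%:E)%E -> (x `^ 2^-1 <= c%:E)%E.
Proof.
move=> x0 c0 xc.
rewrite -(_ : ((c ^+ 2)%:E `^ 2^-1 = c%:E)%E).
  apply: gt0_ler_poweR => //.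
  - by rewrite in_itv/= x0 leey.
  - by rewrite in_itv/= leey lee_fin sqr_ge0.
by rewrite poweR_EFin powR12_sqrt ?sqr_ge0// sqrtr_sqr ger0_norm.
Qed.

Lemma sqintegrable_L2norm D u : measurable (D : set PP) ->
  measurable_fun (D : set PP) (u : PP -> R) -> (L2norm D u < +oo)%E ->
  sqintegrable (@leb2s R) (u \_ D : PP -> R).
Proof.
move=> mD mu; rewrite L2normE => ufin; split; first exact: (measurable_restrictT _ mD).1.
by apply: lty_poweRy ufin; rewrite invr_eq0.
Qed.

Lemma sqintegrable_bounded D u M : measurable (D : set PP) ->
  measurable_fun (D : set PP) (u : PP -> R) -> (leb2 (D : set PP) < +oo)%E ->
  (forall x, D x -> `|u x| <= M) ->
  sqintegrable (@leb2s R) (u \_ D : PP -> R) /\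
  (\int[leb2]_x (((u \_ D) (x : PP)) ^+ 2)%:E <= (M ^+ 2)%:E * leb2 (D : set PP))%E.
Proof.
move=> mD mu Dfin uM.
have mr : measurable_fun setT (u \_ D : PP -> R) by exact: (measurable_restrictT _ mD).1.
have le : (\int[leb2]_x (((u \_ D) (x : PP)) ^+ 2)%:E <= (M ^+ 2)%:E * leb2 (D : set PP))%E.
  have mD1 : measurable_fun setT (fun x : PP => (\1_D x : R)%:E).
    by apply/measurable_EFinP; exact: measurable_indic.
  have -> : leb2 (D : set PP) = (\int[leb2]_x (\1_D (x : PP) : R)%:E)%E.
    by rewrite integral_indic// setIT.
  have D10 (x : PP) : setT x -> (0 <= (\1_D x : R)%:E)%E by rewrite lee_fin.
  have M20 : (0 <= (M ^+ 2)%:E)%E by rewrite lee_fin sqr_ge0.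
  rewrite -(ge0_integralZl _ measurableT mD1 D10 M20).
  apply: ge0_le_integral => //.
  - by move=> x _; rewrite lee_fin sqr_ge0.
  - by apply/measurable_EFinP; exact: measurable_funX.
  - exact: measurable_funeM.
  - move=> x _; rewrite -EFinM lee_fin patchE indicE; case: ifPn => xD.
      rewrite mulr1 -real_normK ?num_real//.
      have := uM x (set_mem xD); have := normr_ge0 (u x) => h1 h2.
      by rewrite ler_sqr ?nnegrE// (le_trans h1).
    by rewrite expr0n/= mulr0.
split => //; split => //.
apply: le_lt_trans le _; rewrite lte_mul_pinfty// lee_fin sqr_ge0//.
Qed.

End square_integrable_restriction.

Section galerkin.
Context {R : realType}.
Local Notation P := (R * R)%type.
Local Notation PP := (plane R).
Variables (Om : set P) (d : R) (gam : P -> P -> R) (gt g : R -> R).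
Variable (Q : P -> @polygon R).
Hypothesis hOm : open_polygon Om.
Hypothesis d0 : 0 < d.
Hypothesis d1 : d <= 1.
Hypothesis kc : kernel_conditions d gam gt g.
Hypothesis mQ : measurable ([set z | Oh Om d z.1 /\ poly_set d z.1 (Q z.1) z.2]
                : set (PP * PP)).
Variable G : R.
Hypothesis G0 : 0 <= G.
Hypothesis hG : (Gker Om d gam <= G%:E)%E.
Local Notation k := (kn Om d gam Q).
Local Notation B := (dform (@leb2s R) k).
Local Notation sqint := (sqintegrable (@leb2s R)).

Let mk := measurable_kn hOm d0 kc mQ.
Let k0 := kn_ge0 Om Q d0 kc.
Let ksym := kn_sym Om Q d0 kc.
Let kG x : (\int[@leb2s R]_y (k x y)%:E <= G%:E)%E.
Proof. exact: kn_int hOm d0 kc mQ G x G0 hG. Qed.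

Lemma within_closure_bounded (D : set P) (w : P -> R) (b : R) :
  (forall x, D x -> `|x.1| <= b /\ `|x.2| <= b) ->
  {within closure D, continuous w} -> exists M, forall x, closure D x -> `|w x| <= M.
Proof.
move=> Db cw; pose S : set P := `[- b, b]%classic `*` `[- b, b]%classic.
have cS : compact S by apply: compact_setX; exact: segment_compact.
have clS : closed S by apply: compact_closed cS; exact: norm_hausdorff.
have DS : closure D `<=` S.
  rewrite ((closure_id S).1 clS); apply: closureS => x /Db[x1 x2].
  by split; rewrite /= in_itv/= -ler_norml.
have cD : compact (closure D).
  by apply: (subclosed_compact _ cS) => //; exact: closed_closure.
have [M [_ HM]] := compact_bounded (continuous_compact cw cD).
by exists (M + 1) => x xD; apply: (HM (M + 1)); [rewrite ltrDl|exists x].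
Qed.

Lemma sqint_within (D : set P) (w : P -> R) (b : R) :
  measurable (D : set PP) -> (leb2 (D : set PP) < +oo)%E ->
  (forall x, D x -> `|x.1| <= b /\ `|x.2| <= b) ->
  {within closure D, continuous w} -> sqint (w \_ D : PP -> R).
Proof.
move=> mD Dfin Db cw; have [M HM] := within_closure_bounded Db cw.
have cDw : {within D, continuous w}.
  by apply: continuous_subspaceW cw; exact: subset_closure.
have mw : measurable_fun (D : set PP) (w : PP -> R).
  exact: continuous_within_measurable_plane.
apply: (sqintegrable_bounded mD mw Dfin (M := M) _).1.
by move=> x /subset_closure; exact: HM.
Qed.

Lemma Oc_strip : exists b, forall x, Oh Om d x -> `|x.1| <= b /\ `|x.2| <= b.
Proof.
have [D D0 HD] := polygon_strip hOm; exists (D + 1) => x /(OhP hOm)[/HD[h1 h2]|[z fz xz]].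
  by split; lra.
have : closure Om z by case: fz.
have clB : closure Om `<=` [set z | `|z.1| <= D /\ `|z.2| <= D].
  have clS : closed (`[- D, D]%classic `*` `[- D, D]%classic : set P).
    apply: compact_closed; first exact: norm_hausdorff.
    by apply: compact_setX; exact: segment_compact.
  move=> y; have : Om `<=` (`[- D, D]%classic `*` `[- D, D]%classic : set P).
    by move=> t /HD[t1 t2]; split; rewrite /= in_itv/= -ler_norml ltW.
  move=> /closureS; rewrite -((closure_id _).1 clS) => /[apply] -[/=].
  by rewrite !in_itv/= -!ler_norml.
move=> /clB[z1 z2].
have n1 := norm1_le_ed x z; have n2 := norm2_le_ed x z.
have t1 := ler_normD (x.1 - z.1) z.1; have t2 := ler_normD (x.2 - z.2) z.2.
rewrite subrK distrC in t1; rewrite subrK distrC in t2.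
by move: z1 z2 t1 t2 n1 n2 xz d1 => /= *; split; lra.
Qed.

Lemma sqint_V0 T w : V0 Om T w -> sqint (w \_ Om : PP -> R).
Proof.
move=> [cw _ _]; have [b Hb] := Oc_strip.
apply: (@sqint_within _ _ b) => //; first exact: measurable_Om.
- exact: leb2_Om_fin.
- by move=> x xO; apply: Hb; left.
Qed.

Lemma sqint_Vc T w : Vc Om d T w -> sqint (w \_ (Oc Om d) : PP -> R).
Proof.
move=> [cw _ _]; have [b Hb] := Oc_strip.
apply: (@sqint_within _ _ b) => //; first exact: measurable_Oc.
- apply: le_lt_trans (leb2_Oh_fin hOm (d := d) _); last by rewrite d0.
  apply: le_measure; rewrite ?inE.
  + exact: measurable_Oc.
  + exact: measurable_Oh.
  + by right.
- by move=> x xO; apply: Hb; right.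
Qed.

(** Interior and exterior parts put together on disjoint sets. The frontier belongs to [Oc Om d], so
    [b] alone counts there, whereas a sum such as [u0h \+ gh] involves both terms. *)
Definition glued (a b : P -> R) : PP -> R := (a \_ Om) \+ (b \_ (Oc Om d)).

Lemma glued_Om a b x : Om x -> glued a b x = a x.
Proof.
move=> xO; rewrite /glued/= !patchE mem_set// memNset ?addr0// OcE.
by case.
Qed.

Lemma glued_Oc a b x : Oc Om d x -> glued a b x = b x.
Proof.
move=> xO; rewrite /glued/= !patchE (mem_set xO) memNset ?add0r//.
by move: xO; rewrite OcE => -[].
Qed.

Lemma glued_out a b x : ~ Oh Om d x -> glued a b x = 0.
Proof.
move=> xO; rewrite /glued/= !patchE !memNset ?add0r// => ?; apply: xO; [by right|by left].
Qed.

Lemma sqint_glued a b : sqint (a \_ Om : PP -> R) -> sqint (b \_ (Oc Om d) : PP -> R) ->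
  sqint (glued a b).
Proof. exact: sqintegrableD. Qed.

Let kOut x y : ~ Oh Om d y -> k x y = 0.
Proof. by move=> yO; rewrite /kn [\1_(Oh Om d) y]indicE memNset// mulr0. Qed.

Lemma Lop_glued (v : P -> R) x : Om x ->
  Lop d gam Q v x = 2 * \int[@leb2 R]_y ((glued v v y - glued v v x) * k x y).
Proof.
move=> xO; rewrite /Lop; congr (_ * _); apply: eq_Rintegral => y _.
rewrite (kn_Om _ hOm d0 kc)//.
have [->|/(gamma_n_supp d0 kc) xy] := eqVneq (gamma_n d gam Q x y) 0; first by rewrite !mulr0.
rewrite (glued_Om _ _ xO).
have [yO|yO] := @disc_sub_Oh _ _ hOm x d (subset_closure xO) y xy; first by rewrite glued_Om.
by rewrite glued_Oc.
Qed.

(** The equation, which holds almost everywhere on [Om], is multiplied by [z] and integrated; the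
    factor of the weak form is that of [Lop]. *)
Lemma dform_solution (f gD u z : P -> R) :
  measurable_fun (Om : set PP) (f : PP -> R) ->
  nonlocal_solution Om d gam Q f gD u ->
  sqint (glued u u) -> sqint (z \_ Om : PP -> R) ->
  B (glued u u) (z \_ Om : PP -> R) = \int[@leb2 R]_(x in Om) (f x * z x).
Proof.
move=> mf [mu _ sol _] iU iZ; have [mZ _] := iZ.
rewrite (@dform_weak_iterated _ PP R (@leb2s R) k G mk k0 ksym kG G0 _ _ iU iZ).
have iW := @dform_weak_integrable _ PP R (@leb2s R) k G mk k0 ksym kG G0 _ _ iU iZ.
rewrite -RintegralZl// [RHS]Rintegral_mkcond /Rintegral; congr fine.
have mO := measurable_Om hOm.
apply: ae_eq_integral => //.
- by case/integrableP: (integrableZlR (-2) iW).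
- apply/measurable_EFinP; rewrite (_ : _ \_ _ = (f \_ Om) \* (z \_ Om)).
    by apply: measurable_funM => //; exact: (measurable_restrictT _ mO).1.
  by apply/funext => x /=; rewrite !patchE; case: ifPn => _ //; rewrite mul0r.
- have sol' : {ae @leb2s R, forall x : PP, Om x -> - Lop d gam Q u x = f x} by exact: sol.
  apply: (@filterS _ _ (ae_filter_ringOfSetsType (@leb2s R)) _ _ _ sol') => x {}sol' _; congr EFin; rewrite !patchE.
  case: ifPn => [/set_mem xO|_]; last by rewrite mul0r mulr0.
  rewrite -(sol' xO) Lop_glued//.
  by set I := \int[_]_y _; rewrite -[fine _]/I; ring.
Qed.

(** Splitting the weak form along [Om] reproduces the two integrals of the discrete problem: outside
    [Om], the cut-off kernel vanishes off [Oc Om d]. *)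
Lemma dform_cdg T (f gh u0h z : P -> R) :
  Vc Om d T gh -> cdg_solution Om d gam Q T f gh u0h -> V0 Om T z ->
  B (glued u0h gh) (z \_ Om : PP -> R) = \int[@leb2 R]_(x in Om) (f x * z x).
Proof.
move=> Vgh [Vu cdg] Vz; have mO := measurable_Om hOm.
have iU := sqint_glued (sqint_V0 Vu) (sqint_Vc Vgh); have iZ := sqint_V0 Vz.
rewrite (@dform_weak_split _ PP R (@leb2s R) k G mk k0 ksym kG G0 _ _ _ mO iU iZ).
have -> : \int[@leb2 R]_x ((z \_ Om) x *
    \int[@leb2 R]_(y in Om) ((glued u0h gh y - glued u0h gh x) * k x y)) =
  \int[@leb2 R]_(x in Om)
        (z x * (\int[@leb2 R]_(y in Om) ((u0h y - u0h x) * gamma_n d gam Q x y))).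
  rewrite [RHS]Rintegral_mkcond; apply: eq_Rintegral => x _; rewrite !patchE.
  case: ifPn => [/set_mem xO|_]; last by rewrite mul0r.
  congr (_ * _); apply: eq_Rintegral => y /set_mem yO.
  by rewrite !glued_Om// (kn_Om _ hOm d0 kc).
have -> : \int[@leb2 R]_x ((z \_ Om) x *
    \int[@leb2 R]_(y in ~` Om) ((glued u0h gh y - glued u0h gh x) * k x y)) =
  \int[@leb2 R]_(x in Om)
        (z x * (\int[@leb2 R]_(y in Oc Om d) ((gh y - u0h x) * gamma_n d gam Q x y))).
  rewrite [RHS]Rintegral_mkcond; apply: eq_Rintegral => x _; rewrite !patchE.
  case: ifPn => [/set_mem xO|_]; last by rewrite mul0r.
  congr (_ * _); rewrite Rintegral_mkcond [RHS]Rintegral_mkcond.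
  apply: eq_Rintegral => y _; rewrite !patchE.
  have [yOc|yOc] := pselect (Oc Om d y).
    rewrite !mem_set//; last by move: yOc; rewrite OcE => -[].
    by rewrite (glued_Oc _ _ yOc) glued_Om// (kn_Om _ hOm d0 kc).
  rewrite (memNset yOc); case: ifPn => // /set_mem yO.
  by rewrite kOut ?mulr0// => -[].
by have c := cdg _ Vz; rewrite mulrDr c mulNr addrK.
Qed.

Lemma V0B T a b : V0 Om T a -> V0 Om T b -> V0 Om T (a \- b).
Proof.
move=> [ca la za] [cb lb zb]; split.
- by move=> x; apply: continuousB; [exact: ca|exact: cb].
- move=> t /[dup]/la[a0 [a1 [a2 Ha]]] /lb[b0 [b1 [b2 Hb]]].
  by exists (a0 - b0), (a1 - b1), (a2 - b2) => x xt /=; rewrite Ha// Hb//; ring.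
- by move=> x xO /=; rewrite za// zb// subrr.
Qed.

(** [w] and [u0h] are paired with the same exterior data [gh], so their difference is a test
    function; subtracting the two weak equations gives the Galerkin orthogonality. *)
Lemma galerkin_best T (f gD u gh u0h w : P -> R) :
  measurable_fun (Om : set PP) (f : PP -> R) ->
  nonlocal_solution Om d gam Q f gD u ->
  Vc Om d T gh -> cdg_solution Om d gam Q T f gh u0h -> V0 Om T w ->
  B (glued (u \- u0h) (u \- gh)) (glued (u \- u0h) (u \- gh)) <=
  B (glued (u \- w) (u \- gh)) (glued (u \- w) (u \- gh)).
Proof.
move=> mf sol Vgh cdg Vw; have [Vu _] := cdg; have [mu ufin _ _] := sol.
have mO := measurable_Om hOm; have mOc := measurable_Oc hOm d.
have gluedD (a b a' b' : P -> R) : glued a b \- glued a' b' = glued (a \- a') (b \- b').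
  apply/funext => x; rewrite /glued/= !patchE /=.
  by case: ifPn => _; case: ifPn => _; rewrite /point/=; ring.
have iU : sqint (glued u u).
  rewrite (_ : glued u u = u \_ (Oh Om d)).
    by apply: sqintegrable_L2norm => //; exact: measurable_Oh.
  apply/funext => x; rewrite [RHS]patchE; case: ifPn => [/set_mem[xO|xO]|/negP xO].
  - by rewrite glued_Om.
  - by rewrite glued_Oc.
  - by rewrite glued_out// => /mem_set.
have iz := V0B Vu Vw.
have iT0 := sqint_V0 iz.
have ie : sqint (glued (u \- w) (u \- gh)).
  by rewrite -gluedD; apply: sqintegrableB => //; apply: sqint_glued; [exact: sqint_V0 Vw|exact: sqint_Vc Vgh].
have E : glued (u \- u0h) (u \- gh) = glued (u \- w) (u \- gh) \- ((u0h \- w) \_ Om).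
  apply/funext => x; rewrite /glued/= !patchE /=.
  by case: ifPn => _; rewrite /point/=; ring.
rewrite E; apply: (@dform_cea _ PP R (@leb2s R) k G mk k0 ksym kG G0) => //; rewrite -E -gluedD.
have iUh : sqint (glued u0h gh) by apply: sqint_glued; [exact: sqint_V0 Vu|exact: sqint_Vc Vgh].
rewrite (@dformBl _ PP R (@leb2s R) k G mk k0 ksym kG G0)// (dform_solution mf sol)//.
by rewrite (dform_cdg Vgh cdg)// subrr.
Qed.

End galerkin.

(** * Error estimate at a fixed horizon *)

Section fixed_horizon.
Context {R : realType}.
Local Notation P := (R * R)%type.
Local Notation PP := (plane R).
Variables (Om : set P) (d : R) (gam : P -> P -> R) (gt g : R -> R).
Variable (Q : P -> @polygon R).
Hypothesis hOm : open_polygon Om.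
Hypothesis d0 : 0 < d.
Hypothesis d1 : d <= 1.
Hypothesis kc : kernel_conditions d gam gt g.
Hypothesis mQ : measurable ([set z | Oh Om d z.1 /\ poly_set d z.1 (Q z.1) z.2]
                : set (PP * PP)).
Variable G : R.
Hypothesis G0 : 0 <= G.
Hypothesis hG : (Gker Om d gam <= G%:E)%E.
Local Notation k := (kn Om d gam Q).
Local Notation B := (dform (@leb2s R) k).
Local Notation sqint := (sqintegrable (@leb2s R)).

Let mk := measurable_kn hOm d0 kc mQ.
Let k0 := kn_ge0 Om Q d0 kc.
Let ksym := kn_sym Om Q d0 kc.
Let kG x : (\int[@leb2s R]_y (k x y)%:E <= G%:E)%E.
Proof. exact: kn_int hOm d0 kc mQ G x G0 hG. Qed.

Variables (D r0 : R).
Hypothesis D1 : 1 <= D.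
Hypothesis OmD : forall x, Om x -> `|x.1| < D.
Hypothesis r00 : 0 < r0 <= 1.
Hypothesis disc_poly : forall x y, Oh Om d x -> ed x y < r0 * d -> poly_set d x (Q x) y.

Local Notation cP := (Phi g r0 / (16 * D ^+ 2)).

Lemma poincare_const_gt0 : 0 < cP.
Proof.
have D0 : 0 < D by move: D1; lra.
by rewrite divr_gt0 ?(Phi_gt0 d0 kc)// mulr_gt0// exprn_gt0.
Qed.

(** Two points at distance less than [r0 * d], one of them in [Om], lie in each other's polygon, so
    the truncated kernel is there the full radial one. Its second moment along an axis on that disc
    is [Phi g r0]. *)
Lemma poincare_kn (v : PP -> R) : sqint v -> (forall x, ~ Om x -> v x = 0) ->
  (cP%:E * \int[@leb2s R]_x ((v x) ^+ 2)%:E <= (B v v)%:E)%E.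
Proof.
move=> iv vOm; have [mv _] := iv.
rewrite (@dform_energy _ PP R (@leb2s R) k G mk k0 ksym kG G0 _ iv).
pose kap (z : PP) : R := if enorm z < r0 * d then radial d gt z else 0.
have [r0p r01] := andP r00.
have rd : r0 * d <= d by rewrite ler_piMl// ltW.
have vnz x : v x != 0 -> Om x.
  by move=> vx; apply: contrapT => /vOm e; rewrite e eqxx in vx.
have kapk x y : Om x -> kap (y - x) <= k x y.
  move=> xO; rewrite /kap -edE; case: ifPn => xy; last exact: k0.
  have yO : Oh Om d y.
    by apply: (@disc_sub_Oh _ _ hOm x d (subset_closure xO)); exact: lt_le_trans xy rd.
  have xO' : Oh Om d x by left.
  rewrite kn_in// (gamma_n_full d0 kc)//; apply: disc_poly => //.
  by rewrite edC.
have kapC x y : kap (y - x) = kap (x - y).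
  by rewrite /kap -!edE edC -(opprB x y) radialN.
apply: (@nonlocal_poincare R v D kap k (Phi g r0)) => //.
- exact: lt_le_trans ltr01 D1.
- by move=> x /vnz; exact: OmD.
- apply: measurable_fun_ifT => //; last exact: (measurable_radial kc).
  by apply: measurable_fun_ltr => //; exact: measurable_enorm.
- by move=> z; rewrite /kap; case: ifPn => // _; exact: (radial_ge0 d0 kc).
- move=> z; rewrite /kap; case: ifPn => [zd _|]; last by rewrite eqxx.
  have D0 : 1 <= D by exact: D1.
  have := norm1_le_enorm z; move: zd rd d1 D0; lra.
- by move=> x y [/vnz|/vnz] ?; [|rewrite kapC ksym]; exact: kapk.
- rewrite -(radial_coord_moment d0 kc r00 (or_introl erefl)).
  rewrite le_eqVlt; apply/orP; left; apply/eqP; apply: eq_integral => z _.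
  by rewrite /kap; case: ifPn => //; rewrite mul0r.
Qed.

Lemma dform_bounded (S : set P) (a : P -> R) (M A : R) :
  measurable (S : set PP) -> sqint (a \_ S : PP -> R) ->
  (forall x, S x -> `|a x| <= M) -> (leb2 (S : set PP) <= A%:E)%E ->
  B (a \_ S : PP -> R) (a \_ S : PP -> R) <= 4 * G * (M ^+ 2 * A).
Proof.
move=> mS ia aM SA; have [ma _] := ia.
have maS : measurable_fun (S : set PP) (a : PP -> R).
  exact: (measurable_restrictT _ mS).2.
have := @dform_le _ PP R (@leb2s R) k G mk k0 ksym kG G0 _ ia.
rewrite -lee_fin => /le_trans; apply.
rewrite [leRHS]EFinM; apply: lee_wpmul2l; first by rewrite lee_fin mulr_ge0.
have Sfin : (leb2 (S : set PP) < +oo)%E by apply: le_lt_trans SA _; rewrite ltry.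
apply: le_trans (sqintegrable_bounded mS maS Sfin aM).2 _.
by rewrite [leRHS]EFinM; apply: lee_wpmul2l => //; rewrite lee_fin sqr_ge0.
Qed.

Section error_bounds.
Variables (f gD u ut w u0h gh : P -> R) (T : set (P * P * P)).
Variables (F E I H A Ac : R).
Hypothesis mf : measurable_fun (Om : set PP) (f : PP -> R).
Hypothesis sol : nonlocal_solution Om d gam Q f gD u.
Hypothesis Vgh : Vc Om d T gh.
Hypothesis cdg : cdg_solution Om d gam Q T f gh u0h.
Hypothesis Vw : V0 Om T w.
Hypothesis iut : sqint (glued Om d ut ut).
Hypothesis F0 : 0 <= F.
Hypothesis lef : forall x, Om x -> `|f x + Lop d gam Q ut x| <= F.
Hypothesis leE : forall x, Oc Om d x -> `|u x - ut x| <= E.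
Hypothesis leI : forall x, Om x -> `|ut x - w x| <= I.
Hypothesis leH : forall x, Oc Om d x -> `|u x - gh x| <= H.
Hypothesis AE : leb2 (Om : set PP) = A%:E.
Hypothesis leAc : (leb2 (Oc Om d : set PP) <= Ac%:E)%E.

Let mO : measurable (Om : set PP) := measurable_Om hOm.
Let mOc : measurable (Oc Om d : set PP) := measurable_Oc hOm d.

Let restr (S : set P) (a b : PP -> R) : measurable (S : set PP) -> sqint b ->
  (forall x, S x -> b x = a x) -> sqint (a \_ S : PP -> R).
Proof.
move=> mS [mb ib] ba.
have mr : measurable_fun setT (a \_ S : PP -> R).
  rewrite (_ : a \_ S = b \* \1_S); first by apply: measurable_funM => //; exact: measurable_indic.
  apply/funext => x /=; rewrite patchE indicE; case: ifPn => [/set_mem/ba->|_].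
    by rewrite mulr1.
  by rewrite mulr0.
split=> //; apply: le_lt_trans ib; apply: ge0_le_integral => //.
- by move=> x _; rewrite lee_fin sqr_ge0.
- by apply/measurable_EFinP; exact: measurable_funX.
- by apply/measurable_EFinP; exact: measurable_funX.
- move=> x _; rewrite lee_fin patchE; case: ifPn => [/set_mem/ba->//|_].
  by rewrite expr0n/= sqr_ge0.
Qed.

Let iU : sqint (glued Om d u u).
Proof.
have [mu ufin _ _] := sol.
rewrite (_ : glued Om d u u = u \_ (Oh Om d)).
  by apply: sqintegrable_L2norm => //; exact: measurable_Oh.
apply/funext => x; rewrite [RHS]patchE; case: ifPn => [/set_mem[xO|xO]|/negP xO].
- by rewrite glued_Om.
- by rewrite glued_Oc.
- by rewrite glued_out// => /mem_set.
Qed.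

Let e0 : PP -> R := (u \- ut) \_ Om.
Let eg : PP -> R := (u \- ut) \_ (Oc Om d).
Let i0 : PP -> R := (ut \- w) \_ Om.
Let gd : PP -> R := (u \- gh) \_ (Oc Om d).
Let err' := glued Om d (u \- u0h) (u \- gh).

Let iUt := sqintegrableB iU iut.

Let ie0 : sqint e0.
Proof. by apply: (restr mO iUt) => x xO /=; rewrite !glued_Om. Qed.

Let ieg : sqint eg.
Proof. by apply: (restr mOc iUt) => x xO /=; rewrite !glued_Oc. Qed.

Let ii0 : sqint i0.
Proof.
apply: (restr mO (sqintegrableB iut (sqint_V0 hOm d1 Vw))) => x xO /=.
by rewrite glued_Om// patchE mem_set.
Qed.

Let igd : sqint gd.
Proof.
apply: (restr mOc (sqintegrableB iU (sqint_Vc hOm d0 d1 Vgh))) => x xO /=.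
by rewrite glued_Oc// patchE mem_set.
Qed.

Let ierr : sqint err'.
Proof.
have [Vu _] := cdg; apply: sqint_glued => //.
apply: (restr mO (sqintegrableB iU (sqint_V0 hOm d1 Vu))) => x xO /=.
by rewrite glued_Om// patchE mem_set.
Qed.

(** On [Om] the operator sends [u - ut] to [- (f + Lop ut)], bounded by [F]; the factor 2 in [Lop]
    turns this into the [F / 2] of the stability estimate. *)
Let dform_e0 : B e0 e0 <= 2 * F ^+ 2 * A / cP + 4 * B eg eg.
Proof.
have e0S x : ~ Om x -> e0 x = 0 by move=> xO; rewrite /e0 patchE memNset.
apply: (@dform_stability _ PP R (@leb2s R) k G mk k0 ksym kG G0 Om) => //.
- exact: poincare_const_gt0.
- exact: poincare_kn.
have [_ _ ae _] := sol.
have ae' : {ae @leb2s R, forall x : PP, Om x -> - Lop d gam Q u x = f x} by exact: ae.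
have s1 := @dform_section_integrable _ PP R (@leb2s R) k G mk k0 ksym kG G0 _ iU.
have s2 := @dform_section_integrable _ PP R (@leb2s R) k G mk k0 ksym kG G0 _ iut.
move: ae' s1 s2; apply: (@filterS3 _ _ (ae_filter_ringOfSetsType (@leb2s R))) => x h1 h2 h3 xO.
have -> : \int[@leb2s R]_y ((e0 y + eg y - (e0 x + eg x)) * k x y) =
    \int[@leb2s R]_y ((glued Om d u u y - glued Om d u u x) * k x y) -
    \int[@leb2s R]_y ((glued Om d ut ut y - glued Om d ut ut x) * k x y).
  rewrite -RintegralB//; apply: eq_Rintegral => y _.
  have eE t : e0 t + eg t = glued Om d u u t - glued Om d ut ut t.
    rewrite /e0 /eg /glued/= !patchE/=.
    by case: ifPn => _; case: ifPn => _; rewrite /point/=; ring.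
  by rewrite !eE; ring.
have := lef xO; rewrite -(h1 xO) !(Lop_glued _ hOm d0 kc)//.
set I1 := \int[_]_y _; set I2 := \int[_]_y _ => h.
have -> : I1 - I2 = - (- (2 * I1) + 2 * I2) / 2 by field.
by rewrite normrM normrN ger0_norm ?invr_ge0// ler_wpM2r.
Qed.

(** The competitor's error is [e0 \+ (i0 \+ gd)]. Two applications of [dform_addle] give weight 2 to
    [e0] and 4 to the other two, and [dform_bounded] contributes [4 * G], whence 16; the strip part
    of [e0] enters with 2, 4 and 4, whence 32. *)
Let energy_bound := 4 * F ^+ 2 * A / cP + 32 * G * E ^+ 2 * Ac
   + 16 * G * I ^+ 2 * A + 16 * G * H ^+ 2 * Ac.

Let dform_gd : B gd gd <= 4 * G * (H ^+ 2 * Ac).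
Proof. exact: dform_bounded. Qed.

Lemma dform_error : B err' err' <= energy_bound.
Proof.
have := galerkin_best hOm d0 d1 kc mQ G0 hG mf sol Vgh cdg Vw; rewrite -/err'.
move=> /le_trans; apply.
have -> : glued Om d (u \- w) (u \- gh) = e0 \+ (i0 \+ gd).
  apply/funext => x; rewrite /glued/e0/i0/gd/= !patchE/=.
  by case: ifPn => _; case: ifPn => _; rewrite /point/=; ring.
have iig := sqintegrableD ii0 igd.
have h1 := @dform_addle _ PP R (@leb2s R) k G mk k0 ksym kG G0 _ _ ie0 iig.
have h2 := @dform_addle _ PP R (@leb2s R) k G mk k0 ksym kG G0 _ _ ii0 igd.
have h3 : B eg eg <= 4 * G * (E ^+ 2 * Ac) by exact: dform_bounded.
have h4 : B i0 i0 <= 4 * G * (I ^+ 2 * A) by apply: dform_bounded => //; rewrite AE.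
move: h1 h2 h3 h4 dform_e0 dform_gd; rewrite /energy_bound.
have -> : 4 * F ^+ 2 * A / cP = 2 * (2 * F ^+ 2 * A / cP) by ring.
move: (2 * F ^+ 2 * A / cP) => Z; lra.
Qed.

Let err : P -> R := u \- (u0h \+ gh).

(** The Poincare inequality needs a function vanishing outside [Om], so the exterior part [gd] is
    subtracted from the glued error; twice the bound on its energy is the term
    [8 * G * H ^+ 2 * Ac]. *)
Lemma L2_error c : 0 <= c -> (2 * energy_bound + 8 * G * H ^+ 2 * Ac) / cP <= c ^+ 2 ->
  (L2norm Om err <= c%:E)%E.
Proof.
move=> c0 hc; have [_ _ gh0] := Vgh.
have cP0 := poincare_const_gt0.
pose v : PP -> R := err' \- gd.
have vE : v = err \_ Om :> (PP -> R).
  apply/funext => x; rewrite /v/=.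
  have [xO|xO] := pselect (Om x).
    rewrite /err' glued_Om// /gd !patchE (mem_set xO) memNset ?subr0.
      by rewrite /err/= gh0// addr0.
    by rewrite OcE => -[].
  rewrite [RHS]patchE memNset// /gd patchE.
  case: ifPn => [/set_mem xOc|/negP xOc]; first by rewrite /err' glued_Oc// subrr.
  by rewrite /err' glued_out ?subr0// => -[//|/mem_set].
have iv : sqint v by exact: sqintegrableB.
have vOm x : ~ Om x -> v x = 0 by move=> xO; rewrite vE patchE memNset.
rewrite L2normE -vE; apply: poweR_half_le => //.
  by apply: integral_ge0 => x _; rewrite lee_fin sqr_ge0.
have le1 := @dform_addle _ PP R (@leb2s R) k G mk k0 ksym kG G0 _ _ ierr (sqintegrableN igd).
have le2 : B v v <= 2 * energy_bound + 8 * G * H ^+ 2 * Ac.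
  have hN : B (\- gd) (\- gd) = B gd gd by apply: eq_Rintegral => z _ /=; ring.
  apply: le_trans le1 _; rewrite hN; move: dform_error dform_gd; lra.
have := poincare_kn iv vOm.
rewrite -[leLHS]/(cP%:E * \int[@leb2s R]_x ((v x) ^+ 2)%:E)%E.
set N := (\int[@leb2s R]_x ((v x) ^+ 2)%:E)%E => h.
rewrite -[leLHS]/N; move: hc; rewrite ler_pdivrMr// => hc.
rewrite -(@lee_pmul2l _ cP%:E) ?lte_fin//.
apply: le_trans h _; rewrite -EFinM lee_fin; move: hc le2; rewrite (mulrC cP).
by move: (c ^+ 2 * cP) (B v v) energy_bound => *; lra.
Qed.

(** In [err] both [u0h] and [gh] may contribute on the frontier, in [err'] only [gh] does. On
    [Oh Om d] the two differ on the frontier alone, a null set, so their difference [n] has no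
    energy; the factor 2 is the price of [dform_addle]. *)
Lemma energy_norm_error c : 0 <= c -> 2 * energy_bound <= c ^+ 2 ->
  (energy_norm Om d gam Q err <= c%:E)%E.
Proof.
move=> c0 hc; have [_ _ gh0] := Vgh; have [[cu _ u0] _] := cdg.
have mOh : measurable (Oh Om d : set PP) by exact: measurable_Oh.
have clOh : closure Om `<=` Oh Om d.
  by move=> x xO; apply: (disc_sub_Oh hOm xO (d := d)); rewrite /disc/= edxx.
have mcl : measurable (closure Om : set PP).
  by apply: closed_measurable_plane; exact: closed_closure.
have icl : sqint (u0h \_ (closure Om) : PP -> R).
  have [b Hb] := Oc_strip hOm d1.
  apply: (@sqint_within _ _ _ b) => //.
  - apply: le_lt_trans (leb2_Oh_fin hOm (d := d) _); last by rewrite d0.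
    by apply: le_measure; rewrite ?inE.
  - by move=> x /clOh; exact: Hb.
  - by rewrite -((closure_id _).1 (@closed_closure _ Om)).
pose e : PP -> R := err \_ (Oh Om d).
have eE : e = (glued Om d u u \- (u0h \_ (closure Om))) \- (gh \_ (Oc Om d)).
  apply/funext => x; rewrite /e/= !patchE.
  case: ifPn => [/set_mem[xO|xO]|/negP xO].
  - rewrite glued_Om// mem_set; last exact: subset_closure.
    rewrite memNset; last by rewrite OcE => -[].
    by rewrite /err/= gh0// addr0 subr0.
  - rewrite glued_Oc// (mem_set xO) /err/=.
    by case: ifPn => [_|/negP xcl]; [|rewrite u0 => [|/mem_set//]]; rewrite /point/=; ring.
  - rewrite glued_out; last by move=> /mem_set.
    rewrite memNset; last by move=> /clOh/mem_set.
    by rewrite memNset ?subr0// => h; apply: xO; apply/mem_set; right.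
have ie : sqint e.
  by rewrite eE; apply: sqintegrableB; [exact: sqintegrableB|exact: sqint_Vc Vgh].
pose n : PP -> R := e \- err'.
have inn : sqint n by exact: sqintegrableB.
have n0 x : ~ frontier Om x -> n x = 0.
  move=> xf; rewrite /n/= /e patchE; case: ifPn => [/set_mem[xO|xO]|/negP xO].
  - by rewrite /err' glued_Om// /err/= gh0// addr0 subrr.
  - rewrite /err' glued_Oc// /err/= u0 ?add0r ?subrr// => xcl; apply: xf; split => //.
    by move=> /interior_subset; move: xO; rewrite OcE => -[].
  - by rewrite /err' glued_out ?subr0// => /mem_set.
have Bn : B n n <= 0.
  have := @dform_le _ PP R (@leb2s R) k G mk k0 ksym kG G0 _ inn.
  rewrite [X in (_ * X)%E](_ : _ = 0%E); first by rewrite mule0 lee_fin.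
  have mfr : measurable (frontier Om : set PP).
    by apply: measurableD => //; apply: open_measurable_plane; exact: open_interior.
  have [mn _] := inn.
  rewrite -(@null_set_integral _ PP R (@leb2s R) (frontier Om) (fun x => ((n x) ^+ 2)%:E))//.
  - rewrite [RHS]integral_mkcond; apply: eq_integral => x _; rewrite patchE.
    by case: ifPn => // /negP xf; rewrite n0 ?expr0n//= => /mem_set.
  - by apply/measurable_EFinP; apply: measurable_funX; exact: measurable_funS mn.
  - exact: leb2_frontier0.
have le1 := @dform_addle _ PP R (@leb2s R) k G mk k0 ksym kG G0 _ _ ierr inn.
have eE' : err' \+ n = e by apply/funext => x; rewrite /n/= addrC subrK.
have le2 : B e e <= c ^+ 2.
  by rewrite -eE'; move: le1 Bn dform_error hc; lra.
have := @dform_energy _ PP R (@leb2s R) k G mk k0 ksym kG G0 _ ie.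
rewrite /energy_norm => h; apply: poweR_half_le => //.
  apply: integral_ge0 => x _; apply: integral_ge0 => y _; rewrite lee_fin.
  by apply: mulr_ge0; [exact: sqr_ge0|exact: (gamma_n_ge0 Q d0 kc)].
move: le2; rewrite -lee_fin h; apply: le_trans.
rewrite le_eqVlt; apply/orP; left; apply/eqP.
rewrite [LHS]integral_mkcond; apply: eq_integral => x _; rewrite patchE.
case: ifPn => [/set_mem xO|/negP xO]; last first.
  rewrite integral0_eq// => y _; rewrite ksym /kn [\1_(Oh Om d) x]indicE memNset ?mulr0//.
  by move=> /mem_set.
rewrite [LHS]integral_mkcond; apply: eq_integral => y _; rewrite patchE.
case: ifPn => [/set_mem yO|/negP yO]; last first.
  rewrite /kn [\1_(Oh Om d) y]indicE memNset ?mulr0//.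
  by move=> /mem_set.
by rewrite kn_in// /e !patchE !mem_set.
Qed.

End error_bounds.
End fixed_horizon.

(** * Discs contained in the polygons and the consistency error *)

Section consistency.
Context {R : realType}.
Local Notation P := (R * R)%type.
Local Notation PP := (plane R).
Implicit Types (x y : P) (u : P -> R).

Lemma eq_laplacian (D : set P) u v : open D -> (forall x, D x -> u x = v x) ->
  forall x, D x -> laplacian u x = laplacian v x.
Proof.
move=> oD uv.
have eqD (a b : P -> R) e : (forall x, D x -> a x = b x) ->
    forall x, D x -> 'D_e a x = 'D_e b x.
  move=> ab x xD; apply: near_eq_derive.
  by have /(_ _ xD) : D `<=` interior D; [rewrite -open_subsetE|apply: filterS => y; exact: ab].
move=> x xD; rewrite /laplacian.
by rewrite (eqD _ _ _ (eqD u v e1 uv) x xD) (eqD _ _ _ (eqD u v e2 uv) x xD).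
Qed.

Variables (Om : set P) (d : R) (gam : P -> P -> R) (gt g : R -> R).
Variable (Q : P -> @polygon R).
Hypothesis hOm : open_polygon Om.
Hypothesis d0 : 0 < d.

(** [r0 < C2] is strict because the supremum defining the inradius need not be attained. The radius
    0, whose disc is empty, shows that this supremum is over a nonempty set. *)
Lemma inradius_disc (C2 r0 : R) x :
  ((C2 * d)%:E <= ereal_inf [set (inradius d x (Q x))%:E | x in Oh Om d])%E ->
  Oh Om d x -> 0 <= r0 < C2 -> disc x (r0 * d) `<=` poly_set d x (Q x).
Proof.
move=> hinf xO /andP[r00 r0C].
have : C2 * d <= inradius d x (Q x).
  by rewrite -lee_fin; apply: le_trans hinf _; apply: ereal_inf_lbound; exists x.
move=> le; have lt : r0 * d < inradius d x (Q x).
  by apply: lt_le_trans le; rewrite ltr_pM2r.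
have [|r [_ hr] rr] := sup_gt _ lt.
  exists 0; split=> //; move=> y; rewrite /disc/= => h.
  by have := ed_ge0 x y; rewrite leNgt h.
by move=> y yx; apply: hr; rewrite /disc/=; apply: lt_trans rr.
Qed.

(** The longest side is at most [2 * C1 * d * sin (pi / n)], hence at most [2 * d * (C1 * pi / n)],
    and [n >= c * (d / h)]. So [inscribed_polygon_disc] applies with [S = C1 * pi / c * (h / d)]. *)
Lemma sides_disc (C1 c h r0 : R) x y : 0 < C1 -> 0 < c -> 0 < h -> 0 < r0 ->
  polygon_ok (Q x) -> disc x (r0 * d) `<=` poly_set d x (Q x) ->
  (ereal_sup [set (longest_side d x (Q x) /
     (2 * sin (pi / (sides (Q x))%:R)))%:E | x in Oh Om d] <= (C1 * d)%:E)%E ->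
  ((c * (d / h))%:E <= ereal_inf [set ((sides (Q x))%:R)%:E | x in Oh Om d])%E ->
  Oh Om d x -> ed x y < d * (1 - (C1 * pi / c * (h / d)) ^+ 2) -> poly_set d x (Q x) y.
Proof.
move=> C10 c0 h0 r00 ok hr hsup hmin xO.
apply: (inscribed_polygon_disc d0 _ ok hr); first exact: mulr_gt0.
have [n3 _ _] := ok; set n : R := (sides (Q x))%:R.
have n0 : 3 <= n by rewrite /n ler_nat.
have hn : c * (d / h) <= n.
  by rewrite -lee_fin; apply: le_trans hmin _; apply: ereal_inf_lbound; exists x.
have hl : longest_side d x (Q x) / (2 * sin (pi / n)) <= C1 * d.
  by rewrite -lee_fin; apply: le_trans hsup; apply: ereal_sup_ubound; exists x.
have p0 := pi_gt0 R.
have pn : 0 < pi / n < pi.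
  by rewrite divr_gt0//=; [rewrite ltr_pdivrMr; [rewrite ltr_pMr//; lra|lra]|lra].
have s0 : 0 < sin (pi / n) by exact: sin_gt0_pi.
move: hl; rewrite ler_pdivrMr; last by rewrite mulr_gt0.
move=> /le_trans; apply.
have s1 : sin (pi / n) <= pi / n by apply: sin_le; case/andP: pn => /ltW.
have e : pi / n <= pi / c * (h / d).
  have cdh : 0 < c * (d / h) by rewrite mulr_gt0// divr_gt0.
  have -> : pi / c * (h / d) = pi / (c * (d / h)) :> R.
    by move: (pi : R) => p; field; rewrite !gt_eqF.
  by rewrite ler_pM2l// lef_pV2 ?posrE//; exact: lt_le_trans hn.
apply: (@le_trans _ _ (C1 * d * (2 * (pi / c * (h / d))))).
  rewrite ler_pM2l; last exact: mulr_gt0.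
  by rewrite ler_pM2l//; exact: le_trans e.
rewrite le_eqVlt; apply/orP; left; apply/eqP.
move: (pi : R) p0 => p p0 {e pn s0 s1}; field.
by rewrite !gt_eqF.
Qed.

Hypothesis d1 : d <= 1.
Hypothesis kc : kernel_conditions d gam gt g.
Hypothesis mQ : measurable ([set z | Oh Om d z.1 /\ poly_set d z.1 (Q z.1) z.2]
                : set (PP * PP)).

Lemma supnorm_le (D : set P) (v : P -> R) (c : R) x :
  (supnorm D v <= c%:E)%E -> D x -> `|v x| <= c.
Proof.
move=> h xD; rewrite -lee_fin; apply: le_trans h.
by apply: ereal_sup_ubound; exists x.
Qed.

Lemma Oh_measurable_Cb4 n delta (u : P -> R) : Cb n (Oh Om delta) u ->
  measurable_fun (Oh Om delta : set PP) (u : PP -> R).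
Proof.
move=> Cu; apply: continuous_within_measurable_plane; first exact: measurable_Oh.
by case: n Cu => [|n] [].
Qed.

(** Since [ut] extends [u0], the residual is the sum of [f - f0] and of [Lop ut - laplacian ut], the
    latter being the truncation error with [tau = 1 - s ^+ 2]. The symmetrized kernel is full only
    where each point lies in the polygon of the other, which is why [polyd] ranges over all of
    [Oh Om d]. *)
Lemma nonlocal_consistency (delta M K G Cf s : R) (lambda : nat)
    (f f0 g0 u0 ut : P -> R) :
  d <= delta -> 0 <= M -> Cb 4 (Oh Om delta) ut ->
  (forall x, Oh Om delta x -> exists c : nat -> R, forall a b : R,
    (forall s t : R, `|s| <= `|a| -> `|t| <= `|b| -> Oh Om delta (x.1 + s, x.2 + t)) ->
    `|ut (x.1 + a, x.2 + b) - ut x| <= M * (`|a| + `|b|) /\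
    `|ut (x.1 + a, x.2 + b) - ut x -
        (a ^+ 2 / 2 * 'D_e1 ('D_e1 ut) x + b ^+ 2 / 2 * 'D_e2 ('D_e2 ut) x) -
        a * (c 0%N + c 1%N * b + c 2%N * b ^+ 2 + c 3%N * a ^+ 2) -
        b * (c 4%N + c 5%N * b ^+ 2 + c 6%N * a ^+ 2)| <= 5 * M * (a ^+ 2 + b ^+ 2) ^+ 2) ->
  local_solution Om f0 g0 u0 -> (forall x, Om x -> ut x = u0 x) ->
  (Gker Om d gam <= G%:E)%E -> (supnorm Om (f \- f0)%R <= (Cf * d ^+ 2)%:E)%E ->
  0 <= s -> s ^+ 2 <= 2^-1 -> `|Phi g 1 - Phi g (1 - s ^+ 2)| <= K * s ^+ lambda ->
  (forall x y, Oh Om d x -> ed x y < d * (1 - s ^+ 2) -> poly_set d x (Q x) y) ->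
  forall x, Om x ->
  `|f x + Lop d gam Q ut x| <= (Cf + 20 * M) * d ^+ 2 + 16 * M / d * (K * s ^+ lambda).
Proof.
move=> ddelta M0 Cut taylor [loc _] ext hG hf s0 s2 hPhi polyd x xO.
have xcl : closure Om x by exact: subset_closure.
have xOh : Oh Om delta x by left.
have dOh : disc x d `<=` Oh Om delta.
  by move=> y /(disc_sub_Oh hOm xcl); exact: Oh_mono.
have mut : measurable_fun setT (ut \_ (Oh Om delta) : PP -> R).
  apply: (measurable_restrictT _ _).1; first exact: measurable_Oh.
  exact: Oh_measurable_Cb4 Cut.
have [c Hc] := taylor x xOh.
have sq0 := sqr_ge0 s.
have tau01 : 2^-1 <= 1 - s ^+ 2 <= 1 by apply/andP; split; lra.
have tp y : ed x y < (1 - s ^+ 2) * d ->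
    poly_set d x (Q x) y /\ poly_set d y (Q y) x.
  move=> xy; have xy' : ed x y < d.
    by apply: lt_le_trans xy _; rewrite ler_piMl ?(ltW d0)//; case/andP: tau01.
  rewrite mulrC in xy; split; apply: polyd => //; first by left.
    by apply: (disc_sub_Oh hOm xcl).
  by rewrite edC.
have tt a b : enorm (a, b) < d ->
    `|ut (x.1 + a, x.2 + b) - ut x| <= M * (`|a| + `|b|) /\
    `|ut (x.1 + a, x.2 + b) - ut x -
        (a ^+ 2 / 2 * 'D_e1 ('D_e1 ut) x + b ^+ 2 / 2 * 'D_e2 ('D_e2 ut) x) -
        a * (c 0%N + c 1%N * b + c 2%N * b ^+ 2 + c 3%N * a ^+ 2) -
        b * (c 4%N + c 5%N * b ^+ 2 + c 6%N * a ^+ 2)| <= 5 * M * (a ^+ 2 + b ^+ 2) ^+ 2.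
  move=> ab; apply: Hc => s' t' sa tb; apply: dOh; rewrite /disc/= edE.
  apply: le_lt_trans ab; rewrite /enorm/= ler_sqrt ?addr_ge0 ?sqr_ge0//.
  rewrite !(addrC x.1) !(addrC x.2) !addrK.
  by apply: lerD; rewrite -[leLHS]real_normK ?num_real// -[leRHS]real_normK ?num_real// ler_sqr ?nnegrE.
have := @truncation_error R Om d gam gt g Q hOm d0 d1 kc mQ G M (1 - s ^+ 2)
  ('D_e1 ('D_e1 ut) x) ('D_e2 ('D_e2 ut) x) ut (Oh Om delta) x c xO M0 hG mut dOh tau01 tp tt.
have -> : 'D_e1 ('D_e1 ut) x + 'D_e2 ('D_e2 ut) x = laplacian ut x by [].
rewrite (eq_laplacian (polygon_open hOm) ext xO) (_ : laplacian u0 x = - f0 x); last by rewrite -(loc x xO) opprK.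
rewrite opprK (Phi1 d0 kc) in hPhi *.
have hfx := supnorm_le hf xO.
move=> h; apply: (@le_trans _ _ (`|f x - f0 x| + `|Lop d gam Q ut x + f0 x|)).
  by rewrite (_ : f x + _ = f x - f0 x + (Lop d gam Q ut x + f0 x)) ?ler_normD//; ring.
have hP : 1 - Phi g (1 - s ^+ 2) <= K * s ^+ lambda by apply: le_trans hPhi; exact: ler_norm.
have hM : 16 * M / d * (1 - Phi g (1 - s ^+ 2)) <= 16 * M / d * (K * s ^+ lambda).
  by rewrite ler_wpM2l// divr_ge0 ?(ltW d0)// mulr_ge0.
rewrite mulrDl -addrA; apply: lerD => //; apply: le_trans h _.
by rewrite lerD2l.
Qed.

End consistency.

(** * Comparison of the error terms with the rate *)

Section rate.
Context {R : realType}.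
Variables (d h : R) (mu lambda : nat).
Hypothesis d01 : 0 < d <= 1.
Hypothesis h0 : 0 < h.
Hypothesis mu1 : (mu <= 1)%N.

Definition rate : R := d `^ ((3 + mu%:R) / 2) + d^-1 * h ^+ 2
                + d ^- lambda.+1 * h ^+ lambda.

Let dp : 0 < d. Proof. by case/andP: d01. Qed.
Let t2 : 0 <= d^-1 * h ^+ 2.
Proof. by rewrite mulr_ge0 ?invr_ge0 ?sqr_ge0// ltW. Qed.
Let t3 : 0 <= d ^- lambda.+1 * h ^+ lambda.
Proof. by rewrite mulr_ge0 ?invr_ge0 ?exprn_ge0// ltW. Qed.
Let t1 : 0 <= d `^ ((3 + mu%:R) / 2) := powR_ge0 _ _.

Lemma rate_ge0 : 0 <= rate.
Proof. by rewrite !addr_ge0. Qed.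

(** Because [(3 + mu) / 2 <= 2] and [d <= 1]. *)
Lemma sqr_horizon_le_rate : d ^+ 2 <= rate.
Proof.
have : d ^+ 2 <= d `^ ((3 + mu%:R) / 2).
  rewrite -powR_mulrn ?(ltW dp)//; apply: ger_powR => //.
  rewrite ler_pdivrMr// -natrD -natrM ler_nat.
  by move: mu1; case: mu => [|[|]].
by move: t2 t3; rewrite /rate; lra.
Qed.

Lemma conformity_le_rate : d ^- lambda.+1 * h ^+ lambda <= rate.
Proof. by move: t1 t2; rewrite /rate; lra. Qed.

Lemma interpolation_le_rate : d^-1 * h ^+ 2 <= rate.
Proof. by move: t1 t3; rewrite /rate; lra. Qed.

(** The left side is the order of the strip energy, [d ^- 2 * d ^+ (4 + 2 * mu) * d]. The first term
    of the rate has square [d ^+ (3 + mu)], which is no smaller as [d <= 1]. *)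
Lemma boundary_le_rate : d ^+ (3 + 2 * mu) <= rate ^+ 2.
Proof.
apply: (@le_trans _ _ ((d `^ ((3 + mu%:R) / 2)) ^+ 2)).
  rewrite -(powR_mulrn 2) ?powR_ge0// -powRrM divfK// -natrD powR_mulrn ?(ltW dp)//.
  by apply: ler_wiXn2l; [exact: ltW|case/andP: d01|rewrite leq_add2l leq_pmull].
rewrite ler_sqr ?nnegrE ?rate_ge0//.
by move: t2 t3; rewrite /rate; lra.
Qed.

(** The energy bound with [G = CG * d ^- 2], [E = Cg * d ^+ (2 + mu)], [I = 4 * M * h ^+ 2],
    [H = Ch * h ^+ 2] and [Ac = CA * d]. In the terms with [H] the factor [d] coming from the area
    of the strip is given up. *)
Lemma energy_bound_le_rate (A CA CG Cg Ch M KF F cP : R) :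
  0 <= A -> 0 <= CA -> 0 <= CG -> 0 < cP -> 0 <= F -> F <= KF * rate ->
  4 * F ^+ 2 * A / cP + 32 * (CG * d ^- 2) * (Cg * d ^+ (2 + mu)) ^+ 2 * (CA * d)
    + 16 * (CG * d ^- 2) * (4 * M * h ^+ 2) ^+ 2 * A
    + 16 * (CG * d ^- 2) * (Ch * h ^+ 2) ^+ 2 * (CA * d) <=
  (4 * KF ^+ 2 * A / cP + 32 * CG * Cg ^+ 2 * CA + 256 * CG * M ^+ 2 * A
    + 16 * CG * Ch ^+ 2 * CA) * rate ^+ 2 /\
  8 * (CG * d ^- 2) * (Ch * h ^+ 2) ^+ 2 * (CA * d) <= 8 * CG * Ch ^+ 2 * CA * rate ^+ 2.
Proof.
move=> A0 CA0 CG0 cP0 F0 FK; have r0 := rate_ge0.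
have pos (n X Z : R) : 0 <= n -> 0 <= Z -> 0 <= n * CG * X ^+ 2 * Z.
  by move=> n0 Z0; apply: mulr_ge0 => //; apply: mulr_ge0; [exact: mulr_ge0|exact: sqr_ge0].
have b1 : F ^+ 2 <= KF ^+ 2 * rate ^+ 2.
  by rewrite -exprMn ler_sqr ?nnegrE// (le_trans F0).
have b2 := boundary_le_rate.
have b3 : (d^-1 * h ^+ 2) ^+ 2 <= rate ^+ 2.
  by rewrite ler_sqr ?nnegrE// interpolation_le_rate.
have b4 : d * (d^-1 * h ^+ 2) ^+ 2 <= rate ^+ 2.
  by apply: le_trans b3; rewrite ler_piMl ?sqr_ge0//; case/andP: d01.
have e1 : 4 * F ^+ 2 * A / cP <= 4 * KF ^+ 2 * A / cP * rate ^+ 2.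
  have -> : 4 * F ^+ 2 * A / cP = 4 * A / cP * F ^+ 2 by ring.
  have -> : 4 * KF ^+ 2 * A / cP * rate ^+ 2 = 4 * A / cP * (KF ^+ 2 * rate ^+ 2) by ring.
  by rewrite ler_wpM2l// divr_ge0 ?(ltW cP0)// mulr_ge0.
have e2 : 32 * (CG * d ^- 2) * (Cg * d ^+ (2 + mu)) ^+ 2 * (CA * d) <=
    32 * CG * Cg ^+ 2 * CA * rate ^+ 2.
  have -> : 32 * (CG * d ^- 2) * (Cg * d ^+ (2 + mu)) ^+ 2 * (CA * d) =
      32 * CG * Cg ^+ 2 * CA * d ^+ (3 + 2 * mu).
    rewrite mul2n -addnn !exprD; move: (d ^+ mu) => dm.
    by field; rewrite gt_eqF.
  by apply: ler_wpM2l; [exact: (pos 32 Cg CA (ler0n _ 32) CA0)|exact: b2].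
have e3 : 16 * (CG * d ^- 2) * (4 * M * h ^+ 2) ^+ 2 * A <= 256 * CG * M ^+ 2 * A * rate ^+ 2.
  have -> : 16 * (CG * d ^- 2) * (4 * M * h ^+ 2) ^+ 2 * A =
      256 * CG * M ^+ 2 * A * (d^-1 * h ^+ 2) ^+ 2 by field; rewrite gt_eqF.
  by apply: ler_wpM2l; [exact: (pos 256 M A (ler0n _ 256) A0)|exact: b3].
have e4 : (CG * d ^- 2) * (Ch * h ^+ 2) ^+ 2 * (CA * d) <= CG * Ch ^+ 2 * CA * rate ^+ 2.
  have -> : (CG * d ^- 2) * (Ch * h ^+ 2) ^+ 2 * (CA * d) =
      CG * Ch ^+ 2 * CA * (d * (d^-1 * h ^+ 2) ^+ 2) by field; rewrite gt_eqF.
  by rewrite ler_wpM2l//; have := pos 1 Ch CA ler01 CA0; rewrite mul1r.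
have e5 (n : R) : 0 <= n -> n * (CG * d ^- 2) * (Ch * h ^+ 2) ^+ 2 * (CA * d) <=
    n * CG * Ch ^+ 2 * CA * rate ^+ 2.
  by move=> n0; rewrite -!mulrA ler_wpM2l// !mulrA; move: e4; rewrite !mulrA.
split; last exact: e5.
by rewrite 3!(mulrDl _ _ (rate ^+ 2)); apply: lerD; [apply: lerD; [exact: lerD|]|exact: e5].
Qed.

End rate.

(** * The estimate for one horizon and one mesh *)

Section horizon_estimate.
Context {R : realType}.
Local Notation P := (R * R)%type.
Local Notation PP := (plane R).

(** The constant is at least 1, hence at most its own square; so an expression linear in [Kb]
    dominates both bounds after squaring, without square roots. *)
Lemma half_rate_le (Kb cP b r e : R) : 0 <= Kb -> 0 < cP -> 0 <= r -> 0 <= e ->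
  b <= Kb * r ^+ 2 -> e <= Kb * r ^+ 2 ->
  2 * b <= ((1 + 4 * Kb + 4 * Kb / cP) * r) ^+ 2 /\
  (2 * b + e) / cP <= ((1 + 4 * Kb + 4 * Kb / cP) * r) ^+ 2.
Proof.
move=> Kb0 cP0 r0 e0 hb he.
have q0 : 0 <= 4 * Kb / cP by rewrite divr_ge0 ?(ltW cP0)// mulr_ge0.
set X := 1 + 4 * Kb + 4 * Kb / cP.
have X1 : 1 <= X by rewrite /X; lra.
have R0 := sqr_ge0 r.
have XX : X * r ^+ 2 <= (X * r) ^+ 2.
  by rewrite exprMn ler_wpM2r// expr2 ler_peMl//; lra.
have k0 : 0 <= Kb * r ^+ 2 by exact: mulr_ge0.
have k1 : 0 <= 4 * Kb / cP * r ^+ 2 by exact: mulr_ge0.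
split; apply: le_trans XX; rewrite /X !mulrDl mul1r -?(mulrA 4 Kb (r ^+ 2)); last first.
  have : (2 * b + e) / cP <= 4 * Kb / cP * r ^+ 2.
    by rewrite ler_pdivrMr// mulrAC divfK ?gt_eqF// -mulrA; lra.
  lra.
lra.
Qed.

Variables (Om : set P) (d h : R) (gam : P -> P -> R) (gt g : R -> R).
Variable (Q : P -> @polygon R).
Hypothesis hOm : open_polygon Om.
Hypothesis d0 : 0 < d.
Hypothesis d1 : d <= 1.
Hypothesis h0 : 0 < h.
Hypothesis hd : h < d.
Hypothesis kc : kernel_conditions d gam gt g.
Hypothesis mQ : measurable ([set z | Oh Om d z.1 /\ poly_set d z.1 (Q z.1) z.2]
                : set (PP * PP)).
Hypothesis Qok : forall x, Oh Om d x -> polygon_ok (Q x).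

Variables (f f0 g0 gD u0 ut u u0h gh : P -> R) (T : set (P * P * P)).
Variables (delta kappa CG Cf Cg Ch C1 C2 c A CA D M K : R) (mu lambda : nat).
Hypothesis d2 : 2 * d <= delta.
Hypothesis (CG0 : 0 <= CG) (Cf0 : 0 <= Cf) (CA0 : 0 <= CA) (M0 : 0 <= M) (K0 : 0 <= K).
Hypothesis (C10 : 0 < C1) (C20 : 0 < C2) (c0 : 0 < c) (D1 : 1 <= D).
Hypothesis hG : (Gker Om d gam <= (CG * d ^- 2)%:E)%E.
Hypothesis hut : Cb 4 (Oh Om delta) ut.
Hypothesis taylor : forall x, Oh Om delta x ->
  [/\ `|ut x| <= M, `|laplacian ut x| <= M
    & exists c : nat -> R, forall a b : R,
      (forall s t : R, `|s| <= `|a| -> `|t| <= `|b| -> Oh Om delta (x.1 + s, x.2 + t)) ->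
      [/\ `|ut (x.1 + a, x.2 + b) - ut x| <= M * (`|a| + `|b|),
          `|ut (x.1 + a, x.2 + b) - ut x - a * 'D_e1 ut x - b * 'D_e2 ut x| <=
            2 * M * (a ^+ 2 + b ^+ 2)
        & `|ut (x.1 + a, x.2 + b) - ut x -
            (a ^+ 2 / 2 * 'D_e1 ('D_e1 ut) x + b ^+ 2 / 2 * 'D_e2 ('D_e2 ut) x) -
            a * (c 0%N + c 1%N * b + c 2%N * b ^+ 2 + c 3%N * a ^+ 2) -
            b * (c 4%N + c 5%N * b ^+ 2 + c 6%N * a ^+ 2)| <=
          5 * M * (a ^+ 2 + b ^+ 2) ^+ 2]].
Hypothesis hloc : local_solution Om f0 g0 u0.
Hypothesis hext : forall x, Om x -> ut x = u0 x.
Hypothesis mf : measurable_fun (Om : set PP) (f : PP -> R).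
Hypothesis hf : (supnorm Om (f \- f0)%R <= (Cf * d ^+ 2)%:E)%E.
Hypothesis hgD : (supnorm (Oc Om d) (gD \- ut)%R <= (Cg * d ^+ (2 + mu))%:E)%E.
Hypothesis mu1 : (mu <= 1)%N.
Hypothesis hgh : (supnorm (Oc Om d) (gD \- gh)%R <= (Ch * h ^+ 2)%:E)%E.
Hypothesis OmD : forall x, Om x -> `|x.1| < D.
Hypothesis AE : leb2 (Om : set PP) = A%:E.
Hypothesis leAc : (leb2 (Oc Om d : set PP) <= (CA * d)%:E)%E.
Hypothesis hsup : (ereal_sup [set (longest_side d x (Q x) /
     (2 * sin (pi / (sides (Q x))%:R)))%:E | x in Oh Om d] <= (C1 * d)%:E)%E.
Hypothesis hinf : ((C2 * d)%:E <= ereal_inf [set (inradius d x (Q x))%:E | x in Oh Om d])%E.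
Hypothesis hmin :
  ((c * (d / h))%:E <= ereal_inf [set ((sides (Q x))%:R)%:E | x in Oh Om d])%E.
Local Notation s := (C1 * pi / c * (h / d)).
Hypothesis hs : s ^+ 2 <= 2^-1.
Hypothesis hPhi : `|Phi g 1 - Phi g (1 - s ^+ 2)| <= K * s ^+ lambda.
Hypothesis kappa0 : 0 < kappa.
Hypothesis hT : triangulation Om d T.
Hypothesis hmesh : mesh_size T = h.
Hypothesis hqu : quasi_uniform kappa T.
Hypothesis Vgh : Vc Om d T gh.
Hypothesis sol : nonlocal_solution Om d gam Q f gD u.
Hypothesis cdg : cdg_solution Om d gam Q T f gh u0h.

(** Half of [C2] leaves room for the strict inequality of [inradius_disc]; the cap [1 / 2] keeps
    [r0 * d] within the horizon. *)
Local Notation r0 := (Num.min (C2 / 2) 2^-1).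
Local Notation cP := (Phi g r0 / (16 * D ^+ 2)).
Local Notation KF := (Cf + 20 * M + 16 * M * K * (C1 * pi / c) ^+ lambda).
Local Notation Kb := (4 * KF ^+ 2 * A / cP + 32 * CG * Cg ^+ 2 * CA + 256 * CG * M ^+ 2 * A
    + 16 * CG * Ch ^+ 2 * CA).
Local Notation rt := (rate d h mu lambda).

Let r00 : 0 < r0 <= 1.
Proof.
apply/andP; split; first by rewrite lt_min divr_gt0//= invr_gt0.
by rewrite ge_min; apply/orP; right; lra.
Qed.

Let inner_disc x : Oh Om d x -> disc x (r0 * d) `<=` poly_set d x (Q x).
Proof.
move=> xO; apply: (inradius_disc d0 hinf) => //.
case/andP: r00 => /ltW -> _ /=; rewrite gt_min; apply/orP; left.
by rewrite ltr_pdivrMr// ltr_pMr// ltr1n.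
Qed.

Let large_disc x y : Oh Om d x -> ed x y < d * (1 - s ^+ 2) -> poly_set d x (Q x) y.
Proof.
move=> xO; have [rp _] := andP r00.
exact: (sides_disc d0 C10 c0 h0 rp (Qok xO) (inner_disc xO) hsup hmin xO).
Qed.

Let s0 : 0 <= s.
Proof.
by apply: mulr_ge0; apply: divr_ge0; rewrite ?ltW// mulr_gt0// pi_gt0.
Qed.

Let F := (Cf + 20 * M) * d ^+ 2 + 16 * M / d * (K * s ^+ lambda).

Let residual x : Om x -> `|f x + Lop d gam Q ut x| <= F.
Proof.
apply: (nonlocal_consistency hOm d0 d1 kc mQ _ M0 hut _ hloc hext hG hf s0 hs hPhi).
- by apply: le_trans d2; rewrite ler_peMl ?(ltW d0)// ler1n.
- move=> y /taylor[_ _ [cc Hcc]]; exists cc => a b /Hcc[h1 _ h3].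
  by split; [exact: h1|exact: h3].
- exact: large_disc.
Qed.

Let F_ge0 : 0 <= F.
Proof.
rewrite /F; apply: addr_ge0; first by rewrite mulr_ge0 ?sqr_ge0// addr_ge0// mulr_ge0.
apply: mulr_ge0; first by rewrite divr_ge0 ?(ltW d0)// mulr_ge0.
by rewrite mulr_ge0// exprn_ge0.
Qed.

Let F_le : F <= KF * rt.
Proof.
have d01 : 0 < d <= 1 by rewrite d0.
have h1 := @sqr_horizon_le_rate R d h mu lambda d01 h0 mu1.
have h2 := @conformity_le_rate R d h mu lambda d01.
have -> : F = (Cf + 20 * M) * d ^+ 2 +
    16 * M * K * (C1 * pi / c) ^+ lambda * (d ^- lambda.+1 * h ^+ lambda).
  rewrite /F exprMn (expr_div_n h) (exprSr d lambda) (invfM (d ^+ lambda)).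
  by move: (_ ^+ lambda) (h ^+ lambda) ((d ^+ lambda)^-1) => a b e; ring.
rewrite [leRHS]mulrDl; apply: lerD.
  by rewrite ler_wpM2l// addr_ge0// mulr_ge0.
rewrite ler_wpM2l// mulr_ge0//; first by rewrite mulr_ge0// mulr_ge0.
by apply: exprn_ge0; apply: divr_ge0; rewrite ?ltW// mulr_gt0// pi_gt0.
Qed.

Let iut : sqintegrable (@leb2s R) (glued Om d ut ut).
Proof.
have mOh : measurable (Oh Om d : set PP) by exact: measurable_Oh.
have ddelta : Oh Om d `<=` Oh Om delta.
  by apply: Oh_mono => //; apply: le_trans d2; rewrite ler_peMl ?(ltW d0)// ler1n.
rewrite (_ : glued Om d ut ut = ut \_ (Oh Om d)).
  apply: (sqintegrable_bounded (M := M) mOh _ _ _).1.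
  - apply: measurable_funS (Oh_measurable_Cb4 hOm hut) => //; exact: measurable_Oh.
  - by apply: leb2_Oh_fin => //; rewrite d0.
  - by move=> x /ddelta/taylor[].
apply/funext => x; rewrite [RHS]patchE; case: ifPn => [/set_mem[xO|xO]|/negP xO].
- by rewrite glued_Om.
- by rewrite glued_Oc.
- by rewrite glued_out// => /mem_set.
Qed.

Let interpolant : exists2 w, V0 Om T w & forall x, Om x -> `|ut x - w x| <= 4 * M * h ^+ 2.
Proof.
have M20 : 0 <= 2 * M by exact: mulr_ge0.
have [|w Vw hw] := @V0_interpolant R Om d h kappa (2 * M) T ut h0 kappa0 M20 hT hmesh hqu.
- move=> p pcl.
  (* A box of half-side [h < d] lies in the disc of radius [2 * d], which is why [2 * d <= delta] is
     assumed. *)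
  have box s' t' : `|s'| <= h -> `|t'| <= h -> Oh Om delta (p.1 + s', p.2 + t').
    move=> hs' ht'; apply: (Oh_mono hOm d2); apply: (disc_sub_Oh hOm pcl).
    rewrite /disc/=; apply: le_lt_trans (ed_le_norm _ _) _ => /=.
    by rewrite !(addrC p.1) !(addrC p.2) !addrK; move: hs' ht' hd; lra.
  have pO : Oh Om delta p.
    by have := box 0 0; rewrite !normr0 !addr0 -surjective_pairing; apply; exact: ltW.
  have [_ _ [cc Hcc]] := taylor pO.
  exists ('D_e1 ut p), ('D_e2 ut p) => a b ah bh.
  by have [|_ h2 _] := Hcc a b; [move=> s' t' hs' ht'; apply: box; [exact: le_trans ah|exact: le_trans bh]|].
exists w => // x xO; rewrite distrC; apply: le_trans (hw x (subset_closure xO)) _.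
by rewrite mulrA -natrM.
Qed.

(** [C] involves neither [d] nor [h]: in particular [cP] depends only on the rescaled profile, on
    [C2] and on the width [D] of the domain. *)
Lemma horizon_estimate (err := u \- (u0h \+ gh)) (C := 1 + 4 * Kb + 4 * Kb / cP) :
  (energy_norm Om d gam Q err <= (C * rt)%:E)%E /\
  (L2norm Om err <= (C * rt)%:E)%E.
Proof.
have d01 : 0 < d <= 1 by rewrite d0.
have A0 : 0 <= A by rewrite -lee_fin -AE.
have cP0 : 0 < cP := poincare_const_gt0 d0 kc D1 r00.
have G0 : 0 <= CG * d ^- 2 by rewrite mulr_ge0// invr_ge0 sqr_ge0.
have [w Vw leI] := interpolant.
have leE x : Oc Om d x -> `|u x - ut x| <= Cg * d ^+ (2 + mu).
  by move=> xO; have [_ _ _ ->//] := sol; exact: (supnorm_le hgD xO).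
have leH x : Oc Om d x -> `|u x - gh x| <= Ch * h ^+ 2.
  by move=> xO; have [_ _ _ ->//] := sol; exact: (supnorm_le hgh xO).
have [b1 b2] := @energy_bound_le_rate R d h mu lambda d01 h0
  A CA CG Cg Ch M KF F cP A0 CA0 CG0 cP0 F_ge0 F_le.
have r_ge0 : 0 <= rt by exact: rate_ge0.
have p1 : 0 <= CG * Ch ^+ 2 * CA by rewrite mulr_ge0// mulr_ge0// sqr_ge0.
have p2 : 0 <= CG * Cg ^+ 2 * CA by rewrite mulr_ge0// mulr_ge0// sqr_ge0.
have p3 : 0 <= CG * M ^+ 2 * A by rewrite mulr_ge0// mulr_ge0// sqr_ge0.
have p4 : 0 <= 4 * KF ^+ 2 * A / cP.
  by rewrite divr_ge0 ?(ltW cP0)// mulr_ge0// mulr_ge0// sqr_ge0.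
have Kb8 : 8 * CG * Ch ^+ 2 * CA <= Kb by move: p1 p2 p3 p4; lra.
have Kb0 : 0 <= Kb by move: p1 p2 p3 p4; lra.
have e0 : 0 <= 8 * (CG * d ^- 2) * (Ch * h ^+ 2) ^+ 2 * (CA * d).
  apply: mulr_ge0; last by rewrite mulr_ge0// ltW.
  by apply: mulr_ge0; [exact: mulr_ge0|exact: sqr_ge0].
have b3 := le_trans b2 (ler_wpM2r (sqr_ge0 rt) Kb8).
have [h1 h2] := half_rate_le Kb0 cP0 r_ge0 e0 b1 b3.
have C0 : 0 <= C * rt.
  apply: mulr_ge0 => //; rewrite /C.
  apply: addr_ge0; last by apply: divr_ge0; [exact: mulr_ge0|exact: ltW].
  exact: addr_ge0 ler01 (mulr_ge0 (ler0n R 4) Kb0).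
have inner x y : Oh Om d x -> ed x y < r0 * d -> poly_set d x (Q x) y.
  by move=> xO; exact: (inner_disc xO).
split.
  exact: (energy_norm_error hOm d0 d1 kc mQ G0 hG D1 OmD r00 inner
    mf sol Vgh cdg Vw iut F_ge0 residual leE leI leH AE leAc C0 h1).
exact: (L2_error hOm d0 d1 kc mQ G0 hG D1 OmD r00 inner
  mf sol Vgh cdg Vw iut F_ge0 residual leE leI leH AE leAc C0 h2).
Qed.

End horizon_estimate.

(** * Uniformity over small horizons and admissible mesh sizes *)

Theorem theorem3p5 (R : realType) (Om : set (R * R)) (hOm : open_polygon Om)
  (* local problem and extension of its solution *)
  (f0 g0 u0 ut0 : R * R -> R) (hu0 : Cb 4 Om u0)
  (hloc : local_solution Om f0 g0 u0)
  (delta0 : R) (hdelta0 : 0 < delta0)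
  (hut0 : Cb 4 (Oh Om delta0) ut0) (hext : forall x, Om x -> ut0 x = u0 x)
  (* kernels *)
  (gam : R -> R * R -> R * R -> R) (gt : R -> R -> R) (g : R -> R)
  (hg : forall r : R, 0 < r < 1 -> 0 <= g r)
  (hgam : forall d : R, 0 < d -> kernel_conditions d (gam d) (gt d) g)
  (hG : exists C : R,
     \forall d \near 0^'+, (Gker Om d (gam d) <= (C * d ^- 2)%:E)%E)
  (dPhi ddPhi : R) (hPhi : left_derivatives_at1 (Phi g) dPhi ddPhi)
  (lambda : nat)
  (hlambda : (dPhi != 0 /\ lambda = 2%N) \/
             [/\ dPhi = 0, ddPhi != 0 & lambda = 4%N])
  (* data *)
  (mu : nat) (hmu : mu = 0%N \/ mu = 1%N)
  (f gD : R -> R * R -> R)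
  (hfm : forall d : R, 0 < d -> measurable_fun (Om : set (plane R)) (f d : plane R -> R))
  (hf : exists C : R,
     \forall d \near 0^'+, (supnorm Om (f d \- f0)%R <= (C * d ^+ 2)%:E)%E)
  (hgD : exists C : R,
     \forall d \near 0^'+,
       (supnorm (Oc Om d) (gD d \- ut0)%R <= (C * d ^+ (2 + mu))%:E)%E)
  (* polygons *)
  (Q : R -> R * R -> @polygon R)
  (hQ : polygon_family Om Q) (hwqu : weakly_quasi_uniform Om Q)
  (hnoo : max_sides Om Q d @[d --> 0^'+] --> +oo%E)
  (hsigma1 : forall x, Om x ->
     `|moment1 Om d (gam d) (Q d) fst x| @[d --> 0^'+] --> (0 : R))
  (hsigma2 : forall x, Om x ->
     `|moment1 Om d (gam d) (Q d) snd x| @[d --> 0^'+] --> (0 : R))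
  (* pairs of horizon and mesh size, meshes *)
  (adm : set (R * R)) (hadm : forall d h : R, adm (d, h) -> 0 < h < d)
  (* n_delta ~ delta / h, the two-sided bound being uniform in x *)
  (hn : exists c C : R, 0 < c /\
     \forall d \near 0^'+, forall h : R, adm (d, h) ->
       ((c * (d / h))%:E <= min_sides Om Q d)%E /\
       (max_sides Om Q d <= (C * (d / h))%:E)%E)
  (T : R -> R -> set ((R * R) * (R * R) * (R * R)))
  (kappa : R) (hkappa : 0 < kappa)
  (hT : forall d h : R, adm (d, h) ->
     [/\ triangulation Om d (T d h), mesh_size (T d h) = h
       & quasi_uniform kappa (T d h)])
  (* nonlocal problem and its CDG approximation *)
  (u : R -> R * R -> R)
  (hu : forall d : R, 0 < d -> nonlocal_solution Om d (gam d) (Q d) (f d) (gD d) (u d))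
  (gh u0h : R -> R -> R * R -> R)
  (hgh : forall d h : R, adm (d, h) -> Vc Om d (T d h) (gh d h))
  (hghC : exists C : R,
     \forall d \near 0^'+, forall h : R, adm (d, h) ->
       (supnorm (Oc Om d) (gD d \- gh d h)%R <= (C * h ^+ 2)%:E)%E)
  (hu0h : forall d h : R, adm (d, h) ->
     cdg_solution Om d (gam d) (Q d) (T d h) (f d) (gh d h) (u0h d h)) :
  exists C : R, \forall d \near 0^'+, forall h : R, adm (d, h) ->
    let err := u d \- (u0h d h \+ gh d h) in
    let rate := d `^ ((3 + mu%:R) / 2) + d^-1 * h ^+ 2
                + d ^- lambda.+1 * h ^+ lambda in
    (energy_norm Om d (gam d) (Q d) err <= (C * rate)%:E)%E /\
    (L2norm Om err <= (C * rate)%:E)%E.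
Proof.
have [D0 D00 HD0] := polygon_strip hOm.
have [CA CA0 HCA] := leb2_Oc_le hOm.
have [M M0 taylor] := Cb4_taylor hut0.
case: hwqu => C1 [C2 [C10 C20 hw]].
case: hn => c [Cn [c0 hnC]].
have [K [eta [K0 eta0 HK]]] := left_remainder hPhi hlambda.
case: hG hf hgD hghC => CG hG' [Cf hf'] [Cg hgD'] [Ch hghC'].
have mu1 : (mu <= 1)%N by case: hmu => ->.
have AE : leb2 (Om : set (plane R)) = (fine (leb2 (Om : set (plane R))))%:E.
  by rewrite fineK// ge0_fin_numE//; exact: leb2_Om_fin.
set A := fine _ in AE.
have D1 : 1 <= D0 + 1 by rewrite lerDr ltW.
have OmD x : Om x -> `|x.1| < D0 + 1 by move=> /HD0[h1 _]; apply: lt_trans h1 _; rewrite ltrDl.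
pose K2 : R := C1 * pi / c.
have K20 : 0 < K2 by rewrite divr_gt0// mulr_gt0// pi_gt0.
(* Bound to be imposed on [K2 * (h / d)]: its square is at most [1 / 2], as the truncation estimate
   requires, and below [eta], as the expansion of [Phi g] at 1 requires. *)
pose s1 : R := Num.min 1 eta / 2.
have s10 : 0 < s1 by rewrite divr_gt0// lt_min ltr01.
have s12 : s1 <= 2^-1 by rewrite /s1 ler_pdivrMr// mulVf// ge_min lexx.
have s1e : s1 ^+ 2 < eta.
  have : s1 < eta.
    by rewrite /s1 ltr_pdivrMr// gt_min; apply/orP; right; rewrite ltr_pMr// ltr1n.
  apply: le_lt_trans; rewrite expr2 ler_piMl ?(ltW s10)//; apply: le_trans s12 _.
  by rewrite invf_le1// ler1n.
(* Positive upper bound for [Cn], whose sign is not known. *)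
pose Cn1 : R := `|Cn| + 1.
have Cn10 : 0 < Cn1 by rewrite /Cn1 ltr_wpDl.
(* The constants of the asymptotic hypotheses may be negative; absolute values make them admissible
   for the estimate at a fixed horizon. *)
have le_abs (z : \bar R) (a b : R) : 0 <= b -> (z <= (a * b)%:E)%E -> (z <= (`|a| * b)%:E)%E.
  move=> b0 /le_trans; apply; rewrite lee_fin ler_wpM2r//; exact: ler_norm.
pose cP : R := Phi g (Num.min (C2 / 2) 2^-1) / (16 * (D0 + 1) ^+ 2).
pose KF : R := `|Cf| + 20 * M + 16 * M * K * K2 ^+ lambda.
pose Kb : R := 4 * KF ^+ 2 * A / cP + 32 * `|CG| * `|Cg| ^+ 2 * CA
  + 256 * `|CG| * M ^+ 2 * A + 16 * `|CG| * `|Ch| ^+ 2 * CA.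
exists (1 + 4 * Kb + 4 * Kb / cP); near=> d.
move=> h dh.
have d0 : 0 < d by near: d; exact: nbhs_right_gt.
have d1 : d <= 1 by near: d; exact: nbhs_right_le.
have d2 : 2 * d <= delta0.
  have : d <= delta0 / 2 by near: d; apply: nbhs_right_le; rewrite divr_gt0.
  by rewrite ler_pdivlMr// mulrC.
have kc := hgam d d0.
have [Qok mQ] := hQ d d0.
have /andP[h0 hd] := hadm d h dh.
have [hT1 hT2 hT3] := hT d h dh.
have [hsup hinf] := hw d d0.
have hGd : (Gker Om d (gam d) <= (`|CG| * d ^- 2)%:E)%E.
  apply: le_abs; first by rewrite invr_ge0 sqr_ge0.
  by near: d; exact: hG'.
have hfd : (supnorm Om (f d \- f0)%R <= (`|Cf| * d ^+ 2)%:E)%E.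
  by apply: le_abs; rewrite ?sqr_ge0//; near: d; exact: hf'.
have hgDd : (supnorm (Oc Om d) (gD d \- ut0)%R <= (`|Cg| * d ^+ (2 + mu))%:E)%E.
  apply: le_abs; first by rewrite exprn_ge0// ltW.
  by near: d; exact: hgD'.
have hghd : (supnorm (Oc Om d) (gD d \- gh d h)%R <= (`|Ch| * h ^+ 2)%:E)%E.
  apply: le_abs; first by rewrite sqr_ge0.
  by move: h dh {h0 hd hT1 hT2 hT3}; near: d; exact: hghC'.
have [hmin hmax] : ((c * (d / h))%:E <= min_sides Om Q d)%E /\
       (max_sides Om Q d <= (Cn * (d / h))%:E)%E.
  by move: h dh {h0 hd hT1 hT2 hT3 hghd}; near: d; exact: hnC.
(* This is how [h / d] becomes small: for small [d] the largest number of sides exceeds this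
   threshold while being at most [Cn * (d / h)], and together these give [K2 * (h / d) <= s1]. *)
have hbig : ((K2 * Cn1 / s1)%:E < max_sides Om Q d)%E.
  by near: d; move/cvgeyPgt: hnoo; apply.
have s_ge0 : 0 <= K2 * (h / d) by rewrite mulr_ge0 ?(ltW K20)// divr_ge0// ltW.
have sle : K2 * (h / d) <= s1.
  move: (lt_le_trans hbig hmax); rewrite lte_fin => lt1.
  have : K2 * Cn1 / s1 <= Cn1 * (d / h).
    apply: le_trans (ltW lt1) _; rewrite ler_wpM2r ?divr_ge0 ?ltW//.
    by rewrite /Cn1 (le_lt_trans (ler_norm _))// ltrDl.
  rewrite ler_pdivrMr// mulrC -mulrA ler_pM2l// => lt2.
  have -> : s1 = d / h * s1 * (h / d) by field; rewrite !gt_eqF.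
  by rewrite ler_wpM2r// divr_ge0// ltW.
have sq : (K2 * (h / d)) ^+ 2 <= s1 ^+ 2 by rewrite ler_sqr ?nnegrE// ltW.
have hs : (K2 * (h / d)) ^+ 2 <= 2^-1.
  apply: (le_trans sq); apply: le_trans (s12); rewrite expr2 ler_piMl ?(ltW s10)//.
  by apply: le_trans s12 _; rewrite invf_le1// ler1n.
have hPhid := HK _ s_ge0 (le_lt_trans sq s1e).
have leAc : (leb2 (Oc Om d : set (plane R)) <= (CA * d)%:E)%E by apply: HCA; rewrite d0.
exact: (@horizon_estimate R Om d h (gam d) (gt d) g (Q d) hOm d0 d1 h0 hd kc mQ Qok
  (f d) f0 g0 (gD d) u0 ut0 (u d) (u0h d h) (gh d h) (T d h)
  delta0 kappa `|CG| `|Cf| `|Cg| `|Ch| C1 C2 c A CA (D0 + 1) M K mu lambda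
  d2 (normr_ge0 _) (normr_ge0 _) CA0 M0 K0 C10 C20 c0 D1 hGd hut0 taylor hloc hext (hfm d d0) hfd hgDd
  mu1 hghd OmD AE leAc hsup hinf hmin hs hPhid hkappa hT1 hT2 hT3 (hgh d h dh) (hu d d0) (hu0h d h dh)).
Unshelve. all: by end_near. Qed.
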